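(* Let $\Phi_S\in C^1(\mathbb{R}^3)$ and suppose that the seminorm $v\mapsto\|v''\|_{L^2(0,L)}$ is a norm on the kernel of $L_{\rm bc}:H^2(0,L;\mathbb{R}^3)\to\mathbb{R}^\ell$ and that $\mathcal{A}\cap H^3(0,L;\mathbb{R}^3)$ is dense in $\mathcal{A}$ with respect to strong convergence in $H^2$. Then the discrete problems of minimizing $I[u_h]=\frac12\int_0^L|u_h''|^2\,dx$ over $u_h\in\mathcal{A}_h$ approximate, as $h\to0$, the problem of minimizing $I[u]=\frac12\int_0^L|u''|^2\,dx$ over $u\in\mathcal{A}$, in the sense of $\Gamma$-convergence with respect to weak convergence in $H^2$: (i) if $u_h\in\mathcal{A}_h$ with $I[u_h]\le c$ for a sequence $h\to0$, then there exist $u\in\mathcal{A}$ and a subsequence (not relabeled) with $u_h\rightharpoonup u$ in $H^2(0,L;\mathbb{R}^3)$ and $I[u]\le\liminf_{h\to0}I[u_h]$; (ii) for every $u\in\mathcal{A}$ there exist $u_h\in\mathcal{A}_h$ with $u_h\to u$ in $H^2(0,L;\mathbb{R}^3)$ and $I[u]=\lim_{h\to0}I[u_h]$; (iii) weak accumulation points in $H^2(0,L;\mathbb{R}^3)$ of sequences $(u_h)_{h>0}$, $u_h\in\mathcal{A}_h$, of quasiminimizers of the discrete problems are minimizers of $I$ over $\mathcal{A}$.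
   Context: Let $L>0$. $S=\{s\in\mathbb{R}^3:\Phi_S(s)=0\}$ is a regular hypersurface ($\Phi_S'\ne0$ on $S$). $L_{\rm bc}:H^2(0,L;\mathbb{R}^3)\to\mathbb{R}^\ell$ is bounded and linear, $L_{\rm bc}[v]$ only depends on the boundary values of $v$ and $v'$, and $\ell_{\rm bc}\in\mathbb{R}^\ell$. The set $\mathcal{A}=\{v\in H^2(0,L;\mathbb{R}^3):|v'|^2=1,\ \Phi_S(v)=0\text{ on }[0,L],\ L_{\rm bc}[v]=\ell_{\rm bc}\}$ is assumed nonempty. For a partition $0=z_0<\dots<z_J=L$ with maximal mesh size $h=\max_j|z_j-z_{j-1}|$ (one arbitrary such partition for each $h$ in a sequence tending to $0$), $V_h$ is the space of all $v_h\in C^1([0,L];\mathbb{R}^3)$ that are componentwise polynomials of degree at most $3$ on each $[z_{j-1},z_j]$, and $\mathcal{A}_h=\{v_h\in V_h:|v_h'(z_j)|=1,\ \Phi_S(v_h(z_j))=0,\ j=0,\dots,J,\ L_{\rm bc}[v_h]=\ell_{\rm bc}\}$. Quasiminimizers: $I[u_h]\le\inf_{\mathcal{A}_h}I+\varepsilon_h$ with $\varepsilon_h\ge 0$, $\varepsilon_h\to0$. *)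

(* Defs.v *)
From mathcomp Require Import all_boot all_order all_algebra.
From mathcomp Require Import all_classical all_reals all_analysis.
Set Implicit Arguments.
Unset Strict Implicit.
Unset Printing Implicit Defensive.
Import Order.TTheory GRing.Theory Num.Theory.
Import numFieldNormedType.Exports.
Local Open Scope classical_set_scope.
Local Open Scope ring_scope.

(** Functions on [0, L] are represented by total functions on [R] whose values
    outside [0, L] are irrelevant. *)

(** [`|v|] on ['rV[R]_m] is the sup norm; Euclidean lengths are therefore
    expressed with [dotp]. *)
Definition dotp (R : realType) (m : nat) (v w : 'rV[R]_m) : R :=
  \sum_(i < m) v 0 i * w 0 i.

Definition enorm (R : realType) (m : nat) (v : 'rV[R]_m) : R :=
  Num.sqrt (dotp v v).

Definition in_L2 (R : realType) (m : nat) (L : R) (v : R -> 'rV[R]_m) : Prop :=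
  forall i : 'I_m,
    measurable_fun `]0, L[ (fun x => v x 0 i) /\
    (@lebesgue_measure R).-integrable `]0, L[ (fun x => ((v x 0 i) ^+ 2)%:E).

Definition L2norm (R : realType) (m : nat) (L : R) (v : R -> 'rV[R]_m) : R :=
  Num.sqrt (\int[@lebesgue_measure R]_(x in `]0, L[) (enorm (v x) ^+ 2)).

(** Weak derivatives are tested against C^1_c(0, L), as in Brezis.  If [b < a]
    the support condition forces [phi] to vanish. *)
Definition test_fun (R : realType) (L : R) (phi : R -> R) : Prop :=
  [/\ forall x, derivable phi x 1,
      continuous (derive1 phi) &
      exists a b : R, [/\ 0 < a, b < L &
        forall x, x \notin `[a, b] -> phi x = 0]].

Definition is_wderiv (R : realType) (m : nat) (L : R)
    (v g : R -> 'rV[R]_m) : Prop :=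
  [/\ in_L2 L v, in_L2 L g &
      forall (i : 'I_m) (phi : R -> R), test_fun L phi ->
        \int[@lebesgue_measure R]_(x in `]0, L[) (v x 0 i * derive1 phi x) =
        - \int[@lebesgue_measure R]_(x in `]0, L[) (g x 0 i * phi x)].

Fixpoint sobolev (R : realType) (m : nat) (L : R) (k : nat)
    (v : R -> 'rV[R]_m) : Prop :=
  if k is k'.+1 then exists2 g, is_wderiv L v g & sobolev L k' g
  else in_L2 L v.

(** Elements of H^2(0, L; R^m), each identified with its representative that is
    continuous on [0, L], so that pointwise and boundary values make sense. *)
Definition H2 (R : realType) (m : nat) (L : R) : set (R -> 'rV[R]_m) :=
  [set v | sobolev L 2 v /\ {within `[0, L], continuous v}].

(** The weak derivative: the representative continuous on [0, L] when there is
    one, otherwise an arbitrary representative. Hence, for [v] in [H2 L],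
    [wderiv L v] is the continuous function v' on [0, L], and
    [wderiv L (wderiv L v)] represents the class of v''. *)
Definition wderiv (R : realType) (m : nat) (L : R) (v : R -> 'rV[R]_m) :
    R -> 'rV[R]_m :=
  xget (xget (fun=> 0) [set g | is_wderiv L v g])
       [set g | is_wderiv L v g /\ {within `[0, L], continuous g}].

Definition H2norm (R : realType) (m : nat) (L : R) (v : R -> 'rV[R]_m) : R :=
  Num.sqrt (L2norm L v ^+ 2 + L2norm L (wderiv L v) ^+ 2 +
            L2norm L (wderiv L (wderiv L v)) ^+ 2).

(** Only the values of [F] on [H2 L] matter; boundedness does not depend on the
    norm chosen on a finite-dimensional codomain. *)
Definition bounded_linear_H2 (R : realType) (m : nat) (L : R)
    (W : normedModType R) (F : (R -> 'rV[R]_m) -> W) : Prop :=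
  (forall (a : R) (v w : R -> 'rV[R]_m), H2 L v -> H2 L w ->
     F (fun x => a *: v x + w x) = a *: F v + F w) /\
  (exists C : R, forall v, H2 L v -> `|F v| <= C * H2norm L v).

Definition boundary_only (R : realType) (m ell : nat) (L : R)
    (F : (R -> 'rV[R]_m) -> 'rV[R]_ell) : Prop :=
  forall v w, H2 L v -> H2 L w ->
    v 0 = w 0 -> v L = w L ->
    wderiv L v 0 = wderiv L w 0 -> wderiv L v L = wderiv L w L ->
    F v = F w.

(** [v |-> L2norm L v''] is always a seminorm on H^2, so being a norm on the
    kernel of [F] means being definite there. *)
Definition norm_on_kernel (R : realType) (m ell : nat) (L : R)
    (F : (R -> 'rV[R]_m) -> 'rV[R]_ell) : Prop :=
  forall v, H2 L v -> F v = 0 -> L2norm L (wderiv L (wderiv L v)) = 0 ->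
    forall x, x \in `[0, L] -> v x = 0.

Definition H2_strong_cvg (R : realType) (m : nat) (L : R)
    (u_ : nat -> R -> 'rV[R]_m) (u : R -> 'rV[R]_m) : Prop :=
  H2norm L (fun x => u_ n x - u x) @[n --> \oo] --> (0 : R).

Definition H2_weak_cvg (R : realType) (m : nat) (L : R)
    (u_ : nat -> R -> 'rV[R]_m) (u : R -> 'rV[R]_m) : Prop :=
  forall F : (R -> 'rV[R]_m) -> R^o, bounded_linear_H2 L F ->
    F (u_ n) @[n --> \oo] --> F u.

Definition C1_fun (R : realType) (m : nat) (Phi : 'rV[R]_m -> R) : Prop :=
  (forall s, differentiable Phi s) /\
  (forall w, continuous (fun s => 'd Phi s w)).

Definition regular_zero_set (R : realType) (m : nat) (Phi : 'rV[R]_m -> R) :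
    Prop :=
  forall s, Phi s = 0 -> exists w, 'd Phi s w <> 0.

Definition bending_energy (R : realType) (m : nat) (L : R)
    (v : R -> 'rV[R]_m) : R :=
  2^-1 * \int[@lebesgue_measure R]_(x in `]0, L[)
           (enorm (wderiv L (wderiv L v) x) ^+ 2).

Definition admissible (R : realType) (ell : nat) (L : R) (Phi : 'rV[R]_3 -> R)
    (Lbc : (R -> 'rV[R]_3) -> 'rV[R]_ell) (lbc : 'rV[R]_ell) :
    set (R -> 'rV[R]_3) :=
  [set v | [/\ H2 L v,
    forall x, x \in `[0, L] -> enorm (wderiv L v x) ^+ 2 = 1,
    forall x, x \in `[0, L] -> Phi (v x) = 0 &
    Lbc v = lbc]].

Definition is_partition (R : realType) (L : R) (J : nat) (z : nat -> R) : Prop :=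
  [/\ z 0%N = 0, z J = L & forall j, (j < J)%N -> z j < z j.+1].

Definition mesh_size (R : realType) (J : nat) (z : nat -> R) : R :=
  \big[Num.max/0]_(j < J) `|z j.+1 - z j|.

Definition C1_on (R : realType) (m : nat) (L : R) (v : R -> 'rV[R]_m) : Prop :=
  {within `[0, L], continuous v} /\
  exists2 g : R -> 'rV[R]_m, {within `[0, L], continuous g} &
    forall x : R, x \in `]0, L[ -> is_derive x 1 v (g x).

Definition C1_cubics (R : realType) (m : nat) (L : R) (J : nat) (z : nat -> R) :
    set (R -> 'rV[R]_m) :=
  [set v | C1_on L v /\
    forall (j : nat) (i : 'I_m), (j < J)%N ->
      exists2 p : {poly R}, (size p <= 4)%N &
        forall x, x \in `[z j, z j.+1] -> v x 0 i = p.[x]].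

Definition discrete_admissible (R : realType) (ell : nat) (L : R)
    (Phi : 'rV[R]_3 -> R) (Lbc : (R -> 'rV[R]_3) -> 'rV[R]_ell)
    (lbc : 'rV[R]_ell) (J : nat) (z : nat -> R) : set (R -> 'rV[R]_3) :=
  [set v | [/\ C1_cubics L J z v,
    forall j, (j <= J)%N -> enorm (wderiv L v (z j)) = 1,
    forall j, (j <= J)%N -> Phi (v (z j)) = 0 &
    Lbc v = lbc]].

(* Main.v *)
Require Import Defs.
From HB Require Import structures.
From mathcomp Require Import all_boot all_order all_algebra.
From mathcomp Require Import all_classical all_reals all_analysis.
From mathcomp Require Import measurable_realfun lra ring.
Set Implicit Arguments.
Unset Strict Implicit.
Unset Printing Implicit Defensive.
Import Order.TTheory GRing.Theory Num.Theory.
Import numFieldNormedType.Exports.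
Local Open Scope classical_set_scope.
Local Open Scope ring_scope.

(** On H^2 the quantity |v(0)|^2 + |v'(0)|^2 + int |v''|^2 ([NN] below) is a
    Hilbertian norm equivalent to the usual one, and coercivity of the energy on
    the constrained set follows because [Lbc] is injective on affine functions.
    Bounded sequences have weakly convergent subsequences: extract pointwise
    convergence on a countable dense set, and use Mazur's lemma to find the limit
    and to upgrade pointwise to weak convergence.  The constraints, imposed only
    at the nodes, pass to the limit by the uniform Hoelder-1/2 bounds on v and v'.
    For the recovery sequence take the cubic Hermite interpolants w of u at the
    nodes: they are discretely admissible, and w'' is L^2-orthogonal to
    (u - w)'', so int |u'' - w''|^2 = int |u''|^2 - int |w''|^2.  In particular
    the w are bounded, hence converge weakly to u, and lower semicontinuity makes
    the right-hand side tend to 0. *)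

(** * Integrals over intervals *)

Section interval_integrals.
Context {R : realType}.
Implicit Types (a b c x y k : R) (f g h : R -> R).
Local Notation mu := (@lebesgue_measure R).

(** The obstacle behind much of the groundwork is that [wderiv] is a choice: for v in H^2 it fixes
    v' only on [0, L] and v'' only almost everywhere. Computations are therefore carried out on
    triples (v, v1, v2) linked by explicit primitives ([prim], [H2rep]). The du Bois-Reymond lemma
    provides such a triple for every element of H^2, and uniqueness of primitives transfers the
    results back to [wderiv]. In the norm [NN] an element of H^2 is nothing but the data v(0), v'(0)
    and v'', so completeness reduces to that of R and L^2. Functionals are never represented by the
    inner product: Mazur's lemma needs only completeness and the parallelogram identity, and weak
    convergence is then tested on half-spaces. Both endpoints are nodes of every partition. Hence
    Hermite interpolation preserves the boundary condition and the part of [NN] located at 0, and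
    the interpolation error is measured by v'' alone. *)

Definition ible a b f := mu.-integrable `]a, b[ (EFin \o f).
Definition rint a b f : R := \int[mu]_(x in `]a, b[) f x.
Definition sqi a b f := measurable_fun `]a, b[ f /\
  mu.-integrable `]a, b[ (fun x => ((f x) ^+ 2)%:E).

Lemma ible_meas a b f : ible a b f -> measurable_fun `]a, b[ f.
Proof. by move=> /measurable_int /measurable_EFinP. Qed.

Lemma ible_sub a b c d f : a <= c -> d <= b -> ible a b f -> ible c d f.
Proof.
move=> ac db; apply: integrableS => //.
by apply: subset_itv; rewrite bnd_simp.
Qed.

Lemma eq_ible a b f g : {in `]a, b[, f =1 g} -> ible a b f -> ible a b g.
Proof.
move=> fg; apply: eq_integrable => // x; rewrite inE /= => xab.
by rewrite fg.
Qed.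

Lemma eq_rint a b f g : {in `]a, b[, f =1 g} -> rint a b f = rint a b g.
Proof. by move=> fg; apply: eq_Rintegral => x; rewrite inE /= => /fg. Qed.

Lemma ibleZ a b k f : ible a b f -> ible a b (fun x => k * f x).
Proof. rewrite /ible => fi;
by have := @integrableZl _ _ _ mu _ (measurable_itv _) k _ fi; apply: eq_integrable. Qed.

Lemma ibleD a b f g : ible a b f -> ible a b g -> ible a b (fun x => f x + g x).
Proof. rewrite /ible => fi gi;
by have := @integrableD _ _ _ mu _ (measurable_itv _) _ _ fi gi; apply: eq_integrable. Qed.

Lemma ibleB a b f g : ible a b f -> ible a b g -> ible a b (fun x => f x - g x).
Proof. rewrite /ible => fi gi;
by have := @integrableB _ _ _ mu _ (measurable_itv _) _ _ fi gi; apply: eq_integrable. Qed.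

Lemma ible_norm a b f : ible a b f -> ible a b (fun x => `|f x|).
Proof. exact: integrable_norm. Qed.

Lemma mu_oo_lty a b : (mu `]a, b[ < +oo)%E.
Proof. by rewrite lebesgue_measure_itv /=; case: ifP => _; rewrite ?ltry. Qed.

Lemma ible_cst a b k : ible a b (fun=> k).
Proof. apply: measurable_bounded_integrable => //; first exact: mu_oo_lty.
by exists `|k|; split => // M Mk x _ /=; exact: ltW. Qed.

Lemma rintZ a b k f : ible a b f -> rint a b (fun x => k * f x) = k * rint a b f.
Proof. by move=> ?; apply: RintegralZl. Qed.

Lemma rintD a b f g : ible a b f -> ible a b g ->
  rint a b (fun x => f x + g x) = rint a b f + rint a b g.
Proof. by move=> ? ?; apply: RintegralD. Qed.

Lemma rintB a b f g : ible a b f -> ible a b g ->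
  rint a b (fun x => f x - g x) = rint a b f - rint a b g.
Proof. by move=> ? ?; apply: RintegralB. Qed.

Lemma rint_ge0 a b f : (forall x, 0 <= f x) -> 0 <= rint a b f.
Proof. by move=> f0; apply: Rintegral_ge0. Qed.

Lemma ler_rint a b f g : ible a b f -> ible a b g ->
  {in `]a, b[, forall x, f x <= g x} -> rint a b f <= rint a b g.
Proof. by move=> ? ? fg; apply: le_Rintegral => // x; exact: fg. Qed.

Lemma normr_rint a b f : ible a b f -> `|rint a b f| <= rint a b (fun x => `|f x|).
Proof. by move=> ?; apply: le_normr_Rintegral. Qed.

Lemma rint_cst a b k : a <= b -> rint a b (fun=> k) = k * (b - a).
Proof.
move=> ab; rewrite /rint Rintegral_cst //= lebesgue_measure_itv /= lte_fin.
by case: ltgtP ab => //= -> _; rewrite subrr.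
Qed.

Lemma rint_nil a f : rint a a f = 0.
Proof. by rewrite /rint set_itv_ge ?Rintegral_set0 // bnd_simp ltxx. Qed.

Lemma rint_cat a c b f : a <= c -> c <= b -> ible a b f ->
  rint a b f = rint a c f + rint c b f.
Proof.
rewrite [c <= b]le_eqVlt => ac /predU1P[->|cb] fi; first by rewrite rint_nil addr0.
have := @Rintegral_itvB _ f (BRight a) (BLeft b) c fi.
rewrite !bnd_simp => /(_ ac cb) /eqP; rewrite subr_eq => /eqP.
rewrite /rint => ->; rewrite addrC Rintegral_itv_bndo_bndc //.
by apply: ible_sub fi => //; exact: ltW.
Qed.

Lemma rint_mono a b c d f : a <= c -> c <= d -> d <= b -> ible a b f ->
  {in `]a, b[, forall x, 0 <= f x} -> rint c d f <= rint a b f.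
Proof.
move=> ac cd db fi f0.
have pos p q : a <= p -> q <= b -> 0 <= rint p q f.
  move=> ap qb; apply: Rintegral_ge0 => x /= xi; apply: f0.
  by apply: subset_itv xi; rewrite bnd_simp.
rewrite (@rint_cat a c b) ?(le_trans cd) // (@rint_cat c d b) //; last first.
  by apply: ible_sub fi.
have := pos a c (lexx _) (le_trans cd db); have := pos d b (le_trans ac cd) (lexx _).
lra.
Qed.

Lemma sqi_sub a b c d f : a <= c -> d <= b -> sqi a b f -> sqi c d f.
Proof.
move=> ac db [mf f2].
have s : `]c, d[ `<=` `]a, b[ by apply: subset_itv; rewrite bnd_simp.
split; [exact: measurable_funS mf|exact: integrableS f2].
Qed.

Lemma eq_sqi a b f g : {in `]a, b[, f =1 g} -> sqi a b f -> sqi a b g.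
Proof.
move=> fg [mf f2]; split.
  apply: eq_measurable_fun mf => x; rewrite inE /= => xab; exact: fg.
by apply: eq_integrable f2 => // x; rewrite inE /= => xab; rewrite fg.
Qed.

Lemma sqi_ible2 a b f : sqi a b f -> ible a b (fun x => f x ^+ 2).
Proof. by case. Qed.

Lemma sqi_mul a b f g : sqi a b f -> sqi a b g -> ible a b (fun x => f x * g x).
Proof.
move=> [mf f2] [mg g2].
have := ibleD f2 g2; apply: le_integrable => //.
  by apply/measurable_EFinP; apply: measurable_funM.
move=> x _ /=; rewrite lee_fin normrM.
rewrite [leRHS]ger0_norm ?addr_ge0 ?sqr_ge0 // -(real_normK (num_real (f x))).
rewrite -(real_normK (num_real (g x))).
have := normr_ge0 (f x); have := normr_ge0 (g x).
move: `|f x| `|g x| => u v ? ?; have := sqr_ge0 (u - v); nra.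
Qed.

Lemma sqi_cst a b k : sqi a b (fun=> k).
Proof. by split; [exact: measurable_cst|exact: ible_cst]. Qed.

Lemma sqi_ible a b f : sqi a b f -> ible a b f.
Proof.
move=> sf; have := sqi_mul sf (sqi_cst a b 1).
by apply: eq_ible => x _; rewrite mulr1.
Qed.

Lemma sqiZ a b k f : sqi a b f -> sqi a b (fun x => k * f x).
Proof.
move=> [mf f2]; split; first exact: measurable_funM.
have := ibleZ (k ^+ 2) f2; apply: eq_ible => x _ /=; by rewrite exprMn.
Qed.

Lemma sqiD a b f g : sqi a b f -> sqi a b g -> sqi a b (fun x => f x + g x).
Proof.
move=> sf sg; split; first by apply: measurable_funD; [case: sf|case: sg].
have := ibleD (ibleD sf.2 (ibleZ 2 (sqi_mul sf sg))) sg.2.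
by apply: eq_ible => x _ /=; ring.
Qed.

Lemma sqiB a b f g : sqi a b f -> sqi a b g -> sqi a b (fun x => f x - g x).
Proof.
move=> sf sg; have := sqiD sf (sqiZ (-1) sg).
by apply: eq_sqi => x _; rewrite mulN1r.
Qed.

(** The integral of (s f + t g)^2 is a nonnegative quadratic form in (s, t); evaluating it at
    suitable pairs yields the discriminant inequality without square roots. *)
Lemma cauchy_schwarz_rint a b f g : sqi a b f -> sqi a b g ->
  (rint a b (fun x => f x * g x)) ^+ 2 <=
  rint a b (fun x => f x ^+ 2) * rint a b (fun x => g x ^+ 2).
Proof.
move=> sf sg.
set A := rint a b (fun x => f x ^+ 2); set B := rint a b (fun x => g x ^+ 2).
set C := rint a b (fun x => f x * g x).
have A0 : 0 <= A by apply: rint_ge0 => x; exact: sqr_ge0.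
have B0 : 0 <= B by apply: rint_ge0 => x; exact: sqr_ge0.
have q (s t : R) : 0 <= s ^+ 2 * A + 2 * s * t * C + t ^+ 2 * B.
  suff -> : s ^+ 2 * A + 2 * s * t * C + t ^+ 2 * B =
            rint a b (fun x => (s * f x + t * g x) ^+ 2).
    by apply: rint_ge0 => x; exact: sqr_ge0.
  have e1 := ibleZ (s ^+ 2) (sqi_ible2 sf).
  have e2 := ibleZ (2 * s * t) (sqi_mul sf sg).
  have e3 := ibleZ (t ^+ 2) (sqi_ible2 sg).
  rewrite -!rintZ //; [|exact: sqi_ible2|exact: sqi_mul|exact: sqi_ible2].
  rewrite -rintD // -rintD //; last exact: ibleD.
  by apply: eq_rint => x _; ring.
(* For B = 0 the pair (C, -(A + 1)) gives -(A + 2) C^2 >= 0, hence C = 0; otherwise (B, -C) gives B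
   (A B - C^2) >= 0. *)
have [B00|B1] := eqVneq B 0.
  have := q C (- (A + 1)); rewrite B00.
  have C0 := sqr_ge0 C; have C2 := mulr_ge0 A0 C0 => h.
  by rewrite mulr0; nra.
have Bp : 0 < B by rewrite lt_neqAle eq_sym B1.
have := q B (- C); rewrite -subr_ge0 => h.
have : 0 <= B * (A * B - C ^+ 2) by move: h; rewrite subr0; nra.
by rewrite pmulr_rge0 // subr_ge0.
Qed.

End interval_integrals.

(** * Primitives of square integrable functions *)

Section primitives.
Context {R : realType}.
Implicit Types (a b c x y k : R) (f g h v w phi : R -> R).
Local Notation mu := (@lebesgue_measure R).

Lemma within_continuous_sub a b c d f : a <= c -> d <= b ->
  {within `[a, b], continuous f} -> {within `[c, d], continuous f}.
Proof.
move=> ac db; apply: continuous_subspaceW.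
by apply: subset_itv; rewrite bnd_simp.
Qed.

Lemma sqi_continuous a b f : {within `[a, b], continuous f} -> sqi a b f.
Proof.
move=> fc; have s : `]a, b[ `<=` `[a, b] by apply: subset_itv; rewrite bnd_simp.
split.
  apply: measurable_funS s _ => //.
  by apply: subspace_continuous_measurable_fun.
apply: (@integrableS _ _ _ mu `[a, b]) => //; apply: continuous_compact_integrable.
  exact: segment_compact.
by move=> x; apply: cvgM; exact: fc.
Qed.

Lemma rint_derive a b (F f : R -> R) : a <= b ->
  {within `[a, b], continuous F} -> {within `[a, b], continuous f} ->
  {in `]a, b[, forall x, is_derive x 1 F (f x)} ->
  rint a b f = F b - F a.
Proof.
rewrite le_eqVlt => /predU1P[->|ab] Fc fc Ff; first by rewrite rint_nil subrr.
have dF : derivable_oo_LRcontinuous F a b.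
  have /(continuous_within_itvP _ ab)[_ Fa Fb] := Fc.
  by split => // x /Ff [].
have F'f : {in `]a, b[, derive1 F =1 f}.
  by move=> x /Ff fx; rewrite derive1E derive_val.
have := continuous_FTC2 ab fc dF F'f.
rewrite /rint /Rintegral -EFinB -integral_itv_obnd_cbnd; last first.
  by apply/measurable_EFinP; apply/measurable_fun_itv_bndo_bndcP; have [] := sqi_continuous fc.
rewrite -integral_itv_bndo_bndc; last by apply/measurable_EFinP; have [] := sqi_continuous fc.
by move=> ->.
Qed.

(** The integral starts at [a], so two-sided differentiability is only obtained to the right of it;
    a base point left of an interval gives a primitive differentiable on the whole closed
    interval. *)
Lemma ex_primitive_gt a g : continuous g ->
  exists W, forall x, a < x -> is_derive x 1 W (g x).
Proof.
move=> gc; exists (fun y => \int[mu]_(t in `[a, y]) g t) => x ax.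
have gi : mu.-integrable `[a, x + 1] (EFin \o g).
  apply: continuous_compact_integrable; first exact: segment_compact.
  by apply: continuous_subspaceT.
have [||d e] := @continuous_FTC1_closed R g a x (x + 1) _ gi ax.
- by rewrite ltrDl.
- exact: gc.
by rewrite derive1E in e; exact: (DeriveDef d e).
Qed.

Lemma continuous_bounded_itv a b f : a <= b -> {within `[a, b], continuous f} ->
  exists2 M, 0 <= M & {in `[a, b], forall x, `|f x| <= M}.
Proof.
move=> ab fc; have nc : {within `[a, b], continuous (fun x => `|f x|)}.
  by move=> x; apply: cvg_norm; exact: fc.
have [c cab cM] := EVT_max ab nc.
by exists (`|f c|) => // x /cM.
Qed.

Lemma ible_cat a c b f : a <= c -> c <= b -> ible a c f -> ible c b f -> ible a b f.
Proof.
rewrite le_eqVlt => /predU1P[->//|ac].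
rewrite le_eqVlt => /predU1P[->//|cb] fac fcb.
have mac := ible_meas fac; have mcb := ible_meas fcb.
have mcb' : measurable_fun `[c, b[ f by apply/measurable_fun_itv_obnd_cbndP.
have E : `]a, b[%classic = `]a, c[ `|` `[c, b[ :> set R.
  by apply: itv_bndbnd_setU; rewrite bnd_simp // ltW.
have mab : measurable_fun `]a, b[ f.
  by rewrite E; apply/measurable_funU.
apply/integrableP; split; first exact/measurable_EFinP.
rewrite E ge0_integral_setU //=.
- rewrite -[X in (_ + X < _)%E]integral_itv_obnd_cbnd; last first.
    by apply/measurable_EFinP; exact: measurableT_comp.
  by apply: lte_add_pinfty; [case/integrableP: fac|case/integrableP: fcb].
- by apply/measurable_EFinP; rewrite -E; exact: measurableT_comp.
- apply/disj_setPS => y [/=]; rewrite !in_itv /= => /andP[_ yc] /andP[].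
  by rewrite leNgt yc.
Qed.

Lemma sqi_cat a c b f : a <= c -> c <= b -> sqi a c f -> sqi c b f -> sqi a b f.
Proof.
move=> ac cb fac fcb; split; last exact: ible_cat ac cb fac.2 fcb.2.
exact: ible_meas (ible_cat ac cb (sqi_ible fac) (sqi_ible fcb)).
Qed.

(** The one-dimensional H^1: v is absolutely continuous on [a, b] with a square integrable
    derivative, of which g is any representative. *)
Definition prim a b v g := sqi a b g /\
  {in `[a, b], forall x, v x = v a + rint a x g}.

Lemma prim_diff a b v g x y : prim a b v g -> a <= x -> x <= y -> y <= b ->
  v y - v x = rint x y g.
Proof.
move=> [sg vg] ax xy yb.
rewrite vg ?in_itv /= ?ax ?yb ?(le_trans ax) //.
rewrite (vg x) ?in_itv /= ?ax ?(le_trans xy) //.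
rewrite (@rint_cat _ a x y) //; first by ring.
by apply: ible_sub (sqi_ible sg).
Qed.

Lemma prim_sub a b c d v g : a <= c -> d <= b -> prim a b v g -> prim c d v g.
Proof.
move=> ac db vg; split; first by apply: sqi_sub vg.1.
move=> x /[!in_itv] /= /andP[cx xd].
by rewrite -(prim_diff vg ac cx (le_trans xd db)) subrKC.
Qed.

Lemma prim_lin a b k v g w h : prim a b v g -> prim a b w h ->
  prim a b (fun x => k * v x + w x) (fun x => k * g x + h x).
Proof.
move=> [sg vg] [sh wh]; split; first by apply: sqiD => //; exact: sqiZ.
move=> x /[dup] xab /[!in_itv] /= /andP[ax xb].
have ig : ible a x g by apply: ible_sub (sqi_ible sg).
have ih : ible a x h by apply: ible_sub (sqi_ible sh).
rewrite rintD //; last exact: ibleZ.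
by rewrite rintZ // vg // wh //; ring.
Qed.

Lemma eq_prim a b v g w h : {in `[a, b], v =1 w} -> {in `]a, b[, g =1 h} ->
  prim a b v g -> prim a b w h.
Proof.
move=> vw gh [sg vg]; split; first by apply: eq_sqi sg.
move=> x /[dup] xab /[!in_itv] /= /andP[ax xb].
rewrite -!vw //; last by rewrite in_itv /= lexx (le_trans ax).
rewrite vg //; congr (_ + _); apply: eq_rint => y /[!in_itv] /= /andP[ay yx].
by apply: gh; rewrite in_itv /= ay (lt_le_trans yx).
Qed.

Lemma prim_cat a c b v g h : a <= c -> c <= b -> prim a c v g -> prim c b v h ->
  prim a b v (fun x => if x < c then g x else h x).
Proof.
move=> ac cb vg vh; set k := fun x => _.
have kg : {in `]a, c[, g =1 k}.
  by move=> x /[!in_itv] /= /andP[_ xc]; rewrite /k xc.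
have kh : {in `]c, b[, h =1 k}.
  by move=> x /[!in_itv] /= /andP[cx _]; rewrite /k ltNge (ltW cx).
have {}vg : prim a c v k by apply: eq_prim vg.
have {}vh : prim c b v k by apply: eq_prim vh.
have sk : sqi a b k by apply: sqi_cat vg.1 vh.1.
split => // x /[!in_itv] /= /andP[ax xb].
have [xc|cx] := leP x c; first by rewrite vg.2 // in_itv /= ax.
rewrite (@rint_cat _ a c x) //; [|exact: ltW|].
  rewrite vh.2 ?in_itv /= ?(ltW cx) // (vg.2 c) ?in_itv /= ?lexx ?ac //.
  by rewrite addrA.
by apply: ible_sub (sqi_ible sk).
Qed.

(** Cauchy-Schwarz for g against the constant 1 on [x, y]; this is where the Hoelder exponent 1/2
    comes from. *)
Lemma prim_holder a b v g x y : prim a b v g -> a <= x -> x <= y -> y <= b ->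
  (v y - v x) ^+ 2 <= (y - x) * rint a b (fun t => g t ^+ 2).
Proof.
move=> vg ax xy yb; rewrite (prim_diff vg) //.
have sg : sqi x y g by apply: sqi_sub vg.1.
have := cauchy_schwarz_rint (sqi_cst x y 1) sg.
under eq_rint do rewrite mul1r.
move=> /le_trans; apply.
rewrite [rint x y _](_ : _ = y - x); last first.
  by rewrite -[RHS]mul1r -rint_cst //; apply: eq_rint => t _; rewrite expr1n.
apply: ler_wpM2l; first by rewrite subr_ge0.
apply: rint_mono => //; first exact: sqi_ible2 vg.1.
by move=> t _; exact: sqr_ge0.
Qed.

Lemma prim_continuous a b v g : prim a b v g -> {within `[a, b], continuous v}.
Proof.
move=> vg; apply/subspace_continuousP => x /= xab.
set M := rint a b (fun t => g t ^+ 2).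
have M0 : 0 <= M by apply: rint_ge0 => t; exact: sqr_ge0.
apply/cvgrPdist_lt => e e0.
have d0 : 0 < e ^+ 2 / (M + 1) by rewrite divr_gt0 ?exprn_gt0 // ltr_pwDr.
near=> y.
have yab : y \in `[a, b] by near: y; exact: withinT.
have xy : `|x - y| < e ^+ 2 / (M + 1).
  by near: y; apply: cvg_within; exact: nbhsx_ballx.
move: xab yab; rewrite /= !in_itv /= => /andP[ax xb] /andP[ay yb].
rewrite -ltr_sqr ?nnegrE ?(ltW e0) // real_normK ?num_real //.
have : (v x - v y) ^+ 2 <= `|x - y| * M.
  have [le|/ltW le] := leP x y.
    by rewrite -sqrrN opprB distrC ger0_norm ?subr_ge0 //; apply: prim_holder vg _ _ _.
  by rewrite ger0_norm ?subr_ge0 //; apply: prim_holder vg _ _ _.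
move=> /le_lt_trans; apply.
move: xy; rewrite ltr_pdivlMr ?ltr_pwDr //; apply: le_lt_trans.
by apply: ler_wpM2l => //; rewrite lerDl.
Unshelve. all: by end_near.
Qed.

Lemma prim_sup a b v g x : prim a b v g -> x \in `[a, b] ->
  v x ^+ 2 <= 2 * v a ^+ 2 + 2 * (b - a) * rint a b (fun t => g t ^+ 2).
Proof.
move=> vg /[!in_itv] /= /andP[ax xb].
have := prim_holder vg (lexx a) ax xb.
have : 0 <= rint a b (fun t => g t ^+ 2) by apply: rint_ge0 => t; exact: sqr_ge0.
move: (rint _ _ _) => M M0 h.
have : (x - a) * M <= (b - a) * M by apply: ler_wpM2r => //; lra.
(* This square is the slack in v(x)^2 <= 2 (v(x) - v(a))^2 + 2 v(a)^2. *)
have := sqr_ge0 (v x - 2 * v a).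
nra.
Qed.

Lemma prim_sqi_fun a b v g : prim a b v g -> sqi a b v.
Proof. by move=> /prim_continuous /sqi_continuous. Qed.

Lemma prim_rint_sqr a b v g : a <= b -> prim a b v g ->
  rint a b (fun x => v x ^+ 2) <=
  (b - a) * (2 * v a ^+ 2 + 2 * (b - a) * rint a b (fun t => g t ^+ 2)).
Proof.
move=> ab vg; rewrite [leRHS]mulrC; set K := 2 * _ + _.
rewrite -(rint_cst K ab); apply: ler_rint.
- exact: sqi_ible2 (prim_sqi_fun vg).
- exact: ible_cst.
move=> x /[!in_itv] /= /andP[ax xb].
by apply: prim_sup vg _; rewrite in_itv /= !ltW.
Qed.

(** The pointwise bound v(x)^2 <= 2 v(y)^2 + 2 (b - a) G is integrated over y: point values are
    controlled by the H^1 norm. *)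
Lemma prim_eval a b v g x : a < b -> prim a b v g -> x \in `[a, b] ->
  (b - a) * v x ^+ 2 <= 2 * rint a b (fun t => v t ^+ 2) +
    2 * (b - a) ^+ 2 * rint a b (fun t => g t ^+ 2).
Proof.
move=> ab vg xab; have iv := sqi_ible2 (prim_sqi_fun vg).
set G := rint a b (fun t => g t ^+ 2).
have G0 : 0 <= G by apply: rint_ge0 => t; exact: sqr_ge0.
have -> : 2 * rint a b (fun t => v t ^+ 2) + 2 * (b - a) ^+ 2 * G =
   rint a b (fun t => 2 * v t ^+ 2 + 2 * (b - a) * G).
  rewrite rintD ?rintZ ?rint_cst //; [by ring|exact: ltW|exact: ible_cst|exact: ibleZ|exact: ible_cst].
rewrite mulrC -(rint_cst (v x ^+ 2) (ltW ab)); apply: ler_rint.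
- exact: ible_cst.
- by apply: ibleD; [exact: ibleZ|exact: ible_cst].
move: xab; rewrite in_itv /= => /andP[ax xb] y /[!in_itv] /= /andP[/ltW ay /ltW yb].
have : (v x - v y) ^+ 2 <= (b - a) * G.
  have [le|/ltW le] := leP x y.
    rewrite -sqrrN opprB; apply: le_trans (prim_holder vg ax le yb) _.
    by apply: ler_wpM2r => //; lra.
  apply: le_trans (prim_holder vg ay le xb) _.
  by apply: ler_wpM2r => //; lra.
have := sqr_ge0 (v x - 2 * v y); nra.
Qed.

End primitives.

(** * Uniqueness of primitives and the du Bois-Reymond lemma *)

Section weak_derivatives.
Context {R : realType}.
Implicit Types (a b c x y k : R) (f g h v w phi psi : R -> R).
Local Notation mu := (@lebesgue_measure R).

Lemma ge_cvg (u : nat -> R) (l c : R) : u n @[n --> \oo] --> l ->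
  (forall n, c <= u n) -> c <= l.
Proof.
move=> ul cu; rewrite -(cvg_lim _ ul) //; apply: limr_ge; first exact: cvgP ul.
exact: nearW.
Qed.

Lemma ae_imp (P Q : R -> Prop) : (forall x, P x -> Q x) ->
  {ae mu, forall x, P x} -> {ae mu, forall x, Q x}.
Proof. move=> PQ; apply: filterS; first exact: (ae_filter_ringOfSetsType mu).
by move=> x; exact: PQ. Qed.

(** After extension by zero, the indefinite integral of f vanishes near each point of the interval,
    so its derivative there is 0; by Lebesgue's differentiation theorem that derivative is f almost
    everywhere. *)
Lemma rint_zero_ae a b f : ible a b f -> {in `]a, b[, forall x, rint a x f = 0} ->
  {ae mu, forall x, x \in `]a, b[ -> f x = 0}.
Proof.
move=> fi f0; set kk := f \_ `]a, b[.
have kki : mu.-integrable setT (EFin \o kk).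
  suff : mu.-integrable setT ((EFin \o f) \_ `]a, b[) by rewrite restrict_EFin.
  have [h _] := @integrable_mkcond _ _ _ mu `]a, b[ (EFin \o f) (measurable_itv _).
  exact: h fi.
have kloc : locally_integrable setT kk by exact: integrable_locally_restrict.
have kY y : mu.-integrable `]-oo, y] (EFin \o kk).
  by apply: (@integrableS _ _ _ mu setT).
have := FTC1Ny kY kloc; set F := fun x : R => \int[mu]_(t in `]-oo, x]) kk t.
apply: ae_imp => x [dF F'x] xab.
have F0 : {near x, F =1 cst (0 : R)}.
  near=> y.
  have yab : y \in `]a, b[ by near: y; exact: near_in_itvoo.
  rewrite /F /kk -Rintegral_mkcondr /=.
  have -> : `]-oo, y] `&` `]a, b[ = `]a, y]%classic :> set R.
    move: yab; rewrite in_itv /= => /andP[ay yb].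
    apply/seteqP; split=> t /=; rewrite !in_itv /=; first by move=> [-> /andP[->]].
    by move=> /andP[-> ty]; split => //=; exact: le_lt_trans yb.
  rewrite -Rintegral_itv_bndo_bndc; first exact: f0.
  by apply: ible_sub fi => //; move: yab; rewrite in_itv /= => /andP[_ /ltW].
have : F^`()%classic x = 0.
  by rewrite derive1E (near_eq_derive _ F0) ?derive_cst.
by rewrite F'x /kk patchE mem_set.
Unshelve. all: by end_near.
Qed.

Lemma ae_eq_rint a b f g : measurable_fun `]a, b[ f -> measurable_fun `]a, b[ g ->
  {ae mu, forall x, x \in `]a, b[ -> f x = g x} -> rint a b f = rint a b g.
Proof.
move=> mf mg fg; rewrite /rint /Rintegral; congr fine.
apply: ae_eq_integral => //; [exact/measurable_EFinP..|].
by apply: ae_imp fg => x h /h /= ->.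
Qed.

Lemma prim_uniq a b v w g h : prim a b v g -> prim a b w h ->
  {in `[a, b], v =1 w} -> {ae mu, forall x, x \in `]a, b[ -> g x = h x}.
Proof.
move=> [sg vg] [sh wh] vw.
have ig := sqi_ible sg; have ih := sqi_ible sh.
have := @rint_zero_ae a b (fun x => g x - h x) (ibleB ig ih).
move=> H; suff {}/H : {in `]a, b[, forall x, rint a x (fun x => g x - h x) = 0}.
  by apply: ae_imp => x h0 /h0 /eqP; rewrite subr_eq0 => /eqP.
move=> x /[!in_itv] /= /andP[/ltW ax /ltW xb].
rewrite rintB; [|exact: ible_sub ig|exact: ible_sub ih].
have xab : x \in `[a, b] by rewrite in_itv /= ax.
have aab : a \in `[a, b] by rewrite in_itv /= lexx (le_trans ax).
have := vg x xab; have := wh x xab; rewrite !vw //; lra.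
Qed.

Lemma rint_dominated a b (f_ : nat -> R -> R) f g :
  (forall n, measurable_fun `]a, b[ (f_ n)) -> ible a b g ->
  (forall n, {in `]a, b[, forall x, `|f_ n x| <= g x}) ->
  {in `]a, b[, forall x, f_ n x @[n --> \oo] --> f x} ->
  ible a b f /\ rint a b (f_ n) @[n --> \oo] --> rint a b f.
Proof.
move=> mf gi fg ff.
have mf' : measurable_fun `]a, b[ f by apply: measurable_fun_cvg ff.
have [] := @dominated_convergence _ _ _ mu `]a, b[ _ (fun n x => (f_ n x)%:E)
  (fun x => (f x)%:E) (fun x => (g x)%:E) _ _ _ gi _.
- by [].
- by move=> n; apply/measurable_EFinP; exact: mf.
- apply/measurable_EFinP; exact: mf'.
- by apply: aeW => x /= xab; apply: cvg_EFin; [exact: nearW|exact: ff].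
- by apply: aeW => x /= n xab; rewrite lee_fin; exact: fg.
move=> fi _ cv; split => //; apply: fine_cvg.
by rewrite fineK //; exact: integrable_fin_num fi.
Qed.

(** Since g is only integrable, it is approximated in L^1 by continuous g_n. The classical formula
    holds for a primitive V of g_n with V(a) = v(a), and both sides depend continuously on g in
    L^1. *)
Lemma prim_by_parts a b v g phi dphi : a <= b -> prim a b v g ->
  (forall x, is_derive x 1 phi (dphi x)) -> continuous dphi ->
  rint a b (fun x => v x * dphi x) =
  v b * phi b - v a * phi a - rint a b (fun x => g x * phi x).
Proof.
rewrite le_eqVlt => /predU1P[->|ab] vg dp cd; first by rewrite !rint_nil; ring.
have cp : continuous phi.
  by move=> x; apply: differentiable_continuous; apply/derivable1_diffP; have [] := dp x.
have ig := sqi_ible vg.1; have sv := prim_sqi_fun vg.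
have sp := sqi_continuous (continuous_subspaceT (A := `[a, b]) cp).
have sd := sqi_continuous (continuous_subspaceT (A := `[a, b]) cd).
have [g_ [cg _ gL]] := approximation_continuous_integrable
  (measurable_itv `]a, b[) (mu_oo_lty a b) ig.
have [M M0 pM] := continuous_bounded_itv (ltW ab) (continuous_subspaceT (A := `[a, b]) cp).
have [N N0 dN] := continuous_bounded_itv (ltW ab) (continuous_subspaceT (A := `[a, b]) cd).
set X := rint _ _ _; set Y := _ - _ - _.
pose d n := rint a b (fun x => `|g x - g_ n x|).
have d0 : d n @[n --> \oo] --> 0 by apply: fine_cvg; exact: gL.
(* N (b - a) accounts for the integral of (v - V) phi', one M for that of (g - g_n) phi, the other M
   for the boundary term at b; at a there is no error. *)
have key n : `|X - Y| <= d n * (N * (b - a) + M + M).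
  have sgn := sqi_continuous (continuous_subspaceT (A := `[a, b]) (cg n)).
  have idn : ible a b (fun x => `|g x - g_ n x|).
    by apply: ible_norm; apply: ibleB => //; exact: sqi_ible.
  have [W dW] := ex_primitive_gt (a - 1) (cg n).
  have dW' x : a <= x -> is_derive x 1 W (g_ n x).
    by move=> ax; apply: dW; rewrite (lt_le_trans _ ax) // gtrBl.
  have cW : {within `[a, b], continuous W}.
    apply: derivable_within_continuous => x /[!in_itv] /= /andP[ax _].
    by have [] := dW' _ ax.
  have Wab x : x \in `[a, b] -> W x - W a = rint a x (g_ n).
    move=> /[!in_itv] /= /andP[ax xb]; rewrite (rint_derive (F := W) ax) //.
    - exact: within_continuous_sub cW.
    - by apply: continuous_subspaceT; exact: cg.
    - by move=> t /[!in_itv] /= /andP[/ltW at_ _]; exact: dW'.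
  pose V x := W x + (v a - W a).
  have vV x : x \in `[a, b] -> `|v x - V x| <= d n.
    move=> /[dup] xab /[!in_itv] /= /andP[ax xb].
    have ix : ible a x g by apply: ible_sub ig.
    have inx : ible a x (g_ n) by apply: ible_sub (sqi_ible sgn).
    have -> : v x - V x = rint a x g - rint a x (g_ n) by rewrite -Wab // vg.2 // /V; ring.
    rewrite -rintB //.
    apply: le_trans (normr_rint _) _; first exact: ibleB.
    by apply: rint_mono.
  have dV x : a <= x -> is_derive x 1 V (g_ n x).
    move=> ax; have := is_deriveD (dW' x ax) (is_derive_cst (v a - W a) x 1).
    by rewrite addr0.
  have cV : {within `[a, b], continuous V}.
    apply: derivable_within_continuous => x /[!in_itv] /= /andP[ax _].
    by have [] := dV _ ax.
  have sV := sqi_continuous cV.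
  have parts : rint a b (fun x => V x * dphi x) + rint a b (fun x => g_ n x * phi x)
    = V b * phi b - V a * phi a.
    rewrite -rintD; [|exact: sqi_mul..].
    apply: (@rint_derive _ _ _ (fun x => V x * phi x)); first exact: ltW.
    - by move=> x; apply: cvgM; [exact: cV|exact: continuous_subspaceT].
    - move=> x; apply: cvgD; apply: cvgM.
      + exact: cV.
      + exact: continuous_subspaceT.
      + by apply: continuous_subspaceT; exact: cg.
      + exact: continuous_subspaceT.
    - move=> x /[!in_itv] /= /andP[/ltW ax _]; have := is_deriveM (dV x ax) (dp x).
      have -> : V x * dphi x + g_ n x * phi x = V x *: dphi x + phi x *: g_ n x.
        by rewrite /GRing.scale /= [phi x * _]mulrC.
      exact.
  have Va : V a = v a by rewrite /V subrKC.
  have aab : a \in `[a, b] by rewrite in_itv /= lexx ltW.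
  have bab : b \in `[a, b] by rewrite in_itv /= lexx ltW.
  have -> : X - Y = rint a b (fun x => (v x - V x) * dphi x)
     + rint a b (fun x => (g x - g_ n x) * phi x) - (v b - V b) * phi b.
    under [rint a b (fun x => (v x - V x) * _)]eq_rint do rewrite mulrBl.
    under [rint a b (fun x => (g x - g_ n x) * _)]eq_rint do rewrite mulrBl.
    rewrite rintB; [|exact: sqi_mul..].
    rewrite rintB; [|apply: sqi_mul => //; exact: vg.1|exact: sqi_mul].
    by move: parts; rewrite Va /X /Y; lra.
  have B1 : `|rint a b (fun x => (v x - V x) * dphi x)| <= d n * (N * (b - a)).
    apply: le_trans (normr_rint _) _; first by apply: sqi_mul => //; exact: sqiB.
    rewrite mulrA -rint_cst; last exact: ltW.
    apply: ler_rint; [|exact: ible_cst|].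
      by apply: ible_norm; apply: sqi_mul => //; exact: sqiB.
    move=> x xab; have xab' : x \in `[a, b] by apply: subset_itv_oo_cc xab.
    by rewrite normrM ler_pM //; [exact: vV|exact: dN].
  have B2 : `|rint a b (fun x => (g x - g_ n x) * phi x)| <= d n * M.
    have s : sqi a b (fun x => g x - g_ n x) by apply: sqiB => //; exact: vg.1.
    apply: le_trans (normr_rint _) _; first exact: sqi_mul.
    rewrite mulrC -rintZ //; apply: ler_rint.
    - by apply: ible_norm; apply: sqi_mul.
    - exact: ibleZ.
    move=> x xab; have xab' : x \in `[a, b] by apply: subset_itv_oo_cc xab.
    by rewrite normrM mulrC ler_wpM2r //; exact: pM.
  have B3 : `|(v b - V b) * phi b| <= d n * M.
    by rewrite normrM ler_pM //; [exact: vV|exact: pM].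
  apply: le_trans (ler_normB _ _) _.
  apply: le_trans (lerD (ler_normD _ _) (lexx _)) _.
  lra.
apply/eqP; rewrite -subr_eq0 -normr_le0.
have : d n * (N * (b - a) + M + M) @[n --> \oo] --> 0 * (N * (b - a) + M + M).
  by apply: cvgM => //; exact: cvg_cst.
rewrite mul0r => h.
exact: ge_cvg h key.
Qed.

(** The primitive is constant on either side of [a, b], and the two constants agree because the mean
    is zero; subtracting the common value [F a] gives compact support. *)
Lemma ex_primitive_csupp a b L psi : 0 <= a -> b <= L -> continuous psi ->
  (forall x, x \notin `[a, b] -> psi x = 0) -> rint 0 L psi = 0 ->
  exists phi, [/\ forall x, is_derive x 1 phi (psi x) &
    forall x, x \notin `[a, b] -> phi x = 0].
Proof.
move=> a0 bL pc ps p0.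
have pi u : mu.-integrable `]-oo, u] (EFin \o psi).
  have e : psi = psi \_ `[a, b].
    apply/funext => x; rewrite patchE; case: ifPn => // xab; apply: ps.
    by move: xab; rewrite notin_setE /= => /negP.
  have i1 : mu.-integrable `[a, b] (EFin \o psi).
    apply: continuous_compact_integrable; first exact: segment_compact.
    by apply: continuous_subspaceT.
  have [h _] := @integrable_mkcond _ _ _ mu `[a, b] (EFin \o psi) (measurable_itv _).
  have := h i1; rewrite restrict_EFin -e => iT.
  by apply: (@integrableS _ _ _ mu setT).
pose F x := \int[mu]_(t in `]-oo, x]) psi t.
have dF x : is_derive x 1 F (psi x).
  have [|||d e] := @continuous_FTC1 R psi -oo%O x (x + 1) _ (pi _).
  - by rewrite ltrDl.
  - by rewrite ltNyr.
  - exact: pc.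
  by rewrite derive1E in e; exact: (DeriveDef d e).
have cF : continuous F.
  by move=> x; apply: differentiable_continuous; apply/derivable1_diffP; have [] := dF x.
have Fd x y : x <= y -> rint x y psi = F y - F x.
  by move=> xy; apply: rint_derive => //; exact: continuous_subspaceT.
have z x y : {in `]x, y[, forall t, psi t = 0} -> x <= y -> F y = F x.
  move=> h xy; apply/eqP; rewrite -subr_eq0 -Fd //; apply/eqP.
  by rewrite (eq_rint h) rint_cst // mul0r.
(* An empty support interval forces psi = 0, and then phi = 0 serves. *)
have [ab|ba] := leP a b; last first.
  exists (cst 0); split => // x; rewrite ps; last first.
    by rewrite in_itv /= negb_and -!ltNge; have [//|/=] := ltP x a => /(lt_le_trans ba).
  exact: is_derive_cst.
have FLa : F b = F a.
  rewrite (z 0 a) //; last first.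
    by move=> t /[!in_itv] /= /andP[_ ta]; rewrite ps // in_itv /= leNgt ta.
  rewrite -(z b L) //; last first.
    by move=> t /[!in_itv] /= /andP[tb _]; rewrite ps // in_itv /= [t <= b]leNgt tb andbF.
  by apply/eqP; rewrite -subr_eq0 -Fd ?p0 //; apply: le_trans bL; exact: le_trans ab.
exists (fun x => F x - F a); split.
  move=> x; have := is_deriveB (dF x) (is_derive_cst (F a) x 1).
  by rewrite subr0.
move=> x; rewrite in_itv /= negb_and -!ltNge => /orP[xa|bx]; apply/eqP; rewrite subr_eq0; apply/eqP.
  rewrite (z x a) //; last exact: ltW.
  by move=> t /[!in_itv] /= /andP[_ ta]; rewrite ps // in_itv /= leNgt ta.
rewrite -FLa; apply: z; last exact: ltW.
by move=> t /[!in_itv] /= /andP[tb _]; rewrite ps // in_itv /= [t <= b]leNgt tb andbF.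
Qed.

(** A trapezoidal cutoff of ]0, x[: for large n it is 0 up to 1/n, rises with slope n, equals 1 from
    2/n to x - 1/n and is back to 0 at x. For x < L it is continuous with compact support in ]0,
    L[. *)
Definition trap (n : nat) x t : R :=
  Num.max 0 (Num.min 1 (Num.min (n%:R * t - 1) (n%:R * (x - t)))).

Lemma trap_continuous n x : continuous (trap n x).
Proof.
pose g1 : R -> R^o := fun t => n%:R * t - 1.
pose g2 : R -> R^o := fun t => n%:R * (x - t).
have c1 : continuous g1.
  by move=> t; apply: cvgB; [apply: cvgM; [exact: cvg_cst|exact: cvg_id]|exact: cvg_cst].
have c2 : continuous g2.
  by move=> t; apply: cvgM; [exact: cvg_cst|apply: cvgB; [exact: cvg_cst|exact: cvg_id]].
move=> t; have c3 := continuous_min (c1 t) (c2 t).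
have c4 := continuous_min (@cst_continuous _ _ (1 : R^o) t) c3.
exact: continuous_max (@cst_continuous _ _ (0 : R^o) t) c4.
Qed.

Lemma trap_bound n x t : 0 <= trap n x t <= 1.
Proof. by rewrite /trap le_max lexx ge_max ler01 ge_min lexx. Qed.

Lemma trap_supp n x t : t \notin `[n.+1%:R^-1, x] -> trap n.+1 x t = 0.
Proof.
rewrite in_itv /= negb_and -!ltNge => h; apply/max_idPl.
rewrite !ge_min; case/orP: h => h; apply/orP; right; apply/orP; [left|right].
  by rewrite subr_le0 mulrC -ler_pdivlMr ?ltr0n // mul1r ltW.
by rewrite pmulr_rle0 ?ltr0n // subr_le0 ltW.
Qed.

Lemma trap_cvg x t : 0 < t -> trap n.+1 x t @[n --> \oo] --> (if t < x then 1 else 0 : R).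
Proof.
move=> t0; have [tx|xt] := ltP t x; apply: cvg_near_cst; last first.
  apply: nearW => n; apply/max_idPl; rewrite !ge_min; apply/orP; right.
  by apply/orP; right; rewrite pmulr_rle0 ?ltr0n // subr_le0.
have [N _ hN] : \forall n \near \oo, Num.max (2 / t) (1 / (x - t)) <= n%:R.
  exact: nbhs_infty_ger.
exists N => // n /= /hN /=; rewrite ge_max => /andP[h1 h2].
have nS : n%:R <= n.+1%:R :> R by rewrite ler_nat.
have nt : 2 <= n.+1%:R * t by rewrite -ler_pdivrMr //; exact: le_trans nS.
have nx : 1 <= n.+1%:R * (x - t).
  by rewrite -ler_pdivrMr ?subr_gt0 //; exact: le_trans nS.
rewrite /trap (min_idPl _); last by rewrite le_min nx andbT; lra.
by rewrite (max_idPr _).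
Qed.

(** A continuous compactly supported function of mean zero is the derivative of a test function.
    Subtracting from any psi a multiple of a fixed psi0 of nonzero mean thus shows that f - c is
    orthogonal to psi, with c the psi0-average of f. Trapezoids psi tending to the indicator of ]0,
    x[ then make the primitive of f - c vanish. *)
Lemma du_bois_reymond L f : 0 < L -> ible 0 L f ->
  (forall phi, test_fun L phi -> rint 0 L (fun x => f x * derive1 phi x) = 0) ->
  exists c, {ae mu, forall x, x \in `]0, L[ -> f x = c}.
Proof.
move=> L0 fi f0.
pose ok psi := continuous psi /\ exists a b : R, [/\ 0 < a, b < L &
  forall x, x \notin `[a, b] -> psi x = 0].
have test psi : ok psi -> rint 0 L psi = 0 -> rint 0 L (fun x => f x * psi x) = 0.
  move=> [pc [a [b [a0 bL ps]]]] p0.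
  have [phi [dphi sphi]] := ex_primitive_csupp (ltW a0) (ltW bL) pc ps p0.
  have dE : derive1 phi = psi by apply/funext => x; rewrite derive1E derive_val.
  rewrite -dE; apply: f0; split.
  - by move=> x; have [] := dphi x.
  - by rewrite dE.
  - by exists a, b.
have fok psi : ok psi -> (exists M : R, forall x, `|psi x| <= M) -> ible 0 L psi /\ ible 0 L (fun x => f x * psi x).
  move=> [pc _] [M pM]; have s := sqi_continuous (continuous_subspaceT (A := `[0, L]) pc).
  split; first exact: sqi_ible.
  have := ibleZ M (ible_norm fi); apply: le_integrable => //.
    by apply/measurable_EFinP; apply: measurable_funM; [exact: ible_meas fi|case: s].
  move=> x _ /=; rewrite lee_fin !normrM normr_id mulrC ler_wpM2r //.
  by apply: le_trans (pM x) _; exact: ler_norm.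
have okt n x : x < L -> ok (trap n.+1 x).
  move=> xL; split; first exact: trap_continuous.
  exists n.+1%:R^-1, x; split => //; exact: trap_supp.
have bt n x : exists M : R, forall t, `|trap n.+1 x t| <= M.
  by exists 1 => t; have /andP[t0 t1] := trap_bound n.+1 x t; rewrite ger0_norm.
have tl h x : ible 0 L h -> 0 < x -> x < L ->
    rint 0 L (fun t => h t * trap n.+1 x t) @[n --> \oo] --> rint 0 x h.
  move=> hi x0 xL.
  have -> : rint 0 x h = rint 0 L (fun t => h t * (if t < x then 1 else 0 : R)).
    have i1 : ible 0 x (fun t => h t * (if t < x then 1 else 0 : R)).
      apply: eq_ible (ible_sub (lexx 0) (ltW xL) hi).
      by move=> t /[!in_itv] /= /andP[_ ->]; rewrite mulr1.
    have e2 : {in `]x, L[, (fun=> 0) =1 (fun t => h t * (if t < x then 1 else 0 : R))}.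
      by move=> t /[!in_itv] /= /andP[/ltW xt _]; rewrite ltNge xt mulr0.
    rewrite (@rint_cat _ 0 x L) ?(ltW x0) ?(ltW xL) //; last first.
      by apply: ible_cat i1 (eq_ible e2 (ible_cst _ _ _)); exact: ltW.
    rewrite -(eq_rint e2) rint_cst ?(ltW xL) // mul0r addr0.
    by apply: eq_rint => t /[!in_itv] /= /andP[_ ->]; rewrite mulr1.
  have [] // := @rint_dominated 0 L (fun n t => h t * trap n.+1 x t)
    (fun t => h t * (if t < x then 1 else 0 : R)) (fun t => `|h t|).
  - move=> n; apply: measurable_funM; first exact: ible_meas hi.
    by have [] := sqi_continuous (continuous_subspaceT (A := `[0, L]) (@trap_continuous n.+1 x)).
  - exact: ible_norm.
  - move=> n t _; have /andP[t0 t1] := trap_bound n.+1 x t.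
    by rewrite normrM (ger0_norm t0) ler_piMr.
  - move=> t /[!in_itv] /= /andP[t0 _]; apply: cvgM; first exact: cvg_cst.
    exact: trap_cvg.
(* The means of these trapezoids tend to L / 2, so they cannot all be nonpositive; L / 2 is just
   some interior point. *)
have [m Im] : exists m, 0 < rint 0 L (trap m.+1 (L / 2)).
  apply: contrapT => /forallNP h.
  have := tl (fun=> 1) (L / 2) (ible_cst _ _ _).
  rewrite rint_cst; last by lra.
  move=> /(_ _ _)/cvgN; have [H1 H2] : 0 < L / 2 /\ L / 2 < L by lra.
  move=> /(_ H1 H2) H; have : 0 <= - (1 * (L / 2 - 0)).
    apply: (ge_cvg H) => n; rewrite oppr_ge0; have /negP := h n; rewrite -leNgt.
    by under [in X in _ -> X]eq_rint do rewrite mul1r.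
  by lra.
set I0 := rint 0 L _ in Im; set psi0 := trap m.+1 (L / 2) in I0 Im.
have L2 : L / 2 < L by lra.
have ok0 : ok psi0 by exact: okt.
pose c := rint 0 L (fun x => f x * psi0 x) / I0.
exists c.
have fc : ible 0 L (fun x => f x - c) by apply: ibleB => //; exact: ible_cst.
have Z n x : 0 < x -> x < L -> rint 0 L (fun t => (f t - c) * trap n.+1 x t) = 0.
  move=> x0 xL; set psi := trap n.+1 x.
  have okp : ok psi by exact: okt.
  have [ip ifp] := fok _ okp (bt n x).
  have [ip0 ifp0] := fok _ ok0 (bt m (L / 2)).
  pose r := rint 0 L psi / I0.
  have ok1 : ok (fun t => psi t - r * psi0 t).
    have [pc [a [b [a0 bL ps]]]] := okp.
    have [pc0 [a' [b' [a0' bL' ps0]]]] := ok0.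
    split.
      by move=> t; apply: cvgB; [exact: pc|apply: cvgM; [exact: cvg_cst|exact: pc0]].
    exists (Num.min a a'), (Num.max b b'); split.
    - by rewrite lt_min a0.
    - by rewrite gt_max bL.
    - move=> t; rewrite in_itv /= ge_min le_max => tn.
      rewrite ps ?ps0 ?mulr0 ?subrr // in_itv /=; apply: contra tn => /andP[-> ->] //.
      by rewrite !orbT.
  have z1 : rint 0 L (fun t => psi t - r * psi0 t) = 0.
    rewrite rintB ?rintZ //; last exact: ibleZ.
    by rewrite /r -/I0 divfK ?subrr // gt_eqF.
  have := test _ ok1 z1.
  have -> : rint 0 L (fun x => f x * (psi x - r * psi0 x)) =
      rint 0 L (fun x => f x * psi x) - r * rint 0 L (fun x => f x * psi0 x).
    rewrite -rintZ // -rintB //; last exact: ibleZ.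
    by apply: eq_rint => t _; ring.
  have -> : rint 0 L (fun t => (f t - c) * psi t) =
      rint 0 L (fun x => f x * psi x) - c * rint 0 L psi.
    rewrite -rintZ // -rintB //; last exact: ibleZ.
    by apply: eq_rint => t _; ring.
  have -> : c * rint 0 L psi = r * rint 0 L (fun x => f x * psi0 x) by rewrite /c /r; ring.
  by [].
have := @rint_zero_ae 0 L (fun x => f x - c) fc.
move=> H; suff {}/H : {in `]0, L[, forall x, rint 0 x (fun x => f x - c) = 0}.
  by apply: ae_imp => x h0 /h0 /eqP; rewrite subr_eq0 => /eqP.
move=> x /[!in_itv] /= /andP[x0 xL].
have := tl _ x fc x0 xL; under eq_cvg do rewrite Z //.
by move=> /(cvg_lim (@Rhausdorff R)) <-; rewrite lim_cst.
Qed.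

End weak_derivatives.

(** * Representation of H^2 functions *)

Section sobolev_representation.
Context {R : realType}.
Implicit Types (a b c x y k L : R) (f g h : R -> R).
Local Notation mu := (@lebesgue_measure R).

(** If P failed throughout the interval, the functions 0 and 1 would agree almost everywhere there
    and have the same integral. *)
Lemma ae_exists a b (P : R -> Prop) : a < b ->
  {ae mu, forall x, x \in `]a, b[ -> P x} -> exists2 x, x \in `]a, b[ & P x.
Proof.
move=> ab aeP; apply: contrapT => /forall2NP nP.
have : rint a b (fun=> 0 : R) = rint a b (fun=> 1).
  apply: ae_eq_rint; [exact: measurable_cst..|].
  by apply: ae_imp aeP => x h xab; case: (nP x) => //; have := h xab.
by rewrite !rint_cst ?(ltW ab) //; lra.
Qed.

Lemma ae_eq_within_continuous a b f g : a < b ->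
  {within `[a, b], continuous f} -> {within `[a, b], continuous g} ->
  {ae mu, forall x, x \in `]a, b[ -> f x = g x} -> {in `[a, b], f =1 g}.
Proof.
move=> ab fc gc fg x xab; apply/eqP; apply: contrapT => /negP fgx.
pose d y := f y - g y.
have dx : 0 < `|d x| by rewrite normr_gt0 subr_eq0.
have dc : {within `[a, b], continuous d} by move=> y; apply: cvgB; [exact: fc|exact: gc].
move/subspace_continuousP : dc => /(_ x xab)/cvgrPdist_lt/(_ _ dx).
rewrite /prop_near1 /= /within /= => -[e /= e0 he].
have pq : Num.max a (x - e) < Num.min b (x + e).
  by move: xab; rewrite in_itv /= gt_max !lt_min => /andP[ax xb]; apply/andP; split; apply/andP; split; lra.
have : {ae mu, forall y, y \in `](Num.max a (x - e)), (Num.min b (x + e))[ -> f y = g y}.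
  apply: ae_imp fg => y fgy; rewrite in_itv /= gt_max lt_min => /andP[/andP[ay _] /andP[yb _]].
  by apply: fgy; rewrite in_itv /= ay.
move=> /(ae_exists pq)[y]; rewrite in_itv /= gt_max lt_min => /andP[/andP[ay ey] /andP[yb ye]] fgy.
have /he : ball_ [eta Num.Def.normr] x e y by rewrite /= ltr_distl; apply/andP; split; lra.
rewrite in_itv /= (ltW ay) (ltW yb) => /(_ isT).
by rewrite /from_subspace /d fgy subrr subr0 ltxx.
Qed.

Definition swd L f g := [/\ sqi 0 L f, sqi 0 L g &
  forall phi, test_fun L phi ->
    rint 0 L (fun x => f x * derive1 phi x) = - rint 0 L (fun x => g x * phi x)].

Lemma test_fun_sqi L phi : test_fun L phi -> sqi 0 L phi /\ sqi 0 L (derive1 phi).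
Proof.
move=> [d c _]; split; apply: sqi_continuous; apply: continuous_subspaceT => // x.
by apply: differentiable_continuous; apply/derivable1_diffP.
Qed.

Lemma prim_swd L f g : 0 <= L -> prim 0 L f g -> swd L f g.
Proof.
move=> L0 fg; split; [exact: prim_sqi_fun fg|exact: fg.1|].
move=> phi [d c [a [b [a0 bL s]]]].
have dd x : is_derive x 1 phi (derive1 phi x) by rewrite derive1E; apply: DeriveDef.
rewrite (prim_by_parts L0 fg dd c) ?(s 0) ?(s L) ?mulr0 ?subrr ?add0r //.
- by rewrite in_itv /= [L <= b]leNgt bL andbF.
- by rewrite in_itv /= leNgt a0.
Qed.

Lemma eq_ae_sqi_rint_mul L f g h : sqi 0 L f -> sqi 0 L g -> sqi 0 L h ->
  {ae mu, forall x, x \in `]0, L[ -> f x = g x} ->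
  rint 0 L (fun x => f x * h x) = rint 0 L (fun x => g x * h x).
Proof.
move=> sf sg sh fg; apply: ae_eq_rint; [exact: ible_meas (sqi_mul _ _)..|].
by apply: ae_imp fg => x e /e ->.
Qed.

(** The primitive G of g has the same weak derivative as f, so the du Bois-Reymond lemma makes f - G
    constant almost everywhere. *)
Lemma swd_prim L f g : 0 < L -> swd L f g ->
  exists F, prim 0 L F g /\ {ae mu, forall x, x \in `]0, L[ -> f x = F x}.
Proof.
move=> L0 [sf sg w].
pose G x := rint 0 x g.
have Gg : prim 0 L G g by split => // x _; rewrite /G rint_nil add0r.
have [_ _ wG] := prim_swd (ltW L0) Gg.
have sG := prim_sqi_fun Gg.
have [||c fc] := @du_bois_reymond _ L (fun x => f x - G x) L0.
- by apply: sqi_ible; exact: sqiB.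
- move=> phi tp; have [_ s1] := test_fun_sqi tp.
  under eq_rint do rewrite mulrBl.
  by rewrite rintB ?w ?wG ?subrr //; exact: sqi_mul.
exists (fun x => c + G x); split.
  split => // x _; rewrite /G rint_nil; ring.
by apply: ae_imp fc => x h /h <-; rewrite subrK.
Qed.

Lemma swd_continuous_prim L f g : 0 < L -> swd L f g ->
  {within `[0, L], continuous f} -> prim 0 L f g.
Proof.
move=> L0 w fc; have [F [Fg fF]] := swd_prim L0 w.
have e := ae_eq_within_continuous L0 fc (prim_continuous Fg) fF.
by apply: eq_prim Fg => // x /e.
Qed.

Lemma swd_ae L f g h : sqi 0 L h -> swd L f g ->
  {ae mu, forall x, x \in `]0, L[ -> g x = h x} -> swd L f h.
Proof.
move=> sh [sf sg w] gh; split=> // phi tp; rewrite w //; congr (- _).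
by apply: eq_ae_sqi_rint_mul => //; have [] := test_fun_sqi tp.
Qed.

(** * Vector-valued functions, componentwise *)

Section vector_valued.
Variable m : nat.
Implicit Types (v w : R -> 'rV[R]_m) (i : 'I_m).

Lemma row_normr_le (u : 'rV[R]_m) i : `|u 0 i| <= `|u|.
Proof.
rewrite [leRHS]mx_normrE.
have := @le_bigmax _ _ _ 0 (fun p : 'I_1 * 'I_m => `|u p.1 p.2|) (0, i).
exact.
Qed.

Lemma row_normr_lt (u : 'rV[R]_m) e : 0 < e -> (forall i, `|u 0 i| < e) -> `|u| < e.
Proof.
move=> e0 ue; rewrite [ltLHS]mx_normrE; apply/bigmax_ltP; split => // -[j i] _ /=.
by rewrite (ord1 j).
Qed.

Lemma within_continuous_row (A : set R) v :
  (forall i, {within A, continuous (fun x => v x 0 i)}) <-> {within A, continuous v}.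
Proof.
split => vc.
  move=> x; apply/cvgrPdist_lt => e e0.
  have H i : \forall y \near (x : subspace A), `|v x 0 i - v y 0 i| < e.
    by have := vc i x => /cvgrPdist_lt; apply.
  near=> y; apply: row_normr_lt => // i; rewrite !mxE; move: i; near: y.
  exact: filter_forall.
move=> i x; apply/cvgrPdist_lt => e e0.
have := vc x => /cvgrPdist_lt/(_ _ e0); apply: filterS => y; apply: le_lt_trans.
by have := row_normr_le (v x - v y) i; rewrite !mxE.
Unshelve. all: by end_near.
Qed.

Lemma is_wderivP L v w : is_wderiv L v w <->
  forall i, swd L (fun x => v x 0 i) (fun x => w x 0 i).
Proof.
split=> [[sv sw h] i|h]; first by split; [exact: sv|exact: sw|exact: h].
by split => i; have [] := h i.
Qed.

(** Here v2 may be any representative of v'', so that explicitly constructed functions qualify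
    although they need not coincide with [wderiv]. *)
Definition H2rep L v v1 v2 := forall i,
  prim 0 L (fun x => v x 0 i) (fun x => v1 x 0 i) /\
  prim 0 L (fun x => v1 x 0 i) (fun x => v2 x 0 i).

Lemma H2rep_H2 L v v1 v2 : 0 < L -> H2rep L v v1 v2 -> H2 L v.
Proof.
move=> L0 r; split; last first.
  by apply/within_continuous_row => i; have [/prim_continuous] := r i.
exists v1; first by apply/is_wderivP => i; apply: prim_swd; [exact: ltW|have [] := r i].
exists v2; last by move=> i; have [_ []] := r i.
by apply/is_wderivP => i; apply: prim_swd; [exact: ltW|have [] := r i].
Qed.

Lemma is_wderiv_wderiv L v : (exists g : R -> 'rV[R]_m, is_wderiv L v g) -> is_wderiv L v (wderiv L v).
Proof.
move=> [g vg]; rewrite /wderiv.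
case: (pselect (exists g : R -> 'rV[R]_m, is_wderiv L v g /\ {within `[0, L], continuous g})).
  by move=> [h vh]; have := xgetPex (xget (fun=> 0) [set g | is_wderiv L v g]) (ex_intro _ h vh : [set g | is_wderiv L v g /\ {within `[0, L], continuous g}] !=set0) => -[].
move=> no; rewrite xgetPN; first exact: (@xgetPex _ _ [set g | is_wderiv L v g]) (ex_intro _ g vg).
by move=> h vh; apply: no; exists h.
Qed.

Lemma wderiv_continuous L v (g : R -> 'rV[R]_m) : is_wderiv L v g -> {within `[0, L], continuous g} ->
  {within `[0, L], continuous (wderiv L v)}.
Proof.
move=> vg gc; rewrite /wderiv.
by have := xgetPex (xget (fun=> 0) [set g | is_wderiv L v g]) (ex_intro _ g (conj vg gc) : [set g | is_wderiv L v g /\ {within `[0, L], continuous g}] !=set0) => -[].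
Qed.

(** The derivatives supplied by [sobolev] are arbitrary representatives. Integrating the second one
    shows that a continuous first derivative exists, and this is what makes the choice in [wderiv] a
    continuous one. *)
Lemma H2_rep L v : 0 < L -> H2 L v -> H2rep L v (wderiv L v) (wderiv L (wderiv L v)).
Proof.
move=> L0 [[g /is_wderivP vg [g2 /is_wderivP gg2 _]] vc].
have /choice[V hV] i : exists F, prim 0 L F (fun x => g2 x 0 i) /\
    {ae mu, forall x, x \in `]0, L[ -> g x 0 i = F x} by exact: swd_prim.
pose W x : 'rV[R]_m := \row_i V i x.
have WE i : (fun x => W x 0 i) = V i by apply/funext => x; rewrite mxE.
have vW : is_wderiv L v W.
  apply/is_wderivP => i; rewrite WE; have [pV gV] := hV i.
  exact: swd_ae (prim_sqi_fun pV) (vg i) gV.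
have Wc : {within `[0, L], continuous W}.
  by apply/within_continuous_row => i; rewrite WE; have [/prim_continuous] := hV i.
have d1 := is_wderiv_wderiv (ex_intro _ W vW).
have d1c := wderiv_continuous vW Wc.
set w := wderiv L v in d1 d1c *.
have vci i : {within `[0, L], continuous (fun x => v x 0 i)} by exact: (iffRL (within_continuous_row _ _)).
have wci i : {within `[0, L], continuous (fun x => w x 0 i)} by exact: (iffRL (within_continuous_row _ _)).
have p1 i : prim 0 L (fun x => v x 0 i) (fun x => w x 0 i).
  by apply: swd_continuous_prim => //; exact: (iffLR (is_wderivP L v w) d1).
(* [W] and [w] are continuous weak derivatives of the same v and agree on [0, L]; so [g2] is also a
   weak derivative of [w], and the second [wderiv] is not a default value. *)
have wg2 i : prim 0 L (fun x => w x 0 i) (fun x => g2 x 0 i).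
  have [pV _] := hV i; apply: eq_prim (pV) => // x.
  apply: ae_eq_within_continuous (prim_continuous pV) (wci i) _ x => //.
  apply: (prim_uniq (v := fun x => v x 0 i) _ (p1 i)) => //.
  by rewrite -WE; apply: swd_continuous_prim => //; exact: (iffLR (is_wderivP L v W) vW).
have d2 : is_wderiv L w (wderiv L w).
  by apply: is_wderiv_wderiv; exists g2; apply/is_wderivP => i; exact: prim_swd (ltW L0) _.
move=> i; split => //; apply: swd_continuous_prim => //; exact: (iffLR (is_wderivP L w _) d2).
Qed.

Lemma H2rep_uniq L v w v1 v2 w1 w2 : 0 < L -> H2rep L v v1 v2 -> H2rep L w w1 w2 ->
  {in `[0, L], v =1 w} -> {in `[0, L], v1 =1 w1} /\
  forall i, {ae mu, forall x, x \in `]0, L[ -> v2 x 0 i = w2 x 0 i}.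
Proof.
move=> L0 rv rw vw.
have e i : {in `[0, L], forall x, v1 x 0 i = w1 x 0 i}.
  have [pv pv'] := rv i; have [pw pw'] := rw i.
  apply: ae_eq_within_continuous (prim_continuous pv') (prim_continuous pw') _ => //.
  by apply: prim_uniq pv pw _ => x /vw ->.
split; first by move=> x xL; apply/rowP => i; exact: e.
move=> i; have [_ pv'] := rv i; have [_ pw'] := rw i.
by apply: prim_uniq pv' pw' _ => x; exact: e.
Qed.

Lemma L2norm_sqr L v : in_L2 L v ->
  L2norm L v ^+ 2 = \sum_i rint 0 L (fun x => v x 0 i ^+ 2).
Proof.
move=> sv.
have dE x : enorm (v x) ^+ 2 = \sum_i v x 0 i ^+ 2.
  by rewrite sqr_sqrtr //; apply: sumr_ge0 => i _; rewrite -expr2 sqr_ge0.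
rewrite /L2norm sqr_sqrtr; last by apply: Rintegral_ge0 => x _; rewrite sqr_ge0.
have H (s : seq 'I_m) : ible 0 L (fun x => \sum_(i <- s) v x 0 i ^+ 2) /\
    rint 0 L (fun x => \sum_(i <- s) v x 0 i ^+ 2) =
    \sum_(i <- s) rint 0 L (fun x => v x 0 i ^+ 2).
  elim: s => [|i s [IH1 IH2]].
    split; first by apply: eq_ible (ible_cst _ _ 0) => x _; rewrite big_nil.
    rewrite (@eq_rint _ _ _ _ (fun=> 0 * 0)) => [|x _]; last by rewrite !big_nil mulr0.
    by rewrite rintZ ?mul0r ?big_nil //; exact: ible_cst.
  have iv : ible 0 L (fun x => v x 0 i ^+ 2) by exact: sqi_ible2 (sv i).
  split; first by apply: eq_ible (ibleD iv IH1) => x _; rewrite big_cons.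
  by rewrite big_cons -IH2 -rintD //; apply: eq_rint => x _; rewrite big_cons.
by rewrite -(H _).2; apply: eq_rint => x _.
Qed.

End vector_valued.
End sobolev_representation.

(** * Completeness of L^2 *)

Section riesz_fischer.
Context {R : realType}.
Implicit Types (a b c x y : R) (f g h : R -> R).
Local Notation mu := (@lebesgue_measure R).

Lemma limn_einf_le (u : nat -> \bar R) (c : \bar R) N :
  (forall n, (N <= n)%N -> (u n <= c)%E) -> (limn_einf u <= c)%E.
Proof.
move=> uc; rewrite limn_einf_lim; apply: lime_le; first exact: is_cvg_einfs.
apply: nearW => n; apply: (@le_trans _ _ (u (maxn n N))); last exact/uc/leq_maxr.
by apply: ereal_inf_lbound; exists (maxn n N) => //=; exact: leq_maxl.
Qed.

Lemma limn_einf_ge (u : nat -> \bar R) (c : \bar R) :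
  (\forall n \near \oo, (c <= u n)%E) -> (c <= limn_einf u)%E.
Proof.
move=> [N _ uc]; rewrite limn_einf_lim; apply: lime_ge; first exact: is_cvg_einfs.
exists N => // n /= Nn; apply: le_ereal_inf_tmp => _ [k /= nk <-].
by apply: uc; exact: leq_trans nk.
Qed.

Lemma integral_rint a b f : ible a b f ->
  (\int[mu]_(x in `]a, b[) (f x)%:E)%E = (rint a b f)%:E.
Proof. by move=> fi; rewrite /rint /Rintegral fineK //; exact: integrable_fin_num fi. Qed.

Lemma sqi_rint_le a b f c : a <= b -> sqi a b f -> 0 <= c ->
  rint a b (fun x => f x ^+ 2) <= c ^+ 2 ->
  rint a b (fun x => `|f x|) <= Num.sqrt (b - a) * c.
Proof.
move=> ab sf c0 fc.
have sn : sqi a b (fun x => `|f x|).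
  split; first by apply: measurableT_comp => //; case: sf.
  by apply: eq_ible sf.2 => x _; rewrite real_normK ?num_real.
have r0 : 0 <= rint a b (fun x => `|f x|) by apply: rint_ge0.
rewrite -ler_sqr ?nnegrE ?mulr_ge0 ?sqrtr_ge0 // exprMn sqr_sqrtr ?subr_ge0 //.
have := cauchy_schwarz_rint (sqi_cst a b 1) sn.
under eq_rint do rewrite mul1r.
move/le_trans; apply.
rewrite (_ : rint a b (fun=> 1 ^+ 2) = b - a); last by rewrite rint_cst // expr1n mul1r.
apply: ler_wpM2l; first by rewrite subr_ge0.
by apply: le_trans fc; rewrite le_eqVlt; apply/orP; left; apply/eqP/eq_rint => x _; rewrite real_normK ?num_real.
Qed.

(** By monotone convergence the series of absolute increments has a finite integral, hence a finite
    sum almost everywhere, and there the telescoping series converges absolutely. A measurable good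
    set is returned because its indicator is needed later. *)
Lemma ae_cvg_of_summable a b (g : nat -> R -> R) (C : R) : a <= b ->
  (forall n, sqi a b (g n)) ->
  (forall n, rint a b (fun x => `|g n.+1 x - g n x|) <= C * 2^-1 ^+ n) ->
  exists A : set R, [/\ measurable A,
    {ae mu, forall x, x \in `]a, b[ -> A x} &
    forall x, A x -> cvgn (g ^~ x)].
Proof.
move=> ab sg gC.
pose d n x := `|g n.+1 x - g n x|.
have id n : ible a b (d n).
  by apply: ible_norm; apply: sqi_ible; apply: sqiB.
have md n : measurable_fun `]a, b[ (fun x => (d n x)%:E).
  by apply/measurable_EFinP; exact: ible_meas (id n).
pose G x := (\sum_(0 <= n <oo) (d n x)%:E)%E.
have mG : measurable_fun `]a, b[ G.
  apply: (ge0_emeasurable_sum (h := fun n x => (d n x)%:E)) => // n x _ _.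
  by rewrite lee_fin normr_ge0.
have Gfin : (\int[mu]_(x in `]a, b[) G x < +oo)%E.
  rewrite /G integral_nneseries //; last by move=> n x _; rewrite lee_fin normr_ge0.
  have -> : (\sum_(0 <= n <oo) \int[mu]_(x in `]a, b[) (d n x)%:E)%E =
     (\sum_(0 <= n <oo) (rint a b (d n))%:E)%E.
    by apply: eq_eseriesr => n _; rewrite (integral_rint (id n)).
  have C0 : 0 <= C.
    by have := gC 0%N; rewrite expr0 mulr1; apply: le_trans; apply: rint_ge0.
  apply: (@le_lt_trans _ _ (\sum_(0 <= n <oo) (C * 2^-1 ^+ n)%:E)%E).
    apply: lee_nneseries => n _ *; last by rewrite lee_fin; exact: gC.
    by rewrite lee_fin; apply: rint_ge0 => x; exact: normr_ge0.
  have /cvg_lim cE : (fun n => (\sum_(0 <= k < n) (C * 2^-1 ^+ k)%:E)%E) @ \oo --> (C / (1 - 2^-1))%:E.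
    under eq_fun do rewrite sumEFin.
    apply: cvg_EFin; first exact: nearW.
    have := @cvg_geometric_series R C 2^-1; apply.
    by rewrite ger0_norm //; lra.
  by rewrite cE // ltry.
pose A := `]a, b[ `&` [set x | (G x < +oo)%E].
exists A; split.
- exact: emeasurable_fun_infty_o.
- have Gi : mu.-integrable `]a, b[ G.
    apply/integrableP; split => //.
    apply: le_lt_trans Gfin; rewrite le_eqVlt; apply/orP; left; apply/eqP.
    apply: eq_integral => x _; rewrite gee0_abs //.
    by apply: nneseries_ge0 => n _ _; rewrite lee_fin normr_ge0.
  have := @integrable_ae _ _ _ mu _ (measurable_itv `]a, b[) _ Gi.
  apply: ae_imp => x h xab; split => //=; have := h xab.
  by rewrite ltey_eq => ->.
- move=> x [xab /= Gx].
  have cs : cvgn (series (fun n => g n.+1 x - g n x)).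
    apply: normed_cvg => /=.
    apply: nondecreasing_is_cvgn.
      by apply: nondecreasing_series => *; exact: normr_ge0.
    exists (fine (G x)) => _ [n _ <-].
    rewrite -lee_fin fineK; last first.
      by rewrite ge0_fin_numE // nneseries_ge0 // => *; rewrite lee_fin normr_ge0.
    rewrite /series /= -sumEFin; apply: nneseries_lim_ge => k _ _.
    by rewrite lee_fin normr_ge0.
  have -> : g ^~ x = (fun n => series (fun n => g n.+1 x - g n x) n + g 0%N x).
    by apply/funext => n; rewrite /series /= telescope_sumr // subrK.
  by apply: is_cvgD => //; exact: is_cvg_cst.
Qed.

(** The Riesz-Fischer theorem: a rapidly converging subsequence has an almost everywhere limit, and
    Fatou's lemma turns it into an L^2 limit of the whole sequence. *)
Lemma sqi_complete a b (f : nat -> R -> R) : a <= b -> (forall n, sqi a b (f n)) ->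
  (forall e, 0 < e -> exists N, forall m n, (N <= m)%N -> (N <= n)%N ->
     rint a b (fun x => (f m x - f n x) ^+ 2) <= e) ->
  exists2 F, sqi a b F & forall e, 0 < e -> exists N, forall n, (N <= n)%N ->
     rint a b (fun x => (f n x - F x) ^+ 2) <= e.
Proof.
move=> ab sf fC.
(* The bound is squared so that the L^1 norms of the increments become a geometric sequence. *)
have /choice[N hN] : forall k : nat, exists N, forall m n, (N <= m)%N -> (N <= n)%N ->
     rint a b (fun x => (f m x - f n x) ^+ 2) <= (2^-1 ^+ k) ^+ 2.
  by move=> k; apply: fC; rewrite exprn_gt0 // exprn_gt0 // invr_gt0.
(* Summing makes the index increase and dominate both [N k] and [k]. *)
pose phi k := (\sum_(i < k.+1) (N i).+1)%N.
have phiN k : (N k <= phi k)%N by rewrite /phi big_ord_recr; apply: leq_trans (leq_addl _ _); exact: leqnSn.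
have phik k : (k <= phi k)%N.
  elim: k => // k IH; rewrite /phi big_ord_recr /=.
  by apply: (@leq_trans (phi k).+1); rewrite ?ltnS // -addn1 leq_add.
have phiS k : (phi k <= phi k.+1)%N by rewrite /phi [in leqRHS]big_ord_recr leq_addr.
have phi_mono k l : (k <= l)%N -> (phi k <= phi l)%N.
  by move=> kl; rewrite -(subnK kl); elim: (l - k)%N => // n IH; apply: leq_trans IH _; rewrite addSn.
have phiN' k l : (k <= l)%N -> (N k <= phi l)%N.
  by move=> kl; apply: leq_trans (phi_mono _ _ kl).
pose g k := f (phi k).
have [||A [mA aeA gA]] := @ae_cvg_of_summable a b g (Num.sqrt (b - a)) ab.
- by move=> n; exact: sf.
- move=> n; apply: sqi_rint_le => //; [exact: sqiB (sf _) (sf _)|exact: hN (phiN' _ _ _) (phiN' _ _ _)].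
(* The cutoff makes the sequence converge at every point, so that [F] is a measurable pointwise
   limit. *)
pose g' k x := g k x * \1_A x.
pose F x := limn (g' ^~ x).
have mg' k : measurable_fun `]a, b[ (g' k).
  apply: measurable_funM; first by case: (sf (phi k)).
  exact: measurable_indic.
have cg' x : g' k x @[k --> \oo] --> F x.
  suff : cvgn (g' ^~ x) by [].
  rewrite /g'; have [Ax|nAx] := pselect (A x).
    by apply: is_cvgM; [exact: gA|exact: is_cvg_cst].
  under eq_fun do rewrite indicE memNset // mulr0.
  exact: is_cvg_cst.
have mF : measurable_fun `]a, b[ F by apply: measurable_fun_cvg (fun x _ => cg' x).
(* Fatou's lemma along k; used with e = 1 for the square integrability of [F], then with arbitrary e
   for convergence. *)
have key n e : 0 < e -> (forall m, (n <= m)%N -> rint a b (fun x => (f n x - f m x) ^+ 2) <= e) ->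
    sqi a b (fun x => f n x - F x) /\ rint a b (fun x => (f n x - F x) ^+ 2) <= e.
  move=> e0 fe.
  have mh k : measurable_fun `]a, b[ (fun x => (f n x - g' k x) ^+ 2).
    by apply: measurable_funX; apply: measurable_funB => //; case: (sf n).
  have mH : measurable_fun `]a, b[ (fun x => (f n x - F x) ^+ 2).
    by apply: measurable_funX; apply: measurable_funB => //; case: (sf n).
  have FF : (\int[mu]_(x in `]a, b[) ((f n x - F x) ^+ 2)%:E <= e%:E)%E.
    have -> : (\int[mu]_(x in `]a, b[) ((f n x - F x) ^+ 2)%:E)%E =
       (\int[mu]_(x in `]a, b[) limn_einf (fun k => ((f n x - g' k x) ^+ 2)%:E))%E.
      apply: eq_integral => x _; apply/esym.
      apply: (cvg_limn_einf_sup _).1; apply: cvg_EFin; first exact: nearW.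
      by apply: cvgM; apply: cvgB => //; exact: cvg_cst.
    apply: (@le_trans _ _ (limn_einf (fun k => \int[mu]_(x in `]a, b[) ((f n x - g' k x) ^+ 2)%:E)%E)).
      apply: fatou => //; first by move=> k; apply/measurable_EFinP; exact: mh.
      by move=> k x _; rewrite lee_fin sqr_ge0.
    apply: (@limn_einf_le _ _ n) => k nk.
    have -> : (\int[mu]_(x in `]a, b[) ((f n x - g' k x) ^+ 2)%:E =
       \int[mu]_(x in `]a, b[) ((f n x - g k x) ^+ 2)%:E)%E.
      apply: ae_eq_integral => //.
      - by apply/measurable_EFinP; exact: mh.
      - by apply/measurable_EFinP; apply: measurable_funX; apply: measurable_funB; [case: (sf n)|case: (sf (phi k))].
      - by apply: ae_imp aeA => x h xab; rewrite /g' indicE mem_set ?mulr1 //; exact: h.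
    rewrite (integral_rint (sqi_ible2 (sqiB (sf n) (sf (phi k))))) lee_fin; apply: fe; exact: leq_trans (phik k).
  have s1 : sqi a b (fun x => f n x - F x).
    split; first by apply: measurable_funB => //; case: (sf n).
    apply/integrableP; split; first by apply/measurable_EFinP.
    apply: le_lt_trans (ltry e); apply: le_trans FF.
    rewrite le_eqVlt; apply/orP; left; apply/eqP/eq_integral => x _.
    by rewrite /= ger0_norm // sqr_ge0.
  by split => //; rewrite -lee_fin -(integral_rint (sqi_ible2 s1)).
exists F.
  have [n hn] := fC 1 ltr01.
  have [s1 _] := key n 1 ltr01 (fun m nm => hn n m (leqnn n) nm).
  by apply: eq_sqi (sqiB (sf n) s1) => x _; ring.
move=> e e0; have [n hn] := fC e e0; exists n => k nk.
by have [] := key k e e0 (fun m nm => hn k m nk (leq_trans nk nm)).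
Qed.

End riesz_fischer.

(** * A Hilbert structure on H^2 *)

Section hilbert_structure.
Context {R : realType}.
Variables (m : nat) (L : R) (L0 : 0 < L).
Implicit Types (a b c x y : R) (v w z u : R -> 'rV[R]_m) (i : 'I_m).
Local Notation mu := (@lebesgue_measure R).
(* Conversion must not unfold these: the checks explode. *)
#[local] Opaque wderiv rint.
Local Notation D1 := (wderiv L).
Local Notation D2 v := (wderiv L (wderiv L v)).

(** Differences and midpoints are both instances, so one expansion of each quadratic form serves for
    all. *)
Definition comb a b v w : R -> 'rV[R]_m := fun x => a *: v x + b *: w x.

Lemma combE a b v w x i : comb a b v w x 0 i = a * v x 0 i + b * w x 0 i.
Proof. by rewrite /comb !mxE. Qed.

Lemma combB v w : (fun x => v x - w x) = comb 1 (-1) v w.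
Proof. by apply/funext => x; rewrite /comb scale1r scaleN1r. Qed.

Lemma prim_comb a b (f g h k : R -> R) : prim 0 L f g -> prim 0 L h k ->
  prim 0 L (fun x => a * f x + b * h x) (fun x => a * g x + b * k x).
Proof.
move=> fg hk; have z : prim 0 L (fun=> 0 : R) (fun=> 0 : R).
  split; first exact: sqi_cst.
  by move=> x /[!in_itv] /= /andP[x0 _]; rewrite rint_cst // mul0r addr0.
have := prim_lin a fg (prim_lin b hk z).
by apply: eq_prim => x _; rewrite addr0.
Qed.

Lemma H2rep_comb a b v v1 v2 w w1 w2 : H2rep L v v1 v2 -> H2rep L w w1 w2 ->
  H2rep L (comb a b v w) (comb a b v1 w1) (comb a b v2 w2).
Proof.
move=> rv rw i; have [p1 p2] := rv i; have [q1 q2] := rw i.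
by split; [have := prim_comb a b p1 q1|have := prim_comb a b p2 q2];
  apply: eq_prim => x _; rewrite /comb !mxE.
Qed.

Lemma H2_comb a b v w : H2 L v -> H2 L w -> H2 L (comb a b v w).
Proof.
move=> /(H2_rep L0) rv /(H2_rep L0) rw.
exact: H2rep_H2 L0 (H2rep_comb a b rv rw).
Qed.

Lemma D1_rep v v1 v2 : H2rep L v v1 v2 -> {in `[0, L], D1 v =1 v1}.
Proof.
move=> r; have r' := H2_rep L0 (H2rep_H2 L0 r).
by have [] := H2rep_uniq L0 r' r (fun x _ => erefl).
Qed.

Lemma D2_rep v v1 v2 : H2rep L v v1 v2 ->
  forall i, {ae mu, forall x, x \in `]0, L[ -> D2 v x 0 i = v2 x 0 i}.
Proof.
move=> r; have r' := H2_rep L0 (H2rep_H2 L0 r).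
by have [] := H2rep_uniq L0 r' r (fun x _ => erefl).
Qed.

Lemma D1_comb a b v w x : H2 L v -> H2 L w -> x \in `[0, L] ->
  D1 (comb a b v w) x = a *: D1 v x + b *: D1 w x.
Proof.
move=> /(H2_rep L0) rv /(H2_rep L0) rw.
exact: D1_rep (H2rep_comb a b rv rw) x.
Qed.

Lemma D2_sqi v i : H2 L v -> sqi 0 L (fun x => D2 v x 0 i).
Proof. by move=> /(H2_rep L0) /(_ i) [_ []]. Qed.

Lemma H2rep_sqi2 v v1 v2 i : H2rep L v v1 v2 -> sqi 0 L (fun x => v2 x 0 i).
Proof. by move=> /(_ i) [_ []]. Qed.

Definition bend v w := \sum_i rint 0 L (fun x => D2 v x 0 i * D2 w x 0 i).
Definition pair0 v w := \sum_i (v 0 0 i * w 0 0 i + D1 v 0 0 i * D1 w 0 0 i).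
Definition NB v w := pair0 v w + bend v w.
Definition NN v := NB v v.

Lemma rint_D2 v v1 v2 i (h : R -> R) : H2rep L v v1 v2 -> sqi 0 L h ->
  rint 0 L (fun x => D2 v x 0 i * h x) = rint 0 L (fun x => v2 x 0 i * h x).
Proof.
move=> r sh; apply: eq_ae_sqi_rint_mul => //.
- by apply: D2_sqi; exact: H2rep_H2 r.
- exact: H2rep_sqi2 r.
- exact: D2_rep r i.
Qed.

Lemma bend_rep v v1 v2 w w1 w2 : H2rep L v v1 v2 -> H2rep L w w1 w2 ->
  bend v w = \sum_i rint 0 L (fun x => v2 x 0 i * w2 x 0 i).
Proof.
move=> rv rw; apply: eq_bigr => i _.
rewrite (rint_D2 i rv); last by apply: D2_sqi; exact: H2rep_H2 rw.
under eq_rint do rewrite mulrC.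
rewrite (rint_D2 i rw); last exact: H2rep_sqi2 rv.
by apply: eq_rint => x _; rewrite mulrC.
Qed.

Lemma bendC v w : bend v w = bend w v.
Proof. by apply: eq_bigr => i _; apply: eq_rint => x _; exact: mulrC. Qed.

Lemma NBC v w : NB v w = NB w v.
Proof.
rewrite /NB bendC; congr (_ + _); apply: eq_bigr => i _.
by congr (_ + _); exact: mulrC.
Qed.

Lemma bend_combl a b v w z : H2 L v -> H2 L w -> H2 L z ->
  bend (comb a b v w) z = a * bend v z + b * bend w z.
Proof.
move=> hv hw hz.
have [rv rw] := (H2_rep L0 hv, H2_rep L0 hw).
rewrite (bend_rep (H2rep_comb a b rv rw) (H2_rep L0 hz)).
rewrite /bend !mulr_sumr -big_split; apply: eq_bigr => i _ /=.
have sv := D2_sqi i hv; have sw := D2_sqi i hw; have sz := D2_sqi i hz.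
rewrite -!rintZ; [|exact: sqi_mul..].
rewrite -rintD; [|by apply: ibleZ; exact: sqi_mul..].
have H p q r : (a * p + b * q) * r = a * (p * r) + b * (q * r) by ring.
by apply: eq_rint => x _; rewrite combE; exact: H.
Qed.

Let zL : (0 : R) \in `[0, L]. Proof. by rewrite in_itv /= lexx ltW. Qed.

Lemma NB_combl a b v w z : H2 L v -> H2 L w -> H2 L z ->
  NB (comb a b v w) z = a * NB v z + b * NB w z.
Proof.
move=> hv hw hz; rewrite /NB bend_combl //.
suff -> : pair0 (comb a b v w) z = a * pair0 v z + b * pair0 w z.
  by rewrite !mulrDr addrACA.
rewrite /pair0 !mulr_sumr -big_split; apply: eq_bigr => i _ /=.
rewrite (D1_comb a b hv hw zL) combE (combE a b (D1 v) (D1 w) 0 i).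
by move: (D1 v 0 0 i) (D1 w 0 0 i) (D1 z 0 0 i) (v 0 0 i) (w 0 0 i) (z 0 0 i) => *; ring.
Qed.

Lemma bend_comb a b v w : H2 L v -> H2 L w ->
  bend (comb a b v w) (comb a b v w) =
  a ^+ 2 * bend v v + 2 * a * b * bend v w + b ^+ 2 * bend w w.
Proof.
move=> hv hw; have hc := H2_comb a b hv hw.
rewrite (bend_combl a b hv hw hc) (bendC v) (bendC w).
rewrite (bend_combl a b hv hw hv) (bend_combl a b hv hw hw) (bendC w v).
by move: (bend v v) (bend v w) (bend w w) => A B C; ring.
Qed.

Lemma NN_comb a b v w : H2 L v -> H2 L w ->
  NN (comb a b v w) = a ^+ 2 * NN v + 2 * a * b * NB v w + b ^+ 2 * NN w.
Proof.
move=> hv hw; have hc := H2_comb a b hv hw.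
rewrite /NN (NB_combl a b hv hw hc) (NBC v) (NBC w).
rewrite (NB_combl a b hv hw hv) (NB_combl a b hv hw hw) (NBC w v).
by move: (NB v v) (NB v w) (NB w w) => A B C; ring.
Qed.

Lemma bend_ge0 v : 0 <= bend v v.
Proof. by apply: sumr_ge0 => i _; apply: rint_ge0 => x; rewrite -expr2 sqr_ge0. Qed.

Lemma pair0_ge0 v : 0 <= pair0 v v.
Proof. by apply: sumr_ge0 => i _; rewrite -!expr2 addr_ge0 // sqr_ge0. Qed.

Lemma NN_ge0 v : 0 <= NN v.
Proof. by rewrite addr_ge0 ?pair0_ge0 ?bend_ge0. Qed.

Lemma bend_le_NN v : bend v v <= NN v.
Proof. by rewrite /NN /NB lerDr pair0_ge0. Qed.

Lemma bend_cauchy_schwarz v w : H2 L v -> H2 L w ->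
  bend v w ^+ 2 <= bend v v * bend w w.
Proof.
move=> hv hw; have q s t : 0 <= s ^+ 2 * bend v v + 2 * s * t * bend v w + t ^+ 2 * bend w w.
  by rewrite -bend_comb // bend_ge0.
have A0 := bend_ge0 v; have B0 := bend_ge0 w.
move: (bend v v) (bend w w) (bend v w) A0 B0 q => A B C A0 B0 q.
have [B00|B1] := eqVneq B 0.
  have := q C (- (A + 1)); rewrite B00.
  have C0 := sqr_ge0 C; have C2 := mulr_ge0 A0 C0 => h.
  by rewrite mulr0; nra.
have Bp : 0 < B by rewrite lt_neqAle eq_sym B1.
have := q B (- C); rewrite -subr_ge0 => h.
have : 0 <= B * (A * B - C ^+ 2) by move: h; rewrite subr0; nra.
by rewrite pmulr_rge0 // subr_ge0.
Qed.

Lemma bending_energyE v : H2 L v -> bending_energy L v = 2^-1 * bend v v.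
Proof.
move=> hv; rewrite /bending_energy; congr (_ * _).
have s2 : in_L2 L (D2 v) by move=> i; exact: D2_sqi.
have := L2norm_sqr s2; rewrite /L2norm sqr_sqrtr; last first.
  by apply: Rintegral_ge0 => x _; rewrite sqr_ge0.
by move=> ->; apply: eq_bigr => i _; apply: eq_rint => x _; rewrite expr2.
Qed.

Lemma H2norm_sqr v : H2 L v -> H2norm L v ^+ 2 = \sum_i
  (rint 0 L (fun x => v x 0 i ^+ 2) + rint 0 L (fun x => D1 v x 0 i ^+ 2) +
   rint 0 L (fun x => D2 v x 0 i ^+ 2)).
Proof.
move=> hv; have r := H2_rep L0 hv.
rewrite /H2norm sqr_sqrtr ?addr_ge0 ?sqr_ge0 //.
rewrite !big_split /=; congr (_ + _ + _); apply: L2norm_sqr => i.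
- by have [/prim_sqi_fun] := r i.
- by have [[]] := r i.
- by have [_ []] := r i.
Qed.

Lemma NNE v : NN v = \sum_i (v 0 0 i ^+ 2 + D1 v 0 0 i ^+ 2 +
  rint 0 L (fun x => D2 v x 0 i ^+ 2)).
Proof.
rewrite /NN /NB /pair0 /bend -big_split; apply: eq_bigr => i _ /=.
by rewrite -!expr2; congr (_ + _); apply: eq_rint => x _; rewrite expr2.
Qed.

Let rint_sqr_ge0 (f : R -> R) : 0 <= rint 0 L (fun x => f x ^+ 2).
Proof. by apply: rint_ge0 => x; exact: sqr_ge0. Qed.

Lemma H2norm_le_NN : exists2 K, 0 <= K & forall v, H2 L v -> H2norm L v ^+ 2 <= K * NN v.
Proof.
(* With A, B, V2 standing for v(0)^2, v'(0)^2 and the integral of v''^2, the bounds are 2 L B + 2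
   L^2 V2 for v' and 2 L A + 4 L^3 B + 4 L^4 V2 for v; the constant adds up all coefficients. *)
exists (1 + 2 * L + 2 * L ^+ 2 + 4 * L ^+ 3 + 4 * L ^+ 4).
  by rewrite !addr_ge0 // mulr_ge0 ?exprn_ge0 // ltW.
move=> v hv; rewrite H2norm_sqr // NNE mulr_sumr; apply: ler_sum => i _.
have [p1 p2] := H2_rep L0 hv i.
have := prim_rint_sqr (ltW L0) p1; have := prim_rint_sqr (ltW L0) p2; rewrite subr0.
have := rint_sqr_ge0 (fun x => D1 v x 0 i).
have := rint_sqr_ge0 (fun x => D2 v x 0 i).
have := sqr_ge0 (v 0 0 i); have := sqr_ge0 (D1 v 0 0 i).
move: (rint 0 L (fun x => D2 v x 0 i ^+ 2)) (rint 0 L (fun x => D1 v x 0 i ^+ 2)) (rint 0 L (fun x => v x 0 i ^+ 2)) (v 0 0 i ^+ 2) (D1 v 0 0 i ^+ 2).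
move=> V2 V1 V A B B0 A0 V20 V10 h1 h0.
have L1 := ltW L0.
have h0' : V <= L * (2 * A + 2 * L * (L * (2 * B + 2 * L * V2))).
  apply: le_trans h0 _; apply: ler_wpM2l => //; rewrite lerD2l.
  by apply: ler_wpM2l => //; rewrite mulr_ge0.
have := mulr_ge0 L1 A0; have := mulr_ge0 L1 B0; have := mulr_ge0 L1 V20.
have := mulr_ge0 (exprn_ge0 2 L1) A0; have := mulr_ge0 (exprn_ge0 2 L1) B0; have := mulr_ge0 (exprn_ge0 2 L1) V20.
have := mulr_ge0 (exprn_ge0 3 L1) A0; have := mulr_ge0 (exprn_ge0 3 L1) B0; have := mulr_ge0 (exprn_ge0 3 L1) V20.
have := mulr_ge0 (exprn_ge0 4 L1) A0; have := mulr_ge0 (exprn_ge0 4 L1) B0; have := mulr_ge0 (exprn_ge0 4 L1) V20.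
by lra.
Qed.

Lemma NN_le_H2norm : exists2 K, 0 <= K & forall v, H2 L v -> NN v <= K * H2norm L v ^+ 2.
Proof.
exists (2 / L + 2 * L + 2 / L + 2 * L + 1).
  by rewrite !addr_ge0 // ?mulr_ge0 ?invr_ge0 // ltW.
move=> v hv; rewrite H2norm_sqr // NNE mulr_sumr; apply: ler_sum => i _.
have [p1 p2] := H2_rep L0 hv i.
have := prim_eval L0 p1 zL; have := prim_eval L0 p2 zL; rewrite subr0.
have := rint_sqr_ge0 (fun x => D1 v x 0 i).
have := rint_sqr_ge0 (fun x => D2 v x 0 i).
have := rint_sqr_ge0 (fun x => v x 0 i).
move: (rint 0 L (fun x => D2 v x 0 i ^+ 2)) (rint 0 L (fun x => D1 v x 0 i ^+ 2)) (rint 0 L (fun x => v x 0 i ^+ 2)) (v 0 0 i ^+ 2) (D1 v 0 0 i ^+ 2).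
move=> V2 V1 V A B V0 V20 V10 hB hA.
have A' : A <= 2 / L * V + 2 * L * V1.
  rewrite -(ler_pM2l L0) (_ : L * (_ + _) = 2 * V + 2 * L ^+ 2 * V1) //.
  by field; rewrite gt_eqF.
have B' : B <= 2 / L * V1 + 2 * L * V2.
  rewrite -(ler_pM2l L0) (_ : L * (_ + _) = 2 * V1 + 2 * L ^+ 2 * V2) //.
  by field; rewrite gt_eqF.
have L1 := ltW L0; have Li : 0 <= 2 / L by rewrite mulr_ge0 ?invr_ge0.
have := mulr_ge0 L1 V0; have := mulr_ge0 L1 V10; have := mulr_ge0 L1 V20.
have := mulr_ge0 Li V0; have := mulr_ge0 Li V10; have := mulr_ge0 Li V20.
by lra.
Qed.

Lemma D1_le_NN : exists2 K, 0 <= K & forall v x i, H2 L v -> x \in `[0, L] ->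
  D1 v x 0 i ^+ 2 <= K * NN v.
Proof.
have L1 := ltW L0.
exists (2 + 2 * L) => [|v x i hv xL]; first by lra.
have [_ p2] := H2_rep L0 hv i.
have := prim_sup p2 xL; rewrite subr0 => /le_trans; apply.
rewrite NNE (bigD1 i) //= mulrDr; apply: ler_wpDr.
  rewrite mulr_ge0 ?addr_ge0 ?mulr_ge0 //; apply: sumr_ge0 => j _.
  by rewrite !addr_ge0 ?sqr_ge0.
have := rint_sqr_ge0 (fun x => D2 v x 0 i).
have := sqr_ge0 (v 0 0 i); have := sqr_ge0 (D1 v 0 0 i).
move: (rint _ _ _) (v 0 0 i ^+ 2) (D1 v 0 0 i ^+ 2) => C A B A0 B0 C0.
have := mulr_ge0 L1 A0; have := mulr_ge0 L1 B0; have := mulr_ge0 L1 C0.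
by lra.
Qed.

Lemma holder_NN : exists2 K, 0 <= K & forall v x y i, H2 L v ->
  x \in `[0, L] -> y \in `[0, L] ->
  (v x 0 i - v y 0 i) ^+ 2 <= K * `|x - y| * NN v /\
  (D1 v x 0 i - D1 v y 0 i) ^+ 2 <= K * `|x - y| * NN v.
Proof.
have L1 := ltW L0; have [K K0 hK] := D1_le_NN.
have KL : 0 <= K * L by rewrite mulr_ge0.
(* The integral of v'^2 is at most K L [NN], that of v''^2 at most [NN]; the sum covers both
   estimates. *)
exists (K * L + 1) => [|v x y i hv xL yL]; first by lra.
have [p1 p2] := H2_rep L0 hv i.
have H (f g : R -> R) M : prim 0 L f g -> rint 0 L (fun t => g t ^+ 2) <= M ->
    (f x - f y) ^+ 2 <= `|x - y| * M.
  move=> fg gM.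
  have M0 : 0 <= M by apply: le_trans gM.
  move: xL yL; rewrite !in_itv /= => /andP[x0 xL] /andP[y0 yL].
  have [le|/ltW le] := leP x y.
    rewrite -sqrrN opprB distrC ger0_norm ?subr_ge0 //.
    apply: le_trans (prim_holder fg _ _ _) _ => //.
    by apply: ler_wpM2l; rewrite ?subr_ge0.
  rewrite ger0_norm ?subr_ge0 //.
  apply: le_trans (prim_holder fg _ _ _) _ => //.
  by apply: ler_wpM2l; rewrite ?subr_ge0.
have N0 := NN_ge0 v.
have LE M : M <= (K * L + 1) * NN v -> `|x - y| * M <= (K * L + 1) * `|x - y| * NN v.
  by move=> h; rewrite [_ * `|_|]mulrC -mulrA; apply: ler_wpM2l.
split.
  apply: le_trans (LE (K * L * NN v) _); last first.
    by rewrite mulrDl mul1r lerDl.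
  apply: H p1 _.
  rewrite -mulrA [L * _]mulrC mulrA -[X in _ * X](subr0 L) -rint_cst //.
  apply: ler_rint.
  - exact: sqi_ible2 (prim_sqi_fun p2).
  - exact: ible_cst.
  by move=> t /subset_itv_oo_cc tL; exact: hK.
apply: le_trans (LE (NN v) _); last first.
  by rewrite mulrDl mul1r lerDr mulr_ge0.
apply: H p2 _; rewrite NNE (bigD1 i) //=.
have : 0 <= \sum_(j < m | j != i) (v 0 0 j ^+ 2 + D1 v 0 0 j ^+ 2 + rint 0 L (fun x0 => D2 v x0 0 j ^+ 2)).
  by apply: sumr_ge0 => j _; rewrite !addr_ge0 ?sqr_ge0.
have := sqr_ge0 (v 0 0 i); have := sqr_ge0 (D1 v 0 0 i); lra.
Qed.

Lemma eval_le_NN : exists2 K, 0 <= K & forall v x i, H2 L v -> x \in `[0, L] ->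
  v x 0 i ^+ 2 <= K * NN v.
Proof.
have L1 := ltW L0; have [K K0 hK] := holder_NN.
exists (2 * K * L + 2) => [|v x i hv xL].
  by rewrite addr_ge0 // mulr_ge0 // mulr_ge0.
have [h _] := hK v x 0 i hv xL zL.
have : v 0 0 i ^+ 2 <= NN v.
  rewrite NNE (bigD1 i) //=.
  have : 0 <= \sum_(j < m | j != i) (v 0 0 j ^+ 2 + D1 v 0 0 j ^+ 2 + rint 0 L (fun x0 => D2 v x0 0 j ^+ 2)).
    by apply: sumr_ge0 => j _; rewrite !addr_ge0 ?sqr_ge0.
  have := sqr_ge0 (D1 v 0 0 i); have := rint_sqr_ge0 (fun x => D2 v x 0 i); lra.
have : K * `|x - 0| * NN v <= K * L * NN v.
  apply: ler_wpM2r; first exact: NN_ge0.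
  apply: ler_wpM2l => //; move: xL; rewrite in_itv /= subr0 => /andP[x0 xL].
  by rewrite ger0_norm.
have := sqr_ge0 (v x 0 i - 2 * v 0 0 i); nra.
Qed.

End hilbert_structure.

(** * Completeness, Mazur's lemma and weak convergence *)

Section weak_compactness.
Context {R : realType}.
Variables (m : nat) (L : R) (L0 : 0 < L).
Implicit Types (a b x y : R) (v w z u : R -> 'rV[R]_m) (i : 'I_m).
#[local] Opaque wderiv rint.
Local Notation D1 := (wderiv L).
Local Notation D2 v := (wderiv L (wderiv L v)).
Local Notation dist2 v w := (NN L (comb 1 (-1) v w)).

Let zL : (0 : R) \in `[0, L]. Proof. by rewrite in_itv /= lexx ltW. Qed.

Lemma cvg0_squeeze (u : nat -> R) : (forall n, 0 <= u n) ->
  (forall e, 0 < e -> exists N, forall n, (N <= n)%N -> u n <= e) ->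
  u n @[n --> \oo] --> (0 : R).
Proof.
move=> u0 h; apply/cvgrPdist_le => e e0; have [N hN] := h e e0.
by exists N => // n /= Nn; rewrite sub0r normrN ger0_norm // hN.
Qed.

Lemma cvg0_le (u v : nat -> R) : (forall n, 0 <= u n) -> (forall n, u n <= v n) ->
  v n @[n --> \oo] --> (0 : R) -> u n @[n --> \oo] --> (0 : R).
Proof.
move=> u0 uv /cvgrPdist_le v0; apply/cvgrPdist_le => e /v0.
apply: filterS => n; rewrite !sub0r !normrN (ger0_norm (u0 n)).
by apply: le_trans; apply: le_trans (uv n) (ler_norm _).
Qed.

Lemma cvg0_sum (I : Type) (s : seq I) (f : nat -> I -> R) :
  (forall j : I, f n j @[n --> \oo] --> (0 : R)) ->
  \sum_(i <- s) f n i @[n --> \oo] --> (0 : R).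
Proof.
move=> f0; elim: s => [|j s IH].
  by under eq_cvg do rewrite big_nil; exact: cvg_cst.
have h : f n j + \sum_(k <- s) f n k @[n --> \oo] --> (0 + 0 : R) by exact: cvgD.
by rewrite addr0 in h; under eq_cvg do rewrite big_cons.
Qed.

Lemma cauchy_sqr_cvg (u : nat -> R) :
  (forall e, 0 < e -> exists N, forall k n, (N <= k)%N -> (N <= n)%N -> (u k - u n) ^+ 2 <= e) ->
  exists l : R, u n @[n --> \oo] --> l.
Proof.
move=> h; suff : cvgn u by move=> c; exists (limn u).
apply: cauchy_cvg; apply: cauchy_exP => e e0 /=.
have [|N hN] := h ((e / 2) ^+ 2); first by rewrite exprn_gt0 // divr_gt0.
exists (u N); exists N => // n /= Nn; rewrite /ball /=.
have := hN N n (leqnn N) Nn; rewrite -[leLHS]real_normK ?num_real //.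
rewrite ler_sqr ?nnegrE ?divr_ge0 // ?(ltW e0) // => /le_lt_trans; apply; lra.
Qed.

Lemma NN_rep v v1 v2 : H2rep L v v1 v2 -> NN L v = \sum_i
  (v 0 0 i ^+ 2 + v1 0 0 i ^+ 2 + rint 0 L (fun x => v2 x 0 i ^+ 2)).
Proof.
move=> r; rewrite /NN /NB (bend_rep L0 r r) /pair0 -big_split.
apply: eq_bigr => i _ /=; rewrite (D1_rep L0 r zL) -!expr2.
by congr (_ + _); apply: eq_rint => x _; rewrite expr2.
Qed.

Lemma dist2_rep v w w1 w2 : H2 L v -> H2rep L w w1 w2 -> dist2 v w = \sum_i
  ((v 0 0 i - w 0 0 i) ^+ 2 + (D1 v 0 0 i - w1 0 0 i) ^+ 2 +
    rint 0 L (fun x => (D2 v x 0 i - w2 x 0 i) ^+ 2)).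
Proof.
move=> hv rw; rewrite (NN_rep (H2rep_comb 1 (-1) (H2_rep L0 hv) rw)).
have H (p q : R) : (1 * p + -1 * q) ^+ 2 = (p - q) ^+ 2 by ring.
apply: eq_bigr => i _; congr (_ + _ + _); [by rewrite combE H..|].
by apply: eq_rint => x _; rewrite combE; exact: H.
Qed.

(** The distance splits into v(0), v'(0) and the L^2 norm of v''. Each part has a limit, and
    integrating twice reassembles an element of H^2. *)
Lemma H2_complete (c : nat -> R -> 'rV[R]_m) : (forall n, H2 L (c n)) ->
  (forall e, 0 < e -> exists N, forall k n, (N <= k)%N -> (N <= n)%N ->
     dist2 (c k) (c n) <= e) ->
  exists2 w, H2 L w & dist2 (c n) w @[n --> \oo] --> (0 : R).
Proof.
move=> hc cc.
have comp i e : 0 < e -> exists N, forall k n, (N <= k)%N -> (N <= n)%N ->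
    [/\ (c k 0 0 i - c n 0 0 i) ^+ 2 <= e, (D1 (c k) 0 0 i - D1 (c n) 0 0 i) ^+ 2 <= e &
     rint 0 L (fun x => (D2 (c k) x 0 i - D2 (c n) x 0 i) ^+ 2) <= e].
  move=> e0; have [N hN] := cc e e0; exists N => k n Nk Nn.
  have := hN k n Nk Nn; rewrite (dist2_rep (hc k) (H2_rep L0 (hc n))).
  rewrite (bigD1 i) //=; set S := \sum_(_ | _) _.
  have S0 : 0 <= S.
    apply: sumr_ge0 => j _; rewrite !addr_ge0 ?sqr_ge0 //.
    by apply: rint_ge0 => x; exact: sqr_ge0.
  have I0 : 0 <= rint 0 L (fun x => (D2 (c k) x 0 i - D2 (c n) x 0 i) ^+ 2).
    by apply: rint_ge0 => x; exact: sqr_ge0.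
  have := sqr_ge0 (c k 0 0 i - c n 0 0 i); have := sqr_ge0 (D1 (c k) 0 0 i - D1 (c n) 0 0 i).
  move: S0 I0; move: S (rint _ _ _) (_ ^+ 2) (_ ^+ 2) => A B C D *.
  by split; lra.
have /choice[p hp] i : exists p : R, c n 0 0 i @[n --> \oo] --> p.
  apply: cauchy_sqr_cvg => e /(comp i)[N hN].
  by exists N => k n Nk Nn; have [] := hN k n Nk Nn.
have /choice[q hq] i : exists q : R, D1 (c n) 0 0 i @[n --> \oo] --> q.
  apply: cauchy_sqr_cvg => e /(comp i)[N hN].
  by exists N => k n Nk Nn; have [] := hN k n Nk Nn.
have /choice[g hg] i : exists g, sqi 0 L g /\
    rint 0 L (fun x => (D2 (c n) x 0 i - g x) ^+ 2) @[n --> \oo] --> (0 : R).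
  have [||g sg gc] := @sqi_complete _ 0 L (fun n x => D2 (c n) x 0 i) (ltW L0).
  - by move=> n; apply: D2_sqi.
  - move=> e /(comp i)[N hN].
    by exists N => k n Nk Nn; have [] := hN k n Nk Nn.
  exists g; split => //; apply: cvg0_squeeze => // n.
  by apply: rint_ge0 => x; exact: sqr_ge0.
pose w2 x : 'rV[R]_m := \row_i g i x.
pose w1 x : 'rV[R]_m := \row_i (q i + rint 0 x (g i)).
pose w x : 'rV[R]_m := \row_i (p i + rint 0 x (fun t => q i + rint 0 t (g i))).
have prim_rint k (h : R -> R) : sqi 0 L h -> prim 0 L (fun x => k + rint 0 x h) h.
  by move=> sh; split => // x _; rewrite rint_nil addr0.
have r : H2rep L w w1 w2.
  move=> i; have [sg _] := hg i; have P1 := prim_rint (q i) _ sg.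
  have P0 := prim_rint (p i) _ (prim_sqi_fun P1).
  by split; [have := P0|have := P1]; apply: eq_prim => x _; rewrite mxE.
have w0 i : w 0 0 i = p i by rewrite mxE rint_nil addr0.
have w10 i : w1 0 0 i = q i by rewrite mxE rint_nil addr0.
have w2E i x : w2 x 0 i = g i x by rewrite mxE.
exists w; first exact: H2rep_H2 r.
under eq_cvg do rewrite (dist2_rep (hc _) r).
apply: cvg0_sum => i.
have sq (t : nat -> R) l : t n @[n --> \oo] --> l -> (t n - l) ^+ 2 @[n --> \oo] --> (0 : R).
  move=> tl; rewrite -(mulr0 (0 : R)) -(subrr l).
  by apply: cvgM; apply: cvgB => //; exact: cvg_cst.
rewrite -[X in _ --> X]addr0 -[X in _ --> X + _]addr0; apply: cvgD; [apply: cvgD|].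
- by rewrite w0; exact: sq.
- by rewrite w10; exact: sq.
- have [_] := hg i; under eq_cvg do under eq_rint do rewrite -w2E.
  by [].
Qed.

(** Closing under midpoints replaces the convex hull: the parallelogram identity uses midpoints
    only, and affine inequalities pass to them by the induction principle. *)
Inductive mhull (A : set (R -> 'rV[R]_m)) : set (R -> 'rV[R]_m) :=
| mhull_in v : A v -> mhull A v
| mhull_mid v w : mhull A v -> mhull A w -> mhull A (comb 2^-1 2^-1 v w).

Lemma mhull_ind_sub (A B : set (R -> 'rV[R]_m)) : A `<=` B ->
  (forall v w, B v -> B w -> B (comb 2^-1 2^-1 v w)) -> mhull A `<=` B.
Proof. by move=> AB Bm v; elim => [w /AB//|w z _ Bw _ Bz]; exact: Bm. Qed.

Lemma mhull_sub (A B : set (R -> 'rV[R]_m)) : A `<=` B -> mhull A `<=` mhull B.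
Proof.
move=> AB; apply: mhull_ind_sub; first by move=> v /AB; exact: mhull_in.
by move=> v w; exact: mhull_mid.
Qed.

Lemma mhull_H2 (A : set (R -> 'rV[R]_m)) : A `<=` H2 L -> mhull A `<=` H2 L.
Proof. by move=> AH; apply: mhull_ind_sub => // v w; exact: H2_comb. Qed.

(* Near-minimizers of the norm over a decreasing sequence of midpoint-convex
   sets form a Cauchy sequence, by the parallelogram identity. *)
Lemma midpoint_cauchy (K : nat -> set (R -> 'rV[R]_m)) (C : R) :
  (forall n, K n `<=` H2 L) -> (forall k n, (k <= n)%N -> K n `<=` K k) ->
  (forall n v w, K n v -> K n w -> K n (comb 2^-1 2^-1 v w)) ->
  (forall n, exists2 v, K n v & NN L v <= C) ->
  exists c, (forall n, K n (c n)) /\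
    forall e, 0 < e -> exists N, forall k n, (N <= k)%N -> (N <= n)%N ->
      dist2 (c k) (c n) <= e.
Proof.
move=> KH Kdec Kmid Kbd.
pose d n := inf [set NN L v | v in K n].
have hasl n : has_lbound [set NN L v | v in K n].
  by exists 0 => _ [v _ <-]; exact: NN_ge0.
have ne n : [set NN L v | v in K n] !=set0.
  by have [v Kv _] := Kbd n; exists (NN L v), v.
have dle n v : K n v -> d n <= NN L v by move=> Kv; apply: ge_inf => //; exists v.
have dC n : d n <= C by have [v /dle h1 h2] := Kbd n; exact: le_trans h2.
have dmono k n : (k <= n)%N -> d k <= d n.
  move=> kn; apply: lb_le_inf => // _ [v Kv <-]; apply: dle; exact: Kdec Kv.
have /choice[c hc] n : exists v, K n v /\ NN L v <= d n + n.+1%:R^-1.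
  have [|_ [v Kv <-] h] := @inf_adherent _ [set NN L v | v in K n] n.+1%:R^-1 _ (conj (ne n) (hasl n)).
    by rewrite invr_gt0.
  by exists v; split => //; exact: ltW.
exists c; split=> [n|e e0]; first by have [] := hc n.
(* The squared distance is 2 [NN] (c k) + 2 [NN] (c n) - 4 [NN] (midpoint), at most 4 (D + e/8) - 4
   (D - e/8) = e. *)
have e8 : 0 < e / 8 by rewrite divr_gt0.
pose D := sup (range d).
have hasu : has_ubound (range d) by exists C => _ [n _ <-].
have [|_ [N1 _ <-] hN1] := @sup_adherent _ (range d) (e / 8) e8 _.
  by split => //; exists (d 0%N), 0%N.
have dD n : d n <= D by apply: ub_le_sup => //; exists n.
have [N2 _ hN2] := near_infty_natSinv_lt (PosNum e8).
exists (maxn N1 N2) => k n; rewrite !geq_max => /andP[k1 k2] /andP[n1 n2].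
have bnd j : (N2 <= j)%N -> NN L (c j) <= D + e / 8.
  move=> j2; have [_ /le_trans] := hc j; apply; apply: lerD => //.
  by apply: ltW; exact: hN2.
have Hk := KH _ _ (hc k).1; have Hn := KH _ _ (hc n).1.
have mid : D - e / 8 <= NN L (comb 2^-1 2^-1 (c k) (c n)).
  apply: le_trans (ltW hN1) _; apply: dle; apply: Kmid.
    by apply: (Kdec N1 k) => //; exact: (hc k).1.
  by apply: (Kdec N1 n) => //; exact: (hc n).1.
have := bnd k k2; have := bnd n n2; move: mid.
rewrite (NN_comb L0 _ _ Hk Hn) (NN_comb L0 _ _ Hk Hn).
move: (NN L (c k)) (NN L (c n)) (NB L (c k) (c n)) => A B E.
lra.
Qed.

(** No weak limit is presupposed: w is the strong limit of elements of almost minimal norm in the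
    hulls of the tails, and has to be identified afterwards by its point values. *)
Lemma mazur (v_ : nat -> R -> 'rV[R]_m) (C : R) : (forall n, H2 L (v_ n)) ->
  (forall n, NN L (v_ n) <= C) ->
  exists (w : R -> 'rV[R]_m) (c : nat -> R -> 'rV[R]_m),
   [/\ H2 L w, forall n, mhull [set v_ k | k in [set k | (n <= k)%N]] (c n),
     forall n, H2 L (c n) & dist2 (c n) w @[n --> \oo] --> (0 : R)].
Proof.
move=> hv vC; set K := fun n => mhull [set v_ k | k in [set k | (n <= k)%N]].
have KH n : K n `<=` H2 L by apply: mhull_H2 => _ [k _ <-].
have [|||c [Kc cc]] := @midpoint_cauchy K C KH.
- move=> k n kn; apply: mhull_sub => _ [j /= nj <-]; exists j => //=; exact: leq_trans nj.
- by move=> n v w; exact: mhull_mid.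
- by move=> n; exists (v_ n) => //; apply: mhull_in; exists n => /=.
have cH n : H2 L (c n) by exact: KH (Kc n).
by have [w hw cw] := H2_complete cH cc; exists w, c.
Qed.

Lemma eval_cvg (c : nat -> R -> 'rV[R]_m) w x i :
  (forall n, H2 L (c n)) -> H2 L w ->
  dist2 (c n) w @[n --> \oo] --> (0 : R) -> x \in `[0, L] ->
  c n x 0 i @[n --> \oo] --> w x 0 i.
Proof.
move=> hc hw cw xL; have [K K0 hK] := eval_le_NN m L0.
have : (c n x 0 i - w x 0 i) ^+ 2 @[n --> \oo] --> (0 : R).
  apply: (@cvg0_le _ (fun n => K * dist2 (c n) w)) => [n|n|]; first exact: sqr_ge0.
    have := hK _ x i (H2_comb L0 1 (-1) (hc n) hw) xL.
    by rewrite combE mul1r mulN1r.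
  by rewrite -(mulr0 K); apply: cvgM => //; exact: cvg_cst.
move=> /cvgrPdist_lt h; apply/cvgrPdist_lt => e e0.
have := h (e ^+ 2) (exprn_gt0 2 e0); apply: filterS => n.
rewrite sub0r normrN ger0_norm ?sqr_ge0 // -real_normK ?num_real // distrC.
by rewrite ltr_sqr ?nnegrE // ltW.
Qed.

(** Being within e of l at x is preserved by midpoints, so it passes from a tail of [v_] to its
    hull. *)
Lemma mazur_eval (v_ c : nat -> R -> 'rV[R]_m) w x i l :
  (forall n, H2 L (c n)) -> H2 L w ->
  (forall n, mhull [set v_ k | k in [set k | (n <= k)%N]] (c n)) ->
  dist2 (c n) w @[n --> \oo] --> (0 : R) -> x \in `[0, L] ->
  v_ n x 0 i @[n --> \oo] --> l -> w x 0 i = l.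
Proof.
move=> hc hw mc cw xL vl; have cx := eval_cvg (i := i) hc hw cw xL.
suff : c n x 0 i @[n --> \oo] --> l.
  by move=> /(cvg_lim (@Rhausdorff R)) <-; move: cx => /(cvg_lim (@Rhausdorff R)) <-.
apply/cvgrPdist_le => e e0; move/cvgrPdist_le : vl => /(_ e e0)[N _ hN].
exists N => // n /= Nn.
apply: (@mhull_ind_sub _ (fun v => `|l - v x 0 i| <= e) _ _ _ (mc n)).
  by move=> _ [k /= nk <-]; apply: hN => /=; exact: leq_trans nk.
move=> v z hv hz; rewrite combE.
have -> : l - (2^-1 * v x 0 i + 2^-1 * z x 0 i) =
  2^-1 * (l - v x 0 i) + 2^-1 * (l - z x 0 i) by lra.
by move: hv hz; rewrite !ler_norml => /andP[h1 h2] /andP[h3 h4]; apply/andP; split; lra.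
Qed.

Lemma H2norm_dist_cvg (c : nat -> R -> 'rV[R]_m) w : (forall n, H2 L (c n)) -> H2 L w ->
  dist2 (c n) w @[n --> \oo] --> (0 : R) -> H2_strong_cvg L c w.
Proof.
move=> hc hw cw; have [K K0 hK] := @H2norm_le_NN R m L L0.
have : H2norm L (fun x => c n x - w x) ^+ 2 @[n --> \oo] --> (0 : R).
  apply: (@cvg0_le _ (fun n => K * dist2 (c n) w)) => [n|n|]; first exact: sqr_ge0.
    by rewrite combB; apply: hK; exact: H2_comb.
  by rewrite -(mulr0 K); apply: cvgM => //; exact: cvg_cst.
move=> /cvgrPdist_lt h; apply/cvgrPdist_lt => e e0.
have := h (e ^+ 2) (exprn_gt0 2 e0); apply: filterS => n.
rewrite !sub0r !normrN ger0_norm ?sqr_ge0 // ger0_norm; last exact: sqrtr_ge0.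
by rewrite ltr_sqr ?nnegrE ?sqrtr_ge0 // ltW.
Qed.

Lemma bounded_linear_comb (W : normedModType R) (F : (R -> 'rV[R]_m) -> W) a b v w :
  bounded_linear_H2 L F -> H2 L v -> H2 L w ->
  F (comb a b v w) = a *: F v + b *: F w.
Proof.
move=> [lF [C hC]] hv hw.
have h0 : H2 L (comb 0 0 v w) by exact: H2_comb.
have F0 : F (fun=> 0) = 0.
  have e0 : (fun=> 0) = comb 0 0 v w by apply/funext => x; rewrite /comb !scale0r addr0.
  have := lF 1 _ _ h0 h0; rewrite -e0 scale1r.
  have -> : (fun _ : R => (0 : 'rV[R]_m) + 0) = (fun=> 0) by apply/funext => x; rewrite addr0.
  rewrite scale1r.
  by move=> /eqP; rewrite -subr_eq0 opprD addrA subrr sub0r oppr_eq0 => /eqP.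
have hz : H2 L (fun=> (0 : 'rV[R]_m)).
  have -> // : (fun=> 0) = comb 0 0 v w by apply/funext => x; rewrite /comb !scale0r addr0.
have e1 : comb a b v w = (fun x => a *: v x + (fun y => b *: w y + (fun=> 0) y) x).
  by apply/funext => x; rewrite /comb addr0.
have e2 : comb b 0 w w = (fun y => b *: w y + (fun=> 0) y).
  by apply/funext => x; rewrite /comb scale0r.
have hbw := H2_comb L0 b 0 hw hw; rewrite e2 in hbw.
by rewrite e1 (lF a v _ hv hbw) (lF b w _ hw hz) F0 addr0.
Qed.

Lemma bounded_linear_cvg (F : (R -> 'rV[R]_m) -> R^o) (c : nat -> R -> 'rV[R]_m) w :
  bounded_linear_H2 L F -> (forall n, H2 L (c n)) -> H2 L w ->
  dist2 (c n) w @[n --> \oo] --> (0 : R) -> F (c n) @[n --> \oo] --> F w.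
Proof.
move=> bF hc hw cw; have [_ [C hC]] := bF.
have cs := H2norm_dist_cvg hc hw cw.
have : `|F w - F (c n)| @[n --> \oo] --> (0 : R).
  apply: (@cvg0_le _ (fun n => C * H2norm L (fun x => c n x - w x))) => [n|n|].
  - exact: normr_ge0.
  - rewrite combB distrC.
    have <- : F (comb 1 (-1) (c n) w) = F (c n) - F w.
      by rewrite bounded_linear_comb // scale1r scaleN1r.
    by apply: hC; exact: H2_comb.
  - by rewrite -(mulr0 C); apply: cvgM => //; exact: cvg_cst.
move=> /cvgrPdist_lt h; apply/cvgrPdist_lt => e e0.
by have := h e e0; apply: filterS => n; rewrite sub0r normrN normr_id.
Qed.

Lemma eq_dist2_0 v w : H2 L v -> H2 L w -> {in `[0, L], v =1 w} -> dist2 v w = 0.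
Proof.
move=> hv hw vw; have rw := H2_rep L0 hw; rewrite (dist2_rep hv rw).
have [e1 e2] := H2rep_uniq L0 (H2_rep L0 hv) rw vw.
rewrite big1 // => i _; rewrite vw // e1 // !subrr expr0n /= !add0r.
rewrite -[RHS](mul0r (L - 0)) -rint_cst; last exact: ltW.
apply: ae_eq_rint; [|exact: measurable_cst|].
  by apply: ible_meas; apply: sqi_ible2; apply: sqiB; exact: D2_sqi.
have H (p q : R) : p = q -> (p - q) ^+ 2 = 0 by move=> ->; rewrite subrr expr0n.
by have := e2 i; apply: ae_imp => x h xL; apply: H; exact: h.
Qed.

(** Functionals take total functions, whose values outside [0, L] are meaningless; boundedness rules
    out any influence of them, because the constant sequence v has distance 0 from w. *)
Lemma eq_bounded_linear (F : (R -> 'rV[R]_m) -> R^o) v w :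
  bounded_linear_H2 L F -> H2 L v -> H2 L w -> {in `[0, L], v =1 w} -> F v = F w.
Proof.
move=> bF hv hw vw.
have : F ((fun=> v) n) @[n --> \oo] --> F w.
  apply: bounded_linear_cvg => //; under eq_cvg do rewrite (eq_dist2_0 hv hw vw).
  exact: cvg_cst.
by move=> /(cvg_lim (@Rhausdorff R)) <-; rewrite lim_cst.
Qed.

(** * From pointwise convergence on a dense set to weak convergence *)

Section dense_pointwise.
Variable Q : set R.
Hypothesis Q_dense : forall x e, x \in `[0, L] -> 0 < e ->
  exists q, [/\ Q q, q \in `[0, L] & `|x - q| < e].

Lemma dense_within_eq v w : H2 L v -> H2 L w ->
  (forall q, Q q -> q \in `[0, L] -> v q = w q) -> {in `[0, L], v =1 w}.
Proof.
move=> hv hw vw x xL; apply/rowP => i; apply/eqP; rewrite -subr_eq0.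
apply/negPn/negP => d0.
have [K K0 hK] := holder_NN m L0; have hd := H2_comb L0 1 (-1) hv hw.
set D := dist2 v w in hK hd.
have dE y : comb 1 (-1) v w y 0 i = v y 0 i - w y 0 i by rewrite combE mul1r mulN1r.
have D0 : 0 <= K * D by rewrite mulr_ge0 // NN_ge0.
pose d := (v x 0 i - w x 0 i) ^+ 2.
have dp : 0 < d by rewrite exprn_even_gt0.
have [|q [Qq qL xq]] := Q_dense xL (e := d / (K * D + 1)).
  by rewrite divr_gt0 // ltr_wpDl.
have [h _] := hK _ x q i hd xL qL.
move: h; rewrite !dE (vw q) // subrr subr0 -/d mulrAC.
rewrite ltr_pdivlMr ?ltr_wpDl // in xq.
have := normr_ge0 (x - q); move: xq D0; rewrite -/D.
move: (K * D) `|x - q| d dp => A B C C0 *; nra.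
Qed.

(** The half-space where F is at least F u + e is closed under midpoints, so Mazur's combinations
    stay in it, while their strong limit equals u on the dense set and hence on [0, L]. *)
Lemma weak_cvg_no_gap (u_ : nat -> R -> 'rV[R]_m) u (C e : R) (F : (R -> 'rV[R]_m) -> R^o) :
  (forall n, H2 L (u_ n)) -> H2 L u -> (forall n, NN L (u_ n) <= C) ->
  (forall q i, Q q -> q \in `[0, L] -> u_ n q 0 i @[n --> \oo] --> u q 0 i) ->
  bounded_linear_H2 L F -> 0 < e ->
  (forall N, exists2 n, (N <= n)%N & F u + e <= F (u_ n)) -> False.
Proof.
move=> hu_ hu uC pc bF e0 gap.
have /choice[s hs] N : exists n, (N <= n)%N /\ F u + e <= F (u_ n).
  by have [n] := gap N; exists n.
have [||w [c [hw mc hc cw]]] := @mazur (fun n => u_ (s n)) C.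
- by move=> n; exact: hu_.
- by move=> n; exact: uC.
have Fc n : F u + e <= F (c n).
  have [] := @mhull_ind_sub _ (fun v => H2 L v /\ F u + e <= F v) _ _ _ (mc n) => //.
    by move=> _ [k _ <-]; split; [exact: hu_|have [] := hs k].
  move=> v z [hv Fv] [hz Fz]; split; first exact: H2_comb.
  by rewrite bounded_linear_comb // /GRing.scale /=; lra.
have wu : {in `[0, L], w =1 u}.
  apply: dense_within_eq => // q Qq qL; apply/rowP => i.
  apply: (mazur_eval hc hw mc cw qL); have /cvgrPdist_le h := pc q i Qq qL.
  apply/cvgrPdist_le => d d0; have [N _ hN] := h d d0; exists N => // n /= Nn.
  by apply: hN => /=; apply: leq_trans Nn _; have [] := hs n.
have := bounded_linear_cvg bF hc hw cw; rewrite (eq_bounded_linear bF hw hu wu).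
by move=> /ge_cvg/(_ Fc); lra.
Qed.

(* A weak limit of a subsequence violating the claim could be turned, by Mazur's
   lemma, into a strong limit, which has to be [u] by pointwise convergence. *)
Lemma weak_cvg_pointwise (u_ : nat -> R -> 'rV[R]_m) u (C : R) :
  (forall n, H2 L (u_ n)) -> H2 L u -> (forall n, NN L (u_ n) <= C) ->
  (forall q i, Q q -> q \in `[0, L] -> u_ n q 0 i @[n --> \oo] --> u q 0 i) ->
  H2_weak_cvg L u_ u.
Proof.
move=> hu_ hu uC pc F bF; apply/cvgrPdist_lt => e e0; apply: contrapT => nc.
have gap N : exists2 n, (N <= n)%N & e <= `|F u - F (u_ n)|.
  apply: contrapT => h; apply: nc; exists N => // n /= Nn.
  by rewrite ltNge; apply/negP => en; apply: h; exists n.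
have [up|] := pselect (forall N, exists2 n, (N <= n)%N & F u + e <= F (u_ n)).
  exact: weak_cvg_no_gap hu_ hu uC pc bF e0 up.
(* From [N0] on every gap lies on the other side, which is the same situation for - F. *)
move=> /existsNP[N0 hN0].
have bN : bounded_linear_H2 L (fun v => - F v : R^o).
  have [lF [B hB]] := bF; split; last by exists B => v hv; rewrite normrN; exact: hB.
  by move=> a v w hv hw; rewrite lF // opprD scalerN.
apply: (weak_cvg_no_gap hu_ hu uC pc bN e0) => N.
have [n] := gap (maxn N N0); rewrite geq_max => /andP[Nn N0n] en; exists n => //.
have : F (u_ n) < F u + e.
  by rewrite ltNge; apply/negP => h; apply: hN0; exists n.
move: en; have [h|h] := leP 0 (F u - F (u_ n)).
  by rewrite ger0_norm //; lra.
by rewrite ltr0_norm //; lra.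
Qed.

End dense_pointwise.

End weak_compactness.

(** * Weak compactness *)

Section diagonal_extraction.
Context {R : realType}.

(** Compactness gives a cluster point, and an ultrafilter converges to its cluster points since it
    contains each set or its complement. *)
Lemma ultra_bounded_limit (G : set_system nat) (a : nat -> R) (M : R) : UltraFilter G ->
  (forall n, `|a n| <= M) -> exists l, forall e, 0 < e -> G [set n | `|a n - l| < e].
Proof.
move=> UG aM.
have cM : compact `[- M, M] by exact: segment_compact.
have aG : (a @ G) `[- M, M]%classic.
  suff : G (a @^-1` `[- M, M]%classic) by [].
  by apply: filterS filterT => n _; have := aM n; rewrite ler_norml /= in_itv.
have [l [_ cl]] := cM (a @ G) _ aG.
exists l => e e0; have [//|h] := in_ultra_setVsetC [set n | `|a n - l| < e] UG.
have [|x [hx /= bx]] := cl [set x | ~ (`|x - l| < e)] (ball l e) _ (nbhsx_ballx l e e0).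
  exact: h.
by exfalso; apply: hx; rewrite distrC.
Qed.

(* The limits are taken along one ultrafilter, so that finitely many of them can
   be approximated simultaneously. *)
Lemma diagonal_extraction (a : nat -> nat -> R) (M : R) : (forall k n, `|a k n| <= M) ->
  exists (s : nat -> nat) (l : nat -> R), {homo s : i j / (i < j)%N} /\
    forall k, a k (s n) @[n --> \oo] --> l k.
Proof.
move=> aM; have [G [UG ooG]] := ultraFilterLemma (eventually_filter : ProperFilter \oo).
have /choice[l hl] k : exists l, forall e, 0 < e -> G [set n | `|a k n - l| < e].
  exact: ultra_bounded_limit.
(* [p.1] is the stage, which sets both the number of sequences treated and the accuracy; [p.2] is
   the previously chosen index. *)
have step p : exists n, (p.2 < n)%N /\
    forall k, (k <= p.1)%N -> `|a k n - l k| < p.1.+1%:R^-1.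
  have H N : G [set n | forall k, (k < N)%N -> `|a k n - l k| < p.1.+1%:R^-1].
    elim: N => [|N IH]; first by apply: filterS filterT.
    have p0 : 0 < p.1.+1%:R^-1 :> R by rewrite invr_gt0.
    have h := hl N _ p0.
    apply: filterS (filterI IH h) => n [/= h1 h2] k.
    by rewrite ltnS leq_eqVlt => /predU1P[->|/h1].
  have [n [/= h1 h2]] := filter_ex (filterI (H p.1.+1) (ooG _ (nbhs_infty_gt p.2))).
  by exists n.
have /choice[nxt hnxt] := step.
pose s := fix s n := if n is n'.+1 then nxt (n'.+1, s n') else nxt (0%N, 0%N).
have sn n : forall k, (k <= n)%N -> `|a k (s n) - l k| < n.+1%:R^-1.
  by case: n => [|n] k kn; [have [_] := hnxt (0%N, 0%N)|have [_] := hnxt (n.+1, s n)]; apply.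
exists s, l; split.
  apply: homo_ltn => [x y z|n]; first exact: ltn_trans.
  by have [] := hnxt (n.+1, s n).
move=> k; apply/cvgrPdist_lt => e e0.
have [N _ hN] := near_infty_natSinv_lt (PosNum e0).
exists (maxn N k) => // n /=; rewrite geq_max => /andP[Nn kn].
by rewrite distrC; apply: lt_trans (sn n k kn) _; exact: hN.
Qed.

End diagonal_extraction.

(** * Weak subsequential limits, bounded functionals and lower semicontinuity *)

Section weak_convergence.
Context {R : realType}.
Variables (m : nat) (L : R) (L0 : 0 < L).
Implicit Types (a b x y : R) (v w z u : R -> 'rV[R]_m) (i : 'I_m).
#[local] Opaque wderiv rint.
Local Notation D1 := (wderiv L).

(** The rational multiples of L in [0, L]. The minimum and the successor make every pair of naturals
    a valid index, so that pairs can be enumerated. *)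
Definition grid (p : nat * nat) : R := L * (minn p.1 p.2.+1)%:R / p.2.+1%:R.

Lemma grid_itv p : grid p \in `[0, L].
Proof.
rewrite in_itv /= /grid divr_ge0 ?mulr_ge0 ?(ltW L0) //=.
by rewrite ler_pdivrMr ?ltr0n // ler_pM2l // ler_nat geq_minr.
Qed.

Lemma grid_dense x e : x \in `[0, L] -> 0 < e ->
  exists q, [/\ range grid q, q \in `[0, L] & `|x - q| < e].
Proof.
rewrite in_itv /= => /andP[x0 xL] e0.
have [N _ hN] := near_infty_natSinv_lt (PosNum (divr_gt0 e0 L0)).
have := hN N (leqnn N) => /=; rewrite ltr_pdivlMr // => NL.
have t0 : 0 <= x / L * N.+1%:R by rewrite !mulr_ge0 ?invr_ge0 // ltW.
have /andP[] := truncn_itv t0.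
set p := Num.truncn _ => pt tp.
have pN : (p <= N.+1)%N.
  rewrite -(ler_nat R); apply: le_trans pt _.
  by rewrite ler_piMl // ler_pdivrMr // mul1r.
exists (grid (p, N)); split; [by exists (p, N)|exact: grid_itv|].
rewrite /grid /= (minn_idPl pN).
have N0 : 0 < N.+1%:R :> R by rewrite ltr0n.
have -> : x - L * p%:R / N.+1%:R = (x / L * N.+1%:R - p%:R) * (N.+1%:R^-1 * L).
  by field; rewrite !gt_eqF.
rewrite ger0_norm; last first.
  by rewrite mulr_ge0 ?subr_ge0 // mulr_ge0 ?invr_ge0 // ltW.
apply: le_lt_trans NL; rewrite -[leRHS]mul1r; apply: ler_wpM2r.
  by rewrite mulr_ge0 ?invr_ge0 // ltW.
by rewrite lerBlDr addrC natr1 ltW.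
Qed.

Lemma weak_compactness (u_ : nat -> R -> 'rV[R]_m) (C : R) :
  (forall n, H2 L (u_ n)) -> (forall n, NN L (u_ n) <= C) ->
  exists u s, [/\ H2 L u, {homo s : i j / (i < j)%N} &
    H2_weak_cvg L (fun n => u_ (s n)) u].
Proof.
move=> hu uC; have [K K0 hK] := @eval_le_NN R m L L0.
pose a k n : R := if unpickle k is Some (p, i) then u_ n (grid p) 0 i else 0.
have [|s [l [smono sl]]] := @diagonal_extraction R a (K * C + 1).
  move=> k n; have KC : 0 <= K * C.
    by rewrite mulr_ge0 //; apply: le_trans (uC n); exact: NN_ge0.
  rewrite /a; case: (unpickle k) => [[p i]|]; last by rewrite normr0; lra.
  have := hK _ (grid p) i (hu n) (grid_itv p).
  move=> /le_trans/(_ (ler_wpM2l K0 (uC n))).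
  rewrite -real_normK ?num_real //; have := normr_ge0 (u_ n (grid p) 0 i).
  move: `|u_ n (grid p) 0 i| => t t0 h; have := sqr_ge0 (t - 1); nra.
have us p i : u_ (s n) (grid p) 0 i @[n --> \oo] --> l (pickle (p, i)).
  by have := sl (pickle (p, i)); rewrite /a pickleK.
have [||u [c [hw mc hc cw]]] := @mazur _ _ _ L0 (fun n => u_ (s n)) C.
- by move=> n; exact: hu.
- by move=> n; exact: uC.
exists u, s; split => //.
apply: (weak_cvg_pointwise L0 grid_dense) (hw) (fun n => uC (s n)) _ => //.
move=> q i [p _ <-] pL.
have := us p i; rewrite -(mazur_eval L0 hc hw mc cw pL (us p i)) => h; exact: h.
Qed.

Lemma eval_bounded_linear x i : x \in `[0, L] ->
  bounded_linear_H2 L (fun v => v x 0 i : R^o).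
Proof.
move=> xL; split; first by move=> a v w _ _; rewrite !mxE.
have [K K0 hK] := @eval_le_NN R m L L0; have [K' K'0 hK'] := @NN_le_H2norm R m L L0.
exists (Num.sqrt (K * K')) => v hv.
rewrite -ler_sqr ?nnegrE ?mulr_ge0 ?sqrtr_ge0 // exprMn sqr_sqrtr ?mulr_ge0 //.
rewrite real_normK ?num_real //; apply: le_trans (hK v x i hv xL) _.
by rewrite -mulrA; apply: ler_wpM2l => //; exact: hK'.
Qed.

Lemma D1_lin a v w x : H2 L v -> H2 L w -> x \in `[0, L] ->
  D1 (fun x => a *: v x + w x) x = a *: D1 v x + D1 w x.
Proof.
move=> hv hw xL.
have -> : (fun x => a *: v x + w x) = comb a 1 v w by apply/funext => y; rewrite /comb scale1r.
by rewrite (D1_comb L0 a 1 hv hw xL) scale1r.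
Qed.

Lemma D1_bounded_linear x i : x \in `[0, L] ->
  bounded_linear_H2 L (fun v => D1 v x 0 i : R^o).
Proof.
move=> xL; split.
  move=> a v w hv hw; rewrite (D1_lin a hv hw xL).
  by have := combE a 1 (D1 v) (D1 w) x i; rewrite /comb scale1r mul1r.
have [K K0 hK] := @D1_le_NN R m L L0; have [K' K'0 hK'] := @NN_le_H2norm R m L L0.
exists (Num.sqrt (K * K')) => v hv.
rewrite -ler_sqr ?nnegrE ?mulr_ge0 ?sqrtr_ge0 // exprMn sqr_sqrtr ?mulr_ge0 //.
rewrite real_normK ?num_real //; apply: le_trans (hK v x i hv xL) _.
by rewrite -mulrA; apply: ler_wpM2l => //; exact: hK'.
Qed.

Lemma bend_bounded_linear u : H2 L u -> bounded_linear_H2 L (fun v => bend L v u : R^o).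
Proof.
move=> hu; split.
  move=> a v w hv hw.
  have -> : (fun x => a *: v x + w x) = comb a 1 v w by apply/funext => y; rewrite /comb scale1r.
  by rewrite (bend_combl L0 a 1 hv hw hu) mul1r.
have [K K0 hK] := @NN_le_H2norm R m L L0.
have b0 := bend_ge0 L u.
exists (Num.sqrt (bend L u u * K)) => v hv.
rewrite -ler_sqr ?nnegrE ?mulr_ge0 ?sqrtr_ge0 // exprMn sqr_sqrtr ?mulr_ge0 //.
rewrite real_normK ?num_real //; apply: le_trans (bend_cauchy_schwarz L0 hv hu) _.
have H (p q r : R) : 0 <= q -> p <= K * r -> p * q <= q * K * r.
  by move=> q0 h; rewrite mulrC -mulrA; exact: ler_wpM2l.
by apply: H b0 _; apply: le_trans (hK v hv); exact: bend_le_NN.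
Qed.

(** From 0 <= bend (u_n - u), the bending of u_n is at least 2 bend (u_n, u) - bend (u, u), and
    pairing with u is a bounded functional. The cross term counts twice, hence e / 2. *)
Lemma bend_lsc (u_ : nat -> R -> 'rV[R]_m) u e : (forall n, H2 L (u_ n)) -> H2 L u ->
  H2_weak_cvg L u_ u -> 0 < e ->
  \forall n \near \oo, bend L u u - e <= bend L (u_ n) (u_ n).
Proof.
move=> hu_ hu w e0; have := w _ (bend_bounded_linear hu).
move=> /cvgrPdist_le/(_ (e / 2))[|N _ hN]; first by rewrite divr_gt0.
exists N => // n /= /hN /=; rewrite ler_norml => /andP[_ h].
have := bend_ge0 L (comb 1 (-1) (u_ n) u).
rewrite (bend_comb L0 1 (-1) (hu_ n) hu).
move: h; move: (bend L (u_ n) u) (bend L u u) (bend L (u_ n) (u_ n)) => A B D *; lra.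
Qed.

End weak_convergence.

(** * C^1 cubic splines *)

Section cubic_splines.
Context {R : realType}.
Implicit Types (a b c x y : R) (f g h : R -> R) (p q : {poly R}).

Lemma is_derive_horner_near f p x : {near x, f =1 horner p} ->
  is_derive x 1 f (deriv p).[x].
Proof.
move=> fp; have := is_derive_poly p x.
by apply: near_eq_is_derive; near=> y; apply/esym; near: y.
Unshelve. all: by end_near. Qed.

Lemma near_itv_horner a b f p x : x \in `]a, b[ ->
  {in `]a, b[, forall y, f y = p.[y]} -> {near x, f =1 horner p}.
Proof. by move=> xab fp; near=> y; apply: fp; near: y; exact: near_in_itvoo. Unshelve. all: by end_near. Qed.

(** Inside the element g is p', whose derivative p'' is affine; continuity of g extends the
    primitive relation to the end points. *)
Lemma cubic_piece a b f g p : a <= b -> (size p <= 4)%N ->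
  {within `[a, b], continuous g} ->
  {in `]a, b[, forall x, is_derive x 1 f (g x)} ->
  {in `[a, b], forall x, f x = p.[x]} ->
  exists c d, prim a b g (fun x => c + d * x).
Proof.
move=> ab sp gc fg fp.
have fp' : {in `]a, b[, forall x, f x = p.[x]}.
  by move=> x /subset_itv_oo_cc; exact: fp.
have gp : {in `]a, b[, forall x, g x = (deriv p).[x]}.
  move=> x xab; have [_ <-] := fg x xab.
  by have [_] := is_derive_horner_near (near_itv_horner xab fp').
have dg : {in `]a, b[, forall x, is_derive x 1 g (deriv (deriv p)).[x]}.
  by move=> x xab; exact: is_derive_horner_near (near_itv_horner xab gp).
have s2 : (size (deriv (deriv p)) <= 2)%N.
  have sd q : (size (deriv q) <= (size q).-1)%N by exact: size_poly.
  apply: leq_trans (sd _) _; have := sd p; case: (size p) sp => [|[|[|[|[|n]]]]] //= _;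
  by case: (size (deriv p)) => [|[|[|[|k]]]].
exists (deriv (deriv p))`_0, (deriv (deriv p))`_1.
have hE x : (deriv (deriv p)).[x] = (deriv (deriv p))`_0 + (deriv (deriv p))`_1 * x.
  by rewrite (horner_coef_wide _ s2) !big_ord_recl big_ord0 /= expr0 expr1 mulr1 addr0.
have cd : continuous (fun x => (deriv (deriv p))`_0 + (deriv (deriv p))`_1 * x).
  move=> x; apply: cvgD; first exact: cvg_cst.
  by apply: cvgM; [exact: cvg_cst|exact: cvg_id].
split; first by apply: sqi_continuous; exact: continuous_subspaceT.
move=> x /[!in_itv] /= /andP[ax xb].
rewrite (rint_derive (F := g) ax); first by ring.
- exact: within_continuous_sub gc.
- exact: continuous_subspaceT.
- move=> y yax; rewrite -hE; apply: dg.
  by move: yax; rewrite !in_itv /= => /andP[-> /lt_le_trans->].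
Qed.

Lemma nodes_mono n (t : nat -> R) j k : (forall i, (i < n)%N -> t i < t i.+1) ->
  (j <= k <= n)%N -> t j <= t k.
Proof.
move=> tlt /andP[jk]; rewrite -(subnK jk); elim: (k - j)%N => [//|i IH] h.
by apply: le_trans (IH (ltnW h)) _; rewrite addSn ltW // tlt.
Qed.

Variables (L : R) (J : nat) (z : nat -> R).
Hypotheses (L0 : 0 < L) (zP : is_partition L J z).

Lemma partition_mono j k : (j <= k <= J)%N -> z j <= z k.
Proof.
by have [_ _ zlt] := zP; exact: nodes_mono.
Qed.

Lemma partition_itv j : (j <= J)%N -> z j \in `[0, L].
Proof.
have [<- <- _] := zP => jJ.
rewrite in_itv /= !partition_mono ?jJ ?leqnn //.
Qed.

Lemma partition_near x : x \in `[0, L] -> exists2 j, (j <= J)%N & `|x - z j| <= mesh_size J z.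
Proof.
rewrite in_itv /= => /andP[x0 xL]; have [z0 zJ zlt] := zP.
have H k : (k <= J)%N -> x <= z k -> exists2 j, (j <= J)%N & `|x - z j| <= mesh_size J z.
  elim: k => [_ xz|k IH kJ xz].
    exists 0%N => //; rewrite [x](_ : _ = z 0%N) ?subrr ?normr0; last first.
      by apply/eqP; rewrite eq_le xz z0.
    by apply: (big_ind (fun t => 0 <= t)) => // u v u0 v0; rewrite le_max u0.
  have [xk|kx] := leP x (z k); first exact: IH (ltnW kJ) xk.
  exists k; first exact: ltnW.
  apply: (@le_trans _ _ `|z k.+1 - z k|); last first.
    exact: (@le_bigmax _ _ _ _ (fun j : 'I_J => `|z j.+1 - z j|) (Ordinal kJ)).
  by rewrite !ger0_norm ?subr_ge0 ?lerD2r // ltW // (lt_le_trans kx).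
by apply: (H J) => //; rewrite zJ.
Qed.

(** Since g is continuous across the nodes, the piecewise affine second derivatives glue to one
    primitive relation without jump terms. *)
Lemma spline_prim f g : {within `[0, L], continuous f} -> {within `[0, L], continuous g} ->
  {in `]0, L[, forall x, is_derive x 1 f (g x)} ->
  (forall j, (j < J)%N -> exists2 p : {poly R}, (size p <= 4)%N & {in `[z j, z j.+1], forall x, f x = p.[x]}) ->
  prim 0 L f g /\ exists2 h, prim 0 L g h &
    forall j, (j < J)%N -> exists c d, {in `]z j, z j.+1[, forall x, h x = c + d * x}.
Proof.
move=> fc gc fg fp; split.
  split; first exact: sqi_continuous.
  move=> x /[!in_itv] /= /andP[x0 xL].
  rewrite (rint_derive (F := f) x0); first by ring.
  - exact: within_continuous_sub fc.
  - exact: within_continuous_sub gc.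
  - move=> y y0; apply: fg; move: y0.
    by rewrite !in_itv /= => /andP[-> /lt_le_trans->].
have [z0 zJ zlt] := zP.
suff H k : (k <= J)%N -> exists2 h, prim 0 (z k) g h & forall j, (j < k)%N ->
    exists c d, {in `]z j, z j.+1[, forall x, h x = c + d * x}.
  by have := H J (leqnn J); rewrite zJ.
elim: k => [_|k IH kJ].
  exists (fun=> 0) => //; rewrite z0; split; first exact: sqi_cst.
  move=> x /[!in_itv] /= x0; rewrite (le_anti x0); by rewrite rint_nil addr0.
have [h hp ha] := IH (ltnW kJ).
have zk := ltW (zlt k kJ).
have zk0 : 0 <= z k by rewrite -z0 partition_mono // (ltnW kJ).
have zkL : z k.+1 <= L by rewrite -zJ partition_mono // kJ leqnn.
have [p sp fpk] := fp k kJ.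
have [||c [d cd]] := @cubic_piece (z k) (z k.+1) f g p zk sp _ _ fpk.
- exact: within_continuous_sub gc.
- move=> x xk; apply: fg; move: xk; rewrite !in_itv /= => /andP[h1 h2].
  by rewrite (le_lt_trans zk0) // (lt_le_trans h2).
exists (fun x => if x < z k then h x else c + d * x); first exact: prim_cat hp cd.
move=> j; rewrite ltnS leq_eqVlt => /predU1P[->|jk].
  exists c, d => x /[!in_itv] /= /andP[kx _].
  by rewrite ltNge (ltW kx).
have [c' [d' E]] := ha j jk; exists c', d' => x xj; rewrite -E //.
move: xj; rewrite in_itv /= => /andP[_ xj].
by rewrite (lt_le_trans xj) // partition_mono // jk ltnW.
Qed.

Lemma C1_cubics_rep m (v : R -> 'rV[R]_m) : C1_cubics L J z v ->
  exists v1 v2, H2rep L v v1 v2 /\ forall (i : 'I_m) j, (j < J)%N ->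
    exists c d, {in `]z j, z j.+1[, forall x, v2 x 0 i = c + d * x}.
Proof.
move=> [[vc [g gc dg]] vp].
have H i : exists h, [/\ prim 0 L (fun x => v x 0 i) (fun x => g x 0 i),
    prim 0 L (fun x => g x 0 i) h & forall j, (j < J)%N ->
    exists c d, {in `]z j, z j.+1[, forall x, h x = c + d * x}].
  have [||||p1 [h p2 ha]] := @spline_prim (fun x => v x 0 i) (fun x => g x 0 i).
  - exact: (iffRL (within_continuous_row _ _)).
  - exact: (iffRL (within_continuous_row _ _)).
  - move=> x xL; have [dv e] := dg x xL.
    apply: DeriveDef; first by have /derivable_mxP := dv; apply.
    by rewrite -e (derive_mx dv) mxE.
  - move=> j jJ; have [p sp pv] := vp j i jJ; exists p => // x; exact: pv.
  by exists h.
have /choice[h hh] := H.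
exists g, (fun x => \row_i h i x); split.
  move=> i; have [p1 p2 _] := hh i; split => //.
  by apply: eq_prim p2 => // x _; rewrite mxE.
move=> i j jJ; have [_ _ ha] := hh i; have [c [d E]] := ha j jJ.
by exists c, d => x xj; rewrite mxE; exact: E.
Qed.

(** The truncated power of spline theory: its square is C^1 and vanishes left of c, so adding a
    polynomial multiple of it leaves all earlier pieces unchanged. *)
Definition ramp c x : R := Num.max 0 (x - c).

Lemma ramp_continuous c : continuous (ramp c).
Proof.
move=> x; have cx : {for x, continuous (fun x : R => x - c : R^o)}.
  by apply: cvgB; [exact: cvg_id|exact: cvg_cst].
exact: continuous_max (@cst_continuous _ _ (0 : R^o) x) cx.
Qed.

Lemma rampl c x : x <= c -> ramp c x = 0.
Proof. by move=> xc; apply/max_idPl; rewrite subr_le0. Qed.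

Lemma rampr c x : c <= x -> ramp c x = x - c.
Proof. by move=> xc; apply/max_idPr; rewrite subr_ge0. Qed.

Lemma is_derive_ramp2 c x : is_derive x 1 (fun x => ramp c x ^+ 2) (2 * ramp c x).
Proof.
have [xc|cx|->] := ltgtP x c.
- rewrite rampl ?(ltW xc) // mulr0.
  apply: near_eq_is_derive (is_derive_cst (0 : R) x 1).
  near=> y; rewrite /= rampl ?expr0n // ltW //; near: y; exact: lt_nbhsl.
- rewrite rampr ?(ltW cx) //.
  have E : {near x, horner (('X - c%:P) ^+ 2) =1 (fun x => ramp c x ^+ 2)}.
    near=> y; rewrite rampr; last by rewrite ltW //; near: y; exact: lt_nbhsr.
    by rewrite !hornerE.
  apply: near_eq_is_derive E _.
  rewrite (_ : 2 * (x - c) = (deriv (('X - c%:P) ^+ 2)).[x]); first exact: is_derive_poly.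
  have -> : deriv (('X - c%:P) ^+ 2) = ('X - c%:P) *+ 2.
    by rewrite expr2 derivM derivXsubC mulr1 mul1r mulr2n.
  by rewrite hornerMn hornerXsubC mulr_natl.
rewrite rampl // mulr0.
have K : (h^-1 *: (ramp c (h *: 1 + c) ^+ 2 - ramp c c ^+ 2)) @[h --> (0 : R)^'] --> (0 : R).
  apply/cvgrPdist_le => e e0; near=> h; rewrite sub0r normrN (rampl (lexx c)).
  rewrite expr0n /= subr0 /GRing.scale /= mulr1.
  have h0 : h != 0 by near: h; exact: nbhs_dnbhs_neq.
  have he : `|h| <= e by near: h; exact: dnbhs0_le.
  have rh : `|ramp c (h + c)| <= `|h|.
    have [hc|hc] := leP (h + c) c; first by rewrite rampl ?normr0.
    by rewrite rampr ?(ltW hc) // addrK.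
  rewrite normrM normfV normrX; apply: le_trans he.
  rewrite ler_pdivrMl ?normr_gt0 // -expr2.
  by rewrite ler_sqr ?nnegrE.
by apply: DeriveDef; [apply/cvg_ex; exists 0|exact: cvg_lim K].
Unshelve. all: by end_near. Qed.

(** Induction on the nodes: the function is kept polynomial beyond the last node, and a linear
    multiple of the squared ramp there has just the two parameters needed to correct value and slope
    at the next node. *)
Lemma hermite (n : nat) (t y d : nat -> R) : (forall j, (j < n)%N -> t j < t j.+1) ->
  exists f g, [/\ continuous g, forall x, is_derive x 1 f (g x),
    forall j, (j <= n)%N -> f (t j) = y j /\ g (t j) = d j,
    forall j, (j < n)%N -> exists2 p : {poly R}, (size p <= 4)%N & {in `[t j, t j.+1], forall x, f x = p.[x]} &
    exists2 p : {poly R}, (size p <= 4)%N & forall x, t n <= x -> f x = p.[x]].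
Proof.
elim: n => [_|n IH tlt].
  pose p : {poly R} := (y 0%N)%:P + (d 0%N) *: ('X - (t 0%N)%:P).
  exists (horner p), (fun=> d 0%N); split => //.
  - exact: cst_continuous.
  - move=> x; rewrite (_ : d 0%N = (deriv p).[x]); first exact: is_derive_poly.
    by rewrite derivD derivZ derivXsubC derivC add0r hornerZ hornerC mulr1.
  - by move=> [|//] _; rewrite !hornerE subrr mulr0 addr0.
  - exists p => //; apply: leq_trans (size_polyD _ _) _; rewrite geq_max.
    rewrite (leq_trans (size_polyC_leq1 _)) //=.
    by apply: leq_trans (size_scale_leq _ _) _; rewrite size_XsubC.
have [f [g [gc dg fy fp [p sp pf]]]] := IH (fun j jn => tlt j (ltnW jn)).
have tn := tlt n (ltnSn n).
have tmono j : (j <= n)%N -> t j <= t n.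
  by move=> jn; apply: (@nodes_mono n.+1) => //; rewrite jn leqnSn.
set c := t n in tn tmono pf *; set b := t n.+1 in tn *.
pose h := b - c; have h0 : h != 0 by rewrite subr_eq0 gt_eqF.
pose r := y n.+1 - f b; pose s := d n.+1 - g b.
(* The solution of al h^2 + be h^3 = r and 2 al h + 3 be h^2 = s, where r and s are the defects of
   value and slope at the new node. *)
pose al := (3 * r - s * h) / h ^+ 2; pose be := (s * h - 2 * r) / h ^+ 3.
pose q : {poly R} := al%:P + be *: ('X - c%:P).
pose F x := f x + q.[x] * ramp c x ^+ 2.
pose G x := g x + (be * ramp c x ^+ 2 + q.[x] * (2 * ramp c x)).
have qE x : q.[x] = al + be * (x - c) by rewrite !hornerE.
have dq x : is_derive x 1 (horner q) be.
  rewrite (_ : be = (deriv q).[x]); first exact: is_derive_poly.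
  by rewrite derivD derivZ derivXsubC derivC add0r hornerZ hornerC mulr1.
have FG x : x <= c -> F x = f x /\ G x = g x.
  by move=> xc; rewrite /F /G rampl // expr0n /= !mulr0 !addr0.
have slin (k l e : R) : (size (k%:P + l *: ('X - e%:P))%R <= 2)%N.
  apply: leq_trans (size_polyD _ _) _; rewrite geq_max.
  rewrite (leq_trans (size_polyC_leq1 _)) //=.
  by apply: leq_trans (size_scale_leq _ _) _; rewrite size_XsubC.
have sq : (size (p + q * ('X - c%:P) ^+ 2)%R <= 4)%N.
  apply: leq_trans (size_polyD _ _) _; rewrite geq_max sp /=.
  apply: leq_trans (size_polyMleq _ _) _; rewrite size_exp_XsubC addn3 /=.
  by rewrite !ltnS; exact: slin.
exists F, G; split.
- move=> x; apply: cvgD; first exact: gc.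
  apply: cvgD; apply: cvgM.
  + exact: cvg_cst.
  + by apply: cvgM; exact: ramp_continuous.
  + exact: continuous_horner.
  + by apply: cvgM; [exact: cvg_cst|exact: ramp_continuous].
- move=> x; have H := is_deriveD (dg x) (is_deriveM (dq x) (is_derive_ramp2 c x)).
  have -> : G x = g x + (q.[x] *: (2 * ramp c x) + ramp c x ^+ 2 *: be).
    by rewrite /G /GRing.scale /= addrC [be * _]mulrC addrC [_ + q.[x] * _]addrC.
  exact: H.
- move=> j; rewrite leq_eqVlt ltnS => /predU1P[->|jn]; last first.
    by have [-> ->] := FG _ (tmono j jn); exact: fy.
  rewrite -/b /F /G !rampr ?(ltW tn) // !qE -/h /al /be /r /s.
  by split; field.
- move=> j; rewrite ltnS leq_eqVlt => /predU1P[->|jn]; last first.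
    have [p' sp' pf'] := fp j jn; exists p' => // x xj; rewrite -pf' //.
    have [] // := FG x; move: xj; rewrite in_itv /= => /andP[_ /le_trans]; apply.
    exact: tmono.
  exists (p + q * ('X - c%:P) ^+ 2) => //.
  move=> x; rewrite -/c -/b in_itv /= => /andP[cx _].
  by rewrite /F pf // rampr // !hornerE.
- exists (p + q * ('X - c%:P) ^+ 2) => //.
  move=> x bx; have cx : c <= x by apply: le_trans bx; exact: ltW.
  by rewrite /F pf // rampr // !hornerE.
Qed.

(** * Hermite interpolants and their orthogonality *)

Section interpolation.
Variable m : nat.
Implicit Types (v w e : R -> 'rV[R]_m) (i : 'I_m).
#[local] Opaque wderiv rint.
Local Notation D1 := (wderiv L).
Local Notation D2 v := (wderiv L (wderiv L v)).

Lemma C1_cubics_H2 v : C1_cubics L J z v -> H2 L v.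
Proof. by move=> /C1_cubics_rep[v1 [v2 [r _]]]; exact: H2rep_H2 r. Qed.

Lemma hermite_interpolant v : exists w, C1_cubics L J z w /\
  forall j, (j <= J)%N -> w (z j) = v (z j) /\ D1 w (z j) = D1 v (z j).
Proof.
have [z0 zJ zlt] := zP.
have /choice[f hf] i : exists f, exists g, [/\ continuous g, forall x, is_derive x 1 f (g x),
    forall j, (j <= J)%N -> f (z j) = v (z j) 0 i /\ g (z j) = D1 v (z j) 0 i &
    forall j, (j < J)%N -> exists2 p : {poly R}, (size p <= 4)%N & {in `[z j, z j.+1], forall x, f x = p.[x]}].
  have [f [g [h1 h2 h3 h4 _]]] := @hermite J z (fun j => v (z j) 0 i) (fun j => D1 v (z j) 0 i) zlt.
  by exists f, g; split.
have /choice[g hg] := hf.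
pose w x : 'rV[R]_m := \row_i f i x; pose w1 x : 'rV[R]_m := \row_i g i x.
have wE i : (fun x => w x 0 i) = f i by apply/funext => x; rewrite mxE.
have w1E i : (fun x => w1 x 0 i) = g i by apply/funext => x; rewrite mxE.
have dw x : is_derive x 1 w (w1 x).
  have dx : derivable w x 1.
    apply/derivable_mxP => k i; rewrite (ord1 k) wE.
    by have [_ h _ _] := hg i; have [] := h x.
  apply: DeriveDef => //; rewrite (derive_mx dx); apply/rowP => i; rewrite !mxE wE.
  by have [_ h _ _] := hg i; have [_] := h x.
have fc i : continuous (f i).
  move=> x; apply: differentiable_continuous; apply/derivable1_diffP.
  by have [_ h _ _] := hg i; have [] := h x.
have Cw : C1_cubics L J z w.
  split.
    split; first by apply/within_continuous_row => i; rewrite wE; exact: continuous_subspaceT.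
    exists w1; last by move=> x _; exact: dw.
    apply/within_continuous_row => i; rewrite w1E; apply: continuous_subspaceT.
    by have [] := hg i.
  move=> j i jJ; have [_ _ _ h] := hg i; have [p sp pf] := h j jJ.
  by exists p => // x xj; rewrite mxE pf.
exists w; split => // j jJ.
have [v1 [v2 [r _]]] := C1_cubics_rep Cw.
have P1 i : prim 0 L (f i) (g i).
  have [gc h _ hp] := hg i.
  have [||//] := @spline_prim (f i) (g i) _ _ (fun x _ => h x) hp.
    by apply: continuous_subspaceT; exact: fc.
  exact: continuous_subspaceT.
(* The chosen derivative and the constructed one are continuous and agree almost everywhere, so
   nodal values may be read off from [w1]. *)
have E : {in `[0, L], D1 w =1 w1}.
  have r' : H2rep L w (D1 w) (D2 w) by apply: H2_rep => //; exact: H2rep_H2 r.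
  move=> x xL; apply/rowP => i; have [p1 p2] := r' i.
  have cg : {within `[0, L], continuous (fun x => w1 x 0 i)}.
    by rewrite w1E; apply: continuous_subspaceT; have [] := hg i.
  apply: (ae_eq_within_continuous L0 (prim_continuous p2) cg _ xL).
  by apply: prim_uniq p1 _ (fun x _ => erefl); rewrite wE w1E.
have zj := partition_itv jJ.
split; first by apply/rowP => i; rewrite mxE; have [_ _ h _] := hg i; have [] := h j jJ.
by rewrite E //; apply/rowP => i; rewrite mxE; have [_ _ h _] := hg i; have [] := h j jJ.
Qed.

(* On each element the integral is [b (w'' e') - w''' (e)] up to boundary terms,
   since [w''] is affine there. *)
Lemma spline_orthogonality w e : C1_cubics L J z w -> H2 L e ->
  (forall j, (j <= J)%N -> e (z j) = 0 /\ D1 e (z j) = 0) -> bend L w e = 0.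
Proof.
move=> Cw he ez; have [w1 [w2 [r aff]]] := C1_cubics_rep Cw.
have re := H2_rep L0 he; rewrite (bend_rep L0 r re); apply: big1 => i _.
have [p1 p2] := re i; have [_ [sw _]] := r i.
have [z0 zJ zlt] := zP.
have ii : ible 0 L (fun x => w2 x 0 i * D2 e x 0 i) by apply: sqi_mul => //; exact: p2.1.
suff H k : (k <= J)%N -> rint 0 (z k) (fun x => w2 x 0 i * D2 e x 0 i) = 0.
  by rewrite -[L in rint _ L _]zJ; exact: H.
elim: k => [_|k IH kJ]; first by rewrite z0 rint_nil.
have zk0 : 0 <= z k by rewrite -z0 partition_mono // (ltnW kJ).
have zk := ltW (zlt k kJ).
have zkL : z k.+1 <= L by rewrite -zJ partition_mono // kJ leqnn.
rewrite (rint_cat zk0 zk); last exact: ible_sub ii.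
rewrite IH ?(ltnW kJ) // add0r.
have [c [d cd]] := aff i k kJ.
pose phi x := c + d * x.
have dphi x : is_derive x 1 phi d.
  have -> : phi = horner (c%:P + d *: 'X) by apply/funext => y; rewrite !hornerE.
  rewrite [X in is_derive _ _ _ X](_ : d = (deriv (c%:P + d *: 'X)).[x]); first exact: is_derive_poly.
  by rewrite derivD derivZ derivX derivC add0r hornerZ hornerC mulr1.
have q1 := prim_sub zk0 zkL p1; have q2 := prim_sub zk0 zkL p2.
have [ek dk] := ez k (ltnW kJ); have [ek1 dk1] := ez k.+1 kJ.
have H := prim_by_parts zk q2 dphi (@cst_continuous _ _ d).
have E1 : rint (z k) (z k.+1) (fun x => w2 x 0 i * D2 e x 0 i) =
   rint (z k) (z k.+1) (fun x => D2 e x 0 i * phi x).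
  by apply: eq_rint => x xk; rewrite (cd x xk) mulrC.
have E2 : rint (z k) (z k.+1) (fun x => D1 e x 0 i * d) = 0.
  have -> : rint (z k) (z k.+1) (fun x => D1 e x 0 i * d) =
     rint (z k) (z k.+1) (fun x => d * D1 e x 0 i).
    by apply: eq_rint => x _; exact: mulrC.
  rewrite rintZ; last exact: sqi_ible q1.1.
  rewrite -(prim_diff q1 (lexx _) zk (lexx _)) ek ek1 !mxE subrr mulr0 //.
by move: H; rewrite E2 E1 dk dk1 !mxE !mul0r subrr sub0r => /eqP; rewrite eq_sym oppr_eq0 => /eqP.
Qed.

End interpolation.

End cubic_splines.

(** * Gamma-convergence *)

Section coercivity.
Context {R : realType}.
Variables (m ell : nat) (L : R) (L0 : 0 < L).
Implicit Types (v w u : R -> 'rV[R]_m) (i : 'I_m).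
#[local] Opaque wderiv rint.
Local Notation D1 := (wderiv L).
Local Notation D2 v := (wderiv L (wderiv L v)).
Variable F : (R -> 'rV[R]_m) -> 'rV[R]_ell.
Hypotheses (F_bounded : bounded_linear_H2 L F) (F_norm : norm_on_kernel L F).

Let zL : (0 : R) \in `[0, L]. Proof. by rewrite in_itv /= lexx ltW. Qed.

Definition affine_fun (p q : 'rV[R]_m) : R -> 'rV[R]_m := fun x => p + x *: q.

Lemma affine_rep p q : H2rep L (affine_fun p q) (fun=> q) (fun=> 0).
Proof.
move=> i; split; split; [exact: sqi_cst| |by rewrite !mxE; exact: sqi_cst|].
  move=> x /[!in_itv] /= /andP[x0 xL].
  by rewrite rint_cst // !mxE subr0 mul0r addr0 mulrC.
move=> x /[!in_itv] /= /andP[x0 xL].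
by rewrite rint_cst // !mxE mul0r addr0.
Qed.

Lemma affine_H2 p q : H2 L (affine_fun p q).
Proof. exact: H2rep_H2 L0 (affine_rep p q). Qed.

Lemma affine_bend p q : bend L (affine_fun p q) (affine_fun p q) = 0.
Proof.
rewrite (bend_rep L0 (affine_rep p q) (affine_rep p q)); apply: big1 => i _.
by rewrite (@eq_rint _ _ _ _ (fun=> 0)) ?rint_cst ?mul0r ?ltW // => x _; rewrite !mxE mulr0.
Qed.

Lemma L2norm_D2 v : H2 L v -> L2norm L (D2 v) ^+ 2 = bend L v v.
Proof.
move=> hv; rewrite L2norm_sqr; last by move=> i; exact: D2_sqi.
by apply: eq_bigr => i _; apply: eq_rint => x _; rewrite expr2.
Qed.

(** Intercept and slope are concatenated into one row vector, so that matrix algebra applies. *)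
Let f (x : 'rV[R]_(m + m)) : 'rV[R]_ell := F (affine_fun (lsubmx x) (rsubmx x)).

Let f_linear a x y : f (a *: x + y) = a *: f x + f y.
Proof.
have [lF _] := F_bounded; rewrite /f -lF; [|exact: affine_H2..].
congr F; apply/funext => t; rewrite /affine_fun.
by apply/rowP => i; rewrite !mxE; ring.
Qed.

Let f_inj x : f x = 0 -> x = 0.
Proof.
move=> fx; have h := affine_H2 (lsubmx x) (rsubmx x).
have := F_norm h fx => H.
have {}H : forall t, t \in `[0, L] -> affine_fun (lsubmx x) (rsubmx x) t = 0.
  apply: H; apply/eqP; rewrite -sqrf_eq0 (L2norm_D2 h) affine_bend; exact/eqP.
have l0 : lsubmx x = 0 by have := H 0 zL; rewrite /affine_fun scale0r addr0.
have LL : L \in `[0, L] by rewrite in_itv /= lexx ltW.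
have r0 : rsubmx x = 0.
  have := H L LL; rewrite /affine_fun l0 add0r => /eqP.
  by rewrite scaler_eq0 gt_eqF //= => /eqP.
by rewrite -[x]hsubmxK l0 r0 row_mx0.
Qed.

(** The restriction to affine functions is an injective map of finite-dimensional spaces: its matrix
    has a right inverse [N], and B is the sum of the absolute values of the entries of [N]. *)
Lemma affine_coercive : exists2 B, 0 <= B & forall (p q : 'rV[R]_m) i,
  `|p 0 i| <= B * `|F (affine_fun p q)| /\ `|q 0 i| <= B * `|F (affine_fun p q)|.
Proof.
pose fL : {linear 'rV[R]_(m + m) -> 'rV[R]_ell} :=
  HB.pack f (GRing.isLinear.Build R 'rV[R]_(m + m) 'rV[R]_ell _ f f_linear).
have fM x : x *m lin1_mx fL = f x by rewrite mul_rV_lin1.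
have /row_freeP[N MN] : row_free (lin1_mx fL).
  by apply: inj_row_free => x; rewrite fM; exact: f_inj.
exists (\sum_j \sum_k `|N j k|).
  by apply: sumr_ge0 => j _; apply: sumr_ge0 => k _.
move=> p q i; set x := row_mx p q.
have fx : f x = F (affine_fun p q) by rewrite /f row_mxKl row_mxKr.
have xN : x = f x *m N by rewrite -fM -mulmxA MN mulmx1.
have bnd k : `|x 0 k| <= (\sum_j \sum_k `|N j k|) * `|F (affine_fun p q)|.
  rewrite xN mxE -fx mulr_suml; apply: le_trans (ler_norm_sum _ _ _) _.
  apply: ler_sum => j _; rewrite normrM mulrC; apply: ler_pM => //.
    by rewrite (bigD1 k) //= lerDl sumr_ge0.
  exact: row_normr_le.
split; [have := bnd (lshift m i)|have := bnd (rshift m i)].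
  by rewrite row_mxEl.
by rewrite row_mxEr.
Qed.

(* Split off the affine part of [v] at [0]: the rest is controlled by [v''], and
   the affine part by [F] because [F] is injective on affine functions. *)
Lemma NN_coercive : exists2 K, 0 <= K & forall v, H2 L v ->
  NN L v <= K * (`|F v| ^+ 2 + bend L v v).
Proof.
have [B B0 hB] := affine_coercive; have [lF [C hC]] := F_bounded.
have [K1 K10 hK1] := @H2norm_le_NN R m L L0.
(* There are m components, each with an intercept and a slope bounded by B times the norm of the
   value of F. *)
pose M := m%:R * 2 * B ^+ 2.
have M0 : 0 <= M by rewrite !mulr_ge0 // sqr_ge0.
have CK : 0 <= C ^+ 2 * K1 by rewrite mulr_ge0 ?sqr_ge0.
exists (2 * M + 2 * M * (C ^+ 2 * K1) + 1).
  have := mulr_ge0 M0 CK; move: (C ^+ 2 * K1) M M0 {CK} => D M' M'0; lra.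
move=> v hv; set p := v 0; set q := D1 v 0.
have ha := affine_H2 p q.
pose V := comb 1 (-1) v (affine_fun p q).
have hV : H2 L V by exact: H2_comb.
have rV := H2rep_comb 1 (-1) (H2_rep L0 hv) (affine_rep p q).
(* V and V' vanish at 0, and V'' = v''. *)
have NV : NN L V = bend L v v.
  rewrite (NN_rep L0 rV); apply: eq_bigr => i _.
  rewrite !combE !mxE mul0r addr0 mul1r mulN1r subrr !mul1r !mulN1r subrr expr0n /= !add0r.
  by apply: eq_rint => x _; rewrite combE mxE mulr0 addr0 mul1r expr2.
have FV : `|F V| ^+ 2 <= C ^+ 2 * K1 * bend L v v.
  apply: (@le_trans _ _ ((C * H2norm L V) ^+ 2)).
    by rewrite ler_sqr ?nnegrE ?hC //; apply: le_trans (hC V hV).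
  by rewrite exprMn -mulrA -NV; apply: ler_wpM2l; [exact: sqr_ge0|exact: hK1].
have Fa : `|F (affine_fun p q)| ^+ 2 <= 2 * `|F v| ^+ 2 + 2 * `|F V| ^+ 2.
  have -> : F (affine_fun p q) = F v - F V.
    by rewrite /V (bounded_linear_comb L0 _ _ F_bounded hv ha) scale1r scaleN1r opprB addrC subrK.
  have := ler_normB (F v) (F V); have := normr_ge0 (F v - F V).
  move: `|F v - F V| `|F v| `|F V| => a b c a0 abc.
  have : a ^+ 2 <= (b + c) ^+ 2 by rewrite ler_sqr ?nnegrE // (le_trans a0).
  have := sqr_ge0 (b - c); nra.
have P0 : pair0 L v v <= M * `|F (affine_fun p q)| ^+ 2.
  rewrite /M -!mulrA mulr_natl -[X in _ *+ X](card_ord m) -sumr_const.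
  apply: ler_sum => i _; have [h1 h2] := hB p q i.
  rewrite -!expr2 mulrA.
  have sq (t : R) : `|t| <= B * `|F (affine_fun p q)| -> t ^+ 2 <= B ^+ 2 * `|F (affine_fun p q)| ^+ 2.
    move=> ht; rewrite -exprMn -[t ^+ 2]real_normK ?num_real //.
    by rewrite ler_sqr ?nnegrE // mulr_ge0.
  by have := sq _ h1; have := sq _ h2; rewrite -/p -/q -mulrA; lra.
have arith (P G Q b g D : R) : 0 <= D -> 0 <= b -> 0 <= g -> P <= M * G -> G <= 2 * g + 2 * Q ->
    Q <= D * b -> P + b <= (2 * M + 2 * M * D + 1) * (g + b).
  move=> D0 b0 g0 h1 h2 h3.
  have h4 := ler_wpM2l M0 h2; have h5 := ler_wpM2l M0 h3.
  have t1 := mulr_ge0 M0 b0; have t2 := mulr_ge0 (mulr_ge0 M0 D0) g0.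
  lra.
exact: arith CK (bend_ge0 L v) (sqr_ge0 _) P0 Fa FV.
Qed.

End coercivity.

(** * Auxiliary facts on sequences *)

Section sequences.
Context {R : realType}.

Lemma enorm_sqr (m : nat) (v : 'rV[R]_m) : enorm v ^+ 2 = \sum_i v 0 i ^+ 2.
Proof.
rewrite sqr_sqrtr; first by apply: eq_bigr => i _; rewrite expr2.
by apply: sumr_ge0 => i _; rewrite -expr2 sqr_ge0.
Qed.

Lemma row_cvg (m : nat) (a : nat -> 'rV[R]_m) (b : 'rV[R]_m) :
  (forall i, a n 0 i @[n --> \oo] --> b 0 i) -> a n @[n --> \oo] --> b.
Proof.
move=> ab; apply/cvgrPdist_lt => e e0.
have : \forall n \near \oo, forall i, `|b 0 i - a n 0 i| < e.
  by apply: filter_forall => i; have /cvgrPdist_lt := ab i; apply.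
apply: filterS => n h; apply: row_normr_lt => // i; rewrite !mxE; exact: h.
Qed.

Lemma homo_ge_id (s : nat -> nat) n : {homo s : i j / (i < j)%N} -> (n <= s n)%N.
Proof.
by move=> smono; elim: n => // n IH; apply: leq_ltn_trans IH _; exact: smono.
Qed.

Lemma cvg_subseq (T : topologicalType) (a : nat -> T) (l : T) (s : nat -> nat) :
  {homo s : i j / (i < j)%N} -> a n @[n --> \oo] --> l -> a (s n) @[n --> \oo] --> l.
Proof.
move=> smono al; apply: cvg_comp al.
move=> A [N _ hN]; exists N => // n /= Nn; apply: hN => /=.
exact: leq_trans Nn (homo_ge_id n smono).
Qed.

Lemma cvg_of_sqr_dist (a b t : nat -> R) (c l : R) :
  (forall n, (b n - a n) ^+ 2 <= c * t n) -> t n @[n --> \oo] --> (0 : R) ->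
  b n @[n --> \oo] --> l -> a n @[n --> \oo] --> l.
Proof.
move=> abt t0 bl; have c0 : c * t n @[n --> \oo] --> (0 : R).
  by rewrite -(mulr0 c); apply: cvgMr.
apply/cvgrPdist_lt => e e0; have e2 : 0 < e / 2 by rewrite divr_gt0.
have e4 : 0 < (e / 2) ^+ 2 by rewrite exprn_gt0.
move/cvgrPdist_lt : c0 => /(_ _ e4) [N1 _ h1].
move/cvgrPdist_lt : bl => /(_ _ e2) [N2 _ h2].
exists (maxn N1 N2) => // n /=; rewrite geq_max => /andP[/h1 /= n1 /h2 /= n2].
have -> : l - a n = (l - b n) + (b n - a n) by rewrite addrA subrK.
apply: le_lt_trans (ler_normD _ _) _; rewrite (splitr e); apply: ltrD => //.
rewrite -ltr_sqr ?nnegrE ?(ltW e2) // real_normK ?num_real //.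
apply: le_lt_trans (abt n) _; apply: le_lt_trans n1.
by rewrite sub0r normrN ler_norm.
Qed.

End sequences.

(** * Limits of discretely admissible functions and recovery sequences *)

Section passage_to_limit.
Context {R : realType}.
Variables (L : R) (L0 : 0 < L).
Variables (Phi : 'rV[R]_3 -> R) (Phi_cont : continuous Phi).
Variables (ell : nat) (Lbc : (R -> 'rV[R]_3) -> 'rV[R]_ell) (lbc : 'rV[R]_ell).
Hypothesis Lbc_bounded : bounded_linear_H2 L Lbc.
Variables (J : nat -> nat) (z : nat -> nat -> R).
Hypothesis z_partition : forall n, is_partition L (J n) (z n).
Hypothesis mesh_cvg0 : mesh_size (J n) (z n) @[n --> \oo] --> (0 : R).
#[local] Opaque wderiv rint.
Local Notation D1 := (wderiv L).

Lemma nodes_cvg x : x \in `[0, L] -> exists j : nat -> nat,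
  (forall n, (j n <= J n)%N) /\ `|x - z n (j n)| @[n --> \oo] --> (0 : R).
Proof.
move=> xL.
have /choice[j hj] n : exists j, (j <= J n)%N /\ `|x - z n j| <= mesh_size (J n) (z n).
  by have [j h1 h2] := partition_near (z_partition n) xL; exists j.
exists j; split; first by move=> n; have [] := hj n.
by apply: cvg0_le mesh_cvg0 => n //; have [_] := hj n.
Qed.

Lemma node_values_cvg (m : nat) (u_ : nat -> R -> 'rV[R]_m) (u : R -> 'rV[R]_m) (C : R) x (y : nat -> R) i :
  (forall n, H2 L (u_ n)) -> H2 L u -> (forall n, NN L (u_ n) <= C) -> H2_weak_cvg L u_ u ->
  x \in `[0, L] -> (forall n, y n \in `[0, L]) -> `|x - y n| @[n --> \oo] --> (0 : R) ->
  u_ n (y n) 0 i @[n --> \oo] --> u x 0 i /\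
  D1 (u_ n) (y n) 0 i @[n --> \oo] --> D1 u x 0 i.
Proof.
move=> hu_ hu uC wk xL yL xy; have [K K0 hK] := @holder_NN R m L L0.
have h n := hK _ _ _ i (hu_ n) xL (yL n).
have kc n : K * `|x - y n| * NN L (u_ n) <= K * C * `|x - y n|.
  by rewrite mulrAC; apply: ler_wpM2r => //; exact: ler_wpM2l.
split; [apply: (cvg_of_sqr_dist (c := K * C) (b := fun n => u_ n x 0 i) _ xy)
       |apply: (cvg_of_sqr_dist (c := K * C) (b := fun n => D1 (u_ n) x 0 i) _ xy)].
- by move=> n; apply: le_trans (kc n); have [] := h n.
- exact: wk (eval_bounded_linear L0 i xL).
- by move=> n; apply: le_trans (kc n); have [] := h n.
- exact: wk (D1_bounded_linear L0 i xL).
Qed.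

Lemma bounded_linear_weak_cvg (u_ : nat -> R -> 'rV[R]_3) (u : R -> 'rV[R]_3) :
  (forall n, Lbc (u_ n) = lbc) -> H2_weak_cvg L u_ u -> Lbc u = lbc.
Proof.
move=> ulbc wk; have [lF [C hC]] := Lbc_bounded; apply/rowP => i.
have bF : bounded_linear_H2 L (fun v => Lbc v 0 i : R^o).
  split; first by move=> a v w hv hw; rewrite lF // !mxE.
  by exists C => v hv; apply: le_trans (hC v hv); exact: row_normr_le.
have := wk _ bF; under eq_fun do rewrite ulbc.
by move=> /(cvg_unique _ (cvg_cst _)) ->.
Qed.

Lemma limit_admissible (u_ : nat -> R -> 'rV[R]_3) (u : R -> 'rV[R]_3) (C : R) :
  (forall n, discrete_admissible L Phi Lbc lbc (J n) (z n) (u_ n)) ->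
  (forall n, NN L (u_ n) <= C) -> H2 L u -> H2_weak_cvg L u_ u ->
  admissible L Phi Lbc lbc u.
Proof.
move=> ua uC hu wk.
have hu_ n : H2 L (u_ n) by have [cu _ _ _] := ua n; exact: (C1_cubics_H2 L0 (z_partition n)).
split => //.
- move=> x xL; have [j [jJ xj]] := nodes_cvg xL.
  have jL n : z n (j n) \in `[0, L] by exact: partition_itv.
  have h i := (node_values_cvg i hu_ hu uC wk xL jL xj).2.
  have : enorm (D1 (u_ n) (z n (j n))) ^+ 2 @[n --> \oo] --> enorm (D1 u x) ^+ 2.
    rewrite enorm_sqr; under eq_fun do rewrite enorm_sqr.
    apply: cvg_big => [|i _]; first exact: add_continuous.
    by under eq_fun do rewrite expr2; rewrite expr2; exact: cvgM (h i) (h i).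
  under eq_fun => n do (have [_ -> // _ _] := ua n; rewrite expr1n).
  by move=> /(cvg_unique (@Rhausdorff R) (cvg_cst (1 : R)))/esym.
- move=> x xL; have [j [jJ xj]] := nodes_cvg xL.
  have jL n : z n (j n) \in `[0, L] by exact: partition_itv.
  have h i := (node_values_cvg i hu_ hu uC wk xL jL xj).1.
  have := cvg_comp _ _ (row_cvg h) (@Phi_cont (u x)).
  rewrite (_ : _ \o _ = fun=> 0); last first.
    by apply/funext => n /=; have [_ _ -> //] := ua n.
  by move=> /(cvg_unique (@Rhausdorff R) (cvg_cst (0 : R)))/esym.
- by apply: bounded_linear_weak_cvg wk => n; have [] := ua n.
Qed.

Hypothesis Lbc_boundary : boundary_only L Lbc.

(** As 0 is a node, w and u share the data at 0, so the distance reduces to the bending of w - u;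
    orthogonality then gives the Pythagorean identity. *)
Lemma interpolant_facts n (u w : R -> 'rV[R]_3) : H2 L u -> C1_cubics L (J n) (z n) w ->
  (forall j, (j <= J n)%N -> w (z n j) = u (z n j) /\ D1 w (z n j) = D1 u (z n j)) ->
  pair0 L w w = pair0 L u u /\
  NN L (comb 1 (-1) w u) = bend L u u - bend L w w.
Proof.
move=> hu Cw wn; have hw := C1_cubics_H2 L0 (z_partition n) Cw.
have [z0 zJ _] := z_partition n.
have [w0 dw0] : w 0 = u 0 /\ D1 w 0 = D1 u 0 by rewrite -z0; exact: wn.
split; first by rewrite /pair0 w0 dw0.
have he := H2_comb L0 1 (-1) hw hu.
have eN j : (j <= J n)%N -> comb 1 (-1) w u (z n j) = 0 /\ D1 (comb 1 (-1) w u) (z n j) = 0.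
  move=> jJ; have [h1 h2] := wn j jJ; have zjL := partition_itv (z_partition n) jJ.
  rewrite (D1_comb L0 1 (-1) hw hu zjL) h2 /comb h1.
  by rewrite !scale1r !scaleN1r !subrr.
have orth := spline_orthogonality L0 (z_partition n) Cw he eN.
have [e0 de0] : comb 1 (-1) w u 0 = 0 /\ D1 (comb 1 (-1) w u) 0 = 0 by rewrite -z0; exact: eN.
have p0 : pair0 L (comb 1 (-1) w u) (comb 1 (-1) w u) = 0.
  by rewrite /pair0 e0 de0; apply: big1 => i _; rewrite mxE mulr0 addr0.
rewrite /NN /NB p0 add0r (bend_comb L0 1 (-1) hw hu).
move: orth; rewrite bendC (bend_combl L0 1 (-1) hw hu hw) (bendC L u w).
by move: (bend L w w) (bend L w u) (bend L u u) => A B D; lra.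
Qed.

(** The last conclusion holds for every n and not just in the limit; it is what bounds the discrete
    infima when quasiminimizers are compared with admissible functions. *)
Lemma recovery (u : R -> 'rV[R]_3) : admissible L Phi Lbc lbc u ->
  exists w_ : nat -> R -> 'rV[R]_3,
    [/\ forall n, discrete_admissible L Phi Lbc lbc (J n) (z n) (w_ n),
        H2_strong_cvg L w_ u,
        bend L (w_ n) (w_ n) @[n --> \oo] --> bend L u u &
        forall n, bend L (w_ n) (w_ n) <= bend L u u].
Proof.
move=> [hu u1 uPhi ulbc].
have /choice[w hw] n := hermite_interpolant L0 (z_partition n) u.
have Cw n : C1_cubics L (J n) (z n) (w n) by have [] := hw n.
have wn n := (hw n).2.
have hw_ n : H2 L (w n) by exact: C1_cubics_H2 L0 (z_partition n) _ _ (Cw n).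
have facts n := interpolant_facts hu (Cw n) (wn n).
have wu n : bend L (w n) (w n) <= bend L u u.
  by rewrite -subr_ge0 -(facts n).2; exact: NN_ge0.
have wC n : NN L (w n) <= NN L u.
  by rewrite /NN /NB (facts n).1 lerD2l.
have pc q i : setT q -> q \in `[0, L] -> w n q 0 i @[n --> \oo] --> u q 0 i.
  move=> _ qL; have [j [jJ qj]] := nodes_cvg qL.
  have jL n : z n (j n) \in `[0, L] by exact: partition_itv.
  have [K K0 hK] := @holder_NN R 3 L L0.
  have uj : u (z n (j n)) 0 i @[n --> \oo] --> u q 0 i.
    apply: (cvg_of_sqr_dist (c := K * NN L u) (b := fun=> u q 0 i) _ qj (cvg_cst _)) => n.
    by rewrite mulrAC; have [] := hK u q (z n (j n)) i hu qL (jL n).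
  (* The value of w at q is compared with its value at the nearby node, which is that of u; the
     Hoelder bound is uniform in n because [NN] of w is at most that of u. *)
  apply: (cvg_of_sqr_dist (c := K * NN L u) _ qj uj) => n.
  have [<- _] := wn n _ (jJ n).
  have [h _] := hK (w n) (z n (j n)) q i (hw_ n) (jL n) qL.
  have H (k t a b : R) : 0 <= k -> 0 <= t -> a <= b -> k * t * a <= k * b * t.
    by move=> k0 t0 ab; rewrite mulrAC; apply: ler_wpM2r => //; exact: ler_wpM2l.
  by rewrite (distrC q); apply: (le_trans h); exact: H.
have dense x e : x \in `[0, L] -> 0 < e ->
    exists q, [/\ [set: R] q, q \in `[0, L] & `|x - q| < e].
  by move=> xL e0; exists x; rewrite subrr normr0.
have wk : H2_weak_cvg L w u by exact: (weak_cvg_pointwise L0 dense hw_ hu wC pc).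
have bw : bend L (w n) (w n) @[n --> \oo] --> bend L u u.
  apply/cvgrPdist_le => e e0; have := bend_lsc L0 hw_ hu wk e0.
  apply: filterS => n /= h; rewrite ger0_norm; last by rewrite subr_ge0; exact: wu.
  by rewrite lerBlDr addrC -lerBlDr.
exists w; split => // [n|].
  have [z0 zJ _] := z_partition n.
  split.
  - exact: Cw.
  - move=> j jJ; have [_ ->] := wn n j jJ.
    have := u1 _ (partition_itv (z_partition n) jJ) => /eqP.
    by rewrite sqr_norm_eq1 ger0_norm ?sqrtr_ge0 // => /eqP.
  - by move=> j jJ; have [-> _] := wn n j jJ; apply: uPhi; exact: partition_itv.
  (* Values and slopes agree at both end nodes, and these determine the boundary operator. *)
  - have := wn n 0%N (leq0n _); rewrite z0 => -[w0 dw0].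
    have := wn n (J n) (leqnn _); rewrite zJ => -[wJ dwJ].
    by rewrite -ulbc; exact: Lbc_boundary.
apply: (H2norm_dist_cvg L0 hw_ hu).
under eq_fun => n do rewrite (facts n).2.
rewrite -(subrr (bend L u u)); apply: cvgB bw; exact: cvg_cst.
Qed.

End passage_to_limit.
Theorem corollary2p5 (R : realType) (L : R) (L_gt0 : 0 < L)
  (Phi : 'rV[R]_3 -> R) (Phi_C1 : C1_fun Phi) (S_regular : regular_zero_set Phi)
  (ell : nat) (Lbc : (R -> 'rV[R]_3) -> 'rV[R]_ell) (lbc : 'rV[R]_ell)
  (Lbc_bounded : bounded_linear_H2 L Lbc)
  (Lbc_boundary : boundary_only L Lbc)
  (A_nonempty : admissible L Phi Lbc lbc !=set0)
  (Lbc_norm : norm_on_kernel L Lbc)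
  (H3_dense : forall u, admissible L Phi Lbc lbc u -> forall e : R, 0 < e ->
     exists w, [/\ admissible L Phi Lbc lbc w, sobolev L 3 w &
                   H2norm L (fun x => w x - u x) < e])
  (J : nat -> nat) (z : nat -> nat -> R)
  (z_partition : forall n, is_partition L (J n) (z n))
  (mesh_cvg0 : mesh_size (J n) (z n) @[n --> \oo] --> (0 : R)) :
  [/\ forall (u_ : nat -> R -> 'rV[R]_3) (c : R),
        (forall n, discrete_admissible L Phi Lbc lbc (J n) (z n) (u_ n)) ->
        (forall n, bending_energy L (u_ n) <= c) ->
        exists (u : R -> 'rV[R]_3) (s : nat -> nat),
          [/\ admissible L Phi Lbc lbc u,
              {homo s : m n / (m < n)%N},
              H2_weak_cvg L (fun n => u_ (s n)) u &
              ((bending_energy L u)%:E <=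
                 limn_einf (fun n => (bending_energy L (u_ (s n)))%:E))%E],
      forall u : R -> 'rV[R]_3, admissible L Phi Lbc lbc u ->
        exists u_ : nat -> R -> 'rV[R]_3,
          [/\ forall n, discrete_admissible L Phi Lbc lbc (J n) (z n) (u_ n),
              H2_strong_cvg L u_ u &
              bending_energy L (u_ n) @[n --> \oo] --> bending_energy L u] &
      forall (u_ : nat -> R -> 'rV[R]_3) (eps : nat -> R),
        (forall n, discrete_admissible L Phi Lbc lbc (J n) (z n) (u_ n)) ->
        (forall n, 0 <= eps n) ->
        eps n @[n --> \oo] --> (0 : R) ->
        (forall n, bending_energy L (u_ n) <=
           inf [set bending_energy L w | w in
                  discrete_admissible L Phi Lbc lbc (J n) (z n)] + eps n) ->
        forall (u : R -> 'rV[R]_3) (s : nat -> nat),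
          H2 L u ->
          {homo s : m n / (m < n)%N} ->
          H2_weak_cvg L (fun n => u_ (s n)) u ->
          admissible L Phi Lbc lbc u /\
          forall w, admissible L Phi Lbc lbc w ->
            bending_energy L u <= bending_energy L w].

Proof.
have Phi_cont : continuous Phi by move=> s; apply: differentiable_continuous; case: Phi_C1.
have [K K0 coer] := NN_coercive L_gt0 Lbc_bounded Lbc_norm.
have dH2 n v : discrete_admissible L Phi Lbc lbc (J n) (z n) v -> H2 L v.
  by case=> cv _ _ _; exact: C1_cubics_H2 L_gt0 (z_partition n) _ _ cv.
have dNN n v C : discrete_admissible L Phi Lbc lbc (J n) (z n) v -> bend L v v <= C ->
    NN L v <= K * (`|lbc| ^+ 2 + C).
  move=> dv vC; apply: le_trans (coer v (dH2 n v dv)) _.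
  by case: dv => _ _ _ ->; apply: ler_wpM2l => //; rewrite lerD2l.
have sub s (smono : {homo s : m n / (m < n)%N}) :
    mesh_size (J (s n)) (z (s n)) @[n --> \oo] --> (0 : R).
  exact: cvg_subseq smono mesh_cvg0.
split.
- move=> u_ c du uc; have hu_ n := dH2 n _ (du n).
  have uC n : NN L (u_ n) <= K * (`|lbc| ^+ 2 + 2 * c).
    apply: (dNN n _ _ (du n)); have := uc n; rewrite (bending_energyE L_gt0 (hu_ n)).
    by move: (bend _ _ _) => b; lra.
  have [u [s [hu smono wk]]] := weak_compactness L_gt0 hu_ uC.
  exists u, s; split => //.
    exact: (limit_admissible L_gt0 Phi_cont Lbc_bounded (fun n => z_partition (s n))
      (sub s smono) (fun n => du (s n)) (fun n => uC (s n)) hu wk).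
  apply/lee_addgt0Pr => e e0; rewrite -leeBlDr // -EFinB; apply: limn_einf_ge.
  have := bend_lsc L_gt0 (fun n => hu_ (s n)) hu wk e0; apply: filterS => n.
  rewrite lee_fin (bending_energyE L_gt0 hu) (bending_energyE L_gt0 (hu_ (s n))).
  by move: (bend L u u) (bend _ _ _) => a b; lra.
- move=> u au; have hu : H2 L u by case: au.
  have [w [dw wu bw _]] :=
    recovery L_gt0 z_partition mesh_cvg0 Lbc_boundary au.
  exists w; split => //; rewrite (bending_energyE L_gt0 hu).
  under eq_fun => n do rewrite (bending_energyE L_gt0 (dH2 n _ (dw n))).
  by apply: cvgMr.
move=> u_ eps du eps0 epscvg uinf u s hu smono wk; have hu_ n := dH2 n _ (du n).
(* The infimum is compared with the energy of the interpolant of w, at most that of w. The factor 2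
   offsets the 1/2 in the energy. *)
have quasi w : admissible L Phi Lbc lbc w -> forall n,
    bend L (u_ n) (u_ n) <= bend L w w + 2 * eps n.
  move=> aw n; have [v [dv _ _ vw]] :=
    recovery L_gt0 z_partition mesh_cvg0 Lbc_boundary aw.
  have := uinf n; rewrite (bending_energyE L_gt0 (hu_ n)).
  have : inf [set bending_energy L w | w in discrete_admissible L Phi Lbc lbc (J n) (z n)]
      <= bending_energy L (v n).
    apply: ge_inf; last by exists (v n).
    exists 0 => _ [x dx <-]; rewrite (bending_energyE L_gt0 (dH2 n _ dx)).
    by rewrite mulr_ge0 ?bend_ge0.
  rewrite (bending_energyE L_gt0 (dH2 n _ (dv n))); have := vw n.
  by move: (inf _) (bend _ _ _) (bend _ _ _) (bend _ _ _) => a b d e; lra.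
have [M epsM] : exists M, forall n, eps n <= M.
  have /cvg_seq_bounded/pinfty_ex_gt0[M _ hM] : cvgn eps by apply/cvg_ex; exists 0.
  by exists M => n; apply: le_trans (ler_norm _) _; exact: hM.
have au : admissible L Phi Lbc lbc u.
  (* Any fixed competitor bounds the energies of the quasiminimizers. *)
  have [w0 aw0] := A_nonempty.
  apply: (limit_admissible L_gt0 Phi_cont Lbc_bounded (fun n => z_partition (s n))
      (sub s smono) (fun n => du (s n)) _ hu wk) => n.
  apply: (dNN (s n) _ (bend L w0 w0 + 2 * M) (du (s n))).
  apply: le_trans (quasi _ aw0 (s n)) _; rewrite lerD2l; apply: ler_wpM2l => //.
split; [exact: au|move=> w aw]; apply/ler_addgt0Pr => e e0.
have hw : H2 L w by case: aw.
have /cvgrPdist_le/(_ _ (divr_gt0 e0 (@ltr0Sn R 1))) h1 := cvg_subseq smono epscvg.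
(* One index suffices: bend u <= bend w + 2 eps + e with eps <= e / 2, and halving turns the excess
   2 e into e. *)
have [n [/= h2 h3]] := filter_ex (filterI h1 (bend_lsc L_gt0 (fun n => hu_ (s n)) hu wk e0)).
have := quasi w aw (s n); rewrite (bending_energyE L_gt0 hu) (bending_energyE L_gt0 hw).
move: h2 h3; rewrite sub0r normrN ger0_norm //.
by move: (eps _) (bend L u u) (bend L w w) (bend _ _ _) => a b d f; lra.
Qed.
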